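(* Let $k\ge1$ be an integer and let $\gamma\colon[a,b]\to\mathbf{R}^{2+k}$ be a rectifiable curve with length $L$, width $w$ and inradius $r$. Then $$L\geq\sqrt{2.2782^2+9k}\;w\quad\text{and}\quad L\geq\sqrt{(\pi+2)^2+36k}\;r.$$ Further, if $\gamma$ is closed, then $$L\geq\sqrt{\pi^2+16k}\;w\quad\text{and}\quad L\geq\sqrt{(6\sqrt3)^2+64(k-1)}\;r.$$
   Context: The width $w$ of $\gamma$ is the infimum of the distances between pairs of parallel hyperplanes of $\mathbf{R}^{2+k}$ between which $\gamma$ lies. The inradius $r$ of $\gamma$ is the supremum of the radii of all spheres which are contained in the convex hull of $\gamma$ and are disjoint from $\gamma$. *)

(* Defs.v *)
From HB Require Import structures.
From mathcomp Require Import all_boot all_order all_algebra.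
From mathcomp Require Import all_classical all_reals all_analysis.
Set Implicit Arguments. Unset Strict Implicit. Unset Printing Implicit Defensive.
Import Order.TTheory GRing.Theory Num.Theory.
Import numFieldNormedType.Exports.
Local Open Scope classical_set_scope.
Local Open Scope ring_scope.

Section CurveDefs.
Variables (R : realType) (n : nat).

Definition edot (u v : 'rV[R]_n) : R := \sum_(i < n) u ord0 i * v ord0 i.
Definition enorm (u : 'rV[R]_n) : R := Num.sqrt (edot u u).

Definition polygonal_lengths (a b : R) (gamma : R -> 'rV[R]_n) : set R :=
  [set s | exists (m : nat) (t : nat -> R),
      [/\ t 0%N = a, t m = b, (forall i, (i < m)%N -> t i <= t i.+1) &
          s = \sum_(i < m) enorm (gamma (t i.+1) - gamma (t i))]].

Definition rectifiable (a b : R) (gamma : R -> 'rV[R]_n) : Prop :=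
  has_ubound (polygonal_lengths a b gamma).

Definition curve_length (a b : R) (gamma : R -> 'rV[R]_n) : R :=
  sup (polygonal_lengths a b gamma).

Definition slab_widths (a b : R) (gamma : R -> 'rV[R]_n) : set R :=
  [set d | exists (u : 'rV[R]_n) (alpha beta : R),
      [/\ enorm u = 1,
          (forall t, a <= t <= b -> alpha <= edot u (gamma t) <= beta) &
          d = beta - alpha]].

Definition curve_width (a b : R) (gamma : R -> 'rV[R]_n) : R :=
  inf (slab_widths a b gamma).

Definition curve_hull (a b : R) (gamma : R -> 'rV[R]_n) : set 'rV[R]_n :=
  [set x | exists (m : nat) (t : 'I_m -> R) (l : 'I_m -> R),
      [/\ (forall i, a <= t i <= b), (forall i, 0 <= l i),
          \sum_(i < m) l i = 1 &
          x = \sum_(i < m) l i *: gamma (t i)]].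

Definition esphere (c : 'rV[R]_n) (rho : R) : set 'rV[R]_n :=
  [set x | enorm (x - c) = rho].

Definition inradii (a b : R) (gamma : R -> 'rV[R]_n) : set R :=
  [set rho | 0 <= rho /\ exists c : 'rV[R]_n,
      esphere c rho `<=` curve_hull a b gamma /\
      (forall t, a <= t <= b -> enorm (gamma t - c) != rho)].

Definition curve_inradius (a b : R) (gamma : R -> 'rV[R]_n) : R :=
  sup (inradii a b gamma).

End CurveDefs.

(* Main.v *)
(* Proof idea.  By rectifiability the curve may be replaced by an inscribed polygon.  In
   dimension at least 3, Tucker's lemma on a grid of directions that covers half a sphere gives a
   direction u in which the polygon comes alternately close to its two extreme levels at four
   successive times, so that its projection on u has variation at least three times the width
   (four times if it is closed).
   Projecting along u keeps the hypotheses, and the lengths add like the sides of a right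
   triangle.  This reduces everything to the following bounds.

   - Planar width: an average of |u.e| over well chosen directions u bounds the length of an
     edge e from below, and the variation in the direction u is at least 2 w - |u.s|, where s
     joins the end points (s = 0 for closed curves).
   - Planar inradius (radius 1): a vertex p outside the disc sees the arc {u : u.p > 1}, and
     these arcs cover the circle.  If an edge crosses the disc, compare the lengths of the edges
     with the arcs gained and lost along the path; otherwise compare the path with the geodesics
     around the disc.
   - Closed curves in space (inradius 1): the caps {u : u.p > 1} cover the sphere, so over the
     closed polygon the areas gained and lost add up to at least twice the area of the sphere,
     while an edge of length d changes the cap by at most d / (3 sqrt 3) times that area. *)
Require Import Defs.
From HB Require Import structures.
From mathcomp Require Import all_boot all_order all_algebra.
From mathcomp Require Import all_classical all_reals all_analysis.
From mathcomp Require Import ring lra zify.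
Import Order.TTheory GRing.Theory Num.Theory.
Import numFieldNormedType.Exports.
Local Open Scope classical_set_scope.
Local Open Scope ring_scope.
Import measurable_realfun.
Set Implicit Arguments. Unset Strict Implicit. Unset Printing Implicit Defensive.

(** * Trigonometric estimates *)

(** Heights of r in every direction amount to a spread of 2 r, so each dropped dimension contributes
    9 (2 r)^2 = 36 r^2, or 16 (2 r)^2 = 64 r^2 for closed curves. The closed inradius bound starts
    in dimension 3, whence k - 1. The hard edge estimate is the one for caps in space: an edge both
    turns the cap and enlarges it, and one length has to pay for both. Projecting the edge on one
    well chosen direction splits the length into the two payments; caps whose angular radius has
    sine below or above 3/5 need different directions. Exact extrema do not persist between
    neighbouring directions of a grid, so near extrema with a slack are followed, and two levels of
    slack separate the labels from the conclusion. Areas on the sphere are represented by volumes of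
    solid cones in the unit ball, divided by the volume of the ball; arc lengths in the plane are
    represented by counts over equally spaced directions. *)

Section trigonometry.
Variable R : realType.
Implicit Types x y t a k : R.

Lemma polar_ex x y : exists r psi : R, [/\ 0 <= r, - pi <= psi <= pi,
  x = r * cos psi & y = r * sin psi].
Proof.
pose r := Num.sqrt (x ^+ 2 + y ^+ 2).
have n0 : 0 <= x ^+ 2 + y ^+ 2 by rewrite addr_ge0 ?sqr_ge0.
have rr : r ^+ 2 = x ^+ 2 + y ^+ 2 by rewrite sqr_sqrtr.
have [r0|r0] := eqVneq r 0.
  exists 0, 0; rewrite lexx !mul0r oppr_le0 pi_ge0; split => //; move: rr;
    rewrite r0 expr0n/=; nra.
have rp : 0 < r by rewrite lt_neqAle eq_sym r0 sqrtr_ge0.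
have xr : -1 <= x / r <= 1.
  by apply/andP; rewrite ler_pdivlMr// ler_pdivrMr//; split; nra.
have s : sin (acos (x / r)) = `|y| / r.
  have E : 1 - (x / r) ^+ 2 = (`|y| / r) ^+ 2.
    by rewrite !expr_div_n real_normK ?num_real// rr; field; rewrite -rr expf_neq0.
  by rewrite sin_acos// E sqrtr_sqr ger0_norm ?divr_ge0// ltW.
have c : cos (acos (x / r)) = x / r by rewrite acosK// in_itv.
have a0 := acos_ge0 xr; have ap := acos_lepi xr.
case: (leP 0 y) => y0.
  exists r, (acos (x / r)); rewrite c s ger0_norm// !mulrA.
  by split; [exact: ltW| |field|field] => //; apply/andP; split => //; lra.
exists r, (- acos (x / r)); rewrite cosN sinN c s ltr0_norm//.
by split; [exact: ltW| |field|field] => //; apply/andP; split => //; lra.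
Qed.

Lemma cosB2pi x : cos (x - pi *+ 2) = cos x.
Proof. by rewrite -[in RHS](subrK (pi *+ 2) x) cosD2pi. Qed.

Lemma angle_mod x : exists y : R, [/\ `|y| <= pi, cos y = cos x & sin y = sin x].
Proof.
have [r [y [r0 yp cE sE]]] := polar_ex (cos x) (sin x).
have r1 : r = 1.
  have : r ^+ 2 * (cos y ^+ 2 + sin y ^+ 2) = 1.
    by rewrite mulrDr -!exprMn -cE -sE cos2Dsin2.
  by rewrite cos2Dsin2; nra.
by exists y; rewrite cE sE r1 !mul1r ler_norml.
Qed.

Lemma cos_gt_near a t : a <= pi -> `|t| < a -> cos a < cos t.
Proof.
move=> ap ta; have t0 := normr_ge0 t.
rewrite -[cos t]cos_norm ltr_cos// in_itv/= ?t0 ?ap ?andbT/=.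
- exact: le_trans (ltW ta) ap.
- exact: le_trans t0 (ltW ta).
Qed.

Lemma cos_le_far a t : 0 <= a -> a <= t <= pi *+ 2 - a -> cos t <= cos a.
Proof.
move=> a0 /andP[at1 t2]; rewrite mulr2n in t2.
have key u : a <= u <= pi -> cos u <= cos a.
  move=> /andP[au up]; have [->//|ne] := eqVneq a u.
  by apply/ltW; rewrite ltr_cos ?in_itv/= ?a0 ?(le_trans au)// ?(le_trans a0 au)// lt_neqAle ne.
have [tp|tp] := leP t pi; first by apply: key; rewrite at1.
rewrite -cosB2pi -cosN opprB; apply: key; rewrite mulr2n.
by apply/andP; split; lra.
Qed.

Lemma sec_angle (r : R) : 1 <= r -> exists a,
  [/\ 0 <= a, a < pi / 2, cos a = r^-1 & sin a = Num.sqrt (1 - r ^- 2)].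
Proof.
move=> r1; have pi0 := pi_gt0 R; have ri0 : 0 < r^-1 by rewrite invr_gt0; lra.
have ri : -1 <= r^-1 <= 1.
  by rewrite invf_le1 ?r1 ?andbT; lra.
have ca : cos (acos r^-1) = r^-1 by rewrite acosK// in_itv.
exists (acos r^-1); split=> //; [exact: acos_ge0| |by rewrite sin_acos// exprVn].
rewrite ltNge; apply/negP => h.
have : cos (acos r^-1) <= cos (pi / 2).
  apply: cos_le_far; first by lra.
  by rewrite h/= [pi *+ 2]mulr2n; have := acos_lepi ri; lra.
by rewrite cos_pihalf ca; lra.
Qed.

(* The angles t with cos (t - psi) > k form one arc, so that over a full turn
   a point enters and leaves it only once. *)
Lemma arc_exit_once k psi (delta : R) (i j : nat) :
  0 < k -> k < 1 -> 0 < delta -> (i < j)%N -> (j.+1)%:R * delta <= pi *+ 2 ->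
  k < cos (i%:R * delta - psi) -> cos (i.+1%:R * delta - psi) <= k ->
  k < cos (j%:R * delta - psi) -> cos (j.+1%:R * delta - psi) <= k -> False.
Proof.
move=> k0 k1 d0 ij jd ci ci' cj cj'.
have kin' : -1 <= k <= 1 by apply/andP; split; lra.
have kin : k \in `[(-1), 1] by rewrite in_itv.
pose a := acos k.
have ca : cos a = k by rewrite acosK.
have a0 : 0 < a by apply: acos_gt0; apply/andP; split; lra.
have ap : a <= pi by apply: acos_lepi.
have pi0 := pi_gt0 R.
have i0 : 0 <= i%:R * delta by rewrite mulr_ge0 ?(ltW d0).
have ijd : i%:R * delta + delta <= j%:R * delta.
  have : i.+1%:R * delta <= j%:R * delta by rewrite ler_pM2r// ler_nat.
  by rewrite -natr1 mulrDl mul1r.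
have jd' : j%:R * delta + delta <= pi *+ 2 by move: jd; rewrite -natr1 mulrDl mul1r.
have [x xa cx] : exists2 x : R, `|x| < a & forall t, cos (i%:R * delta - psi + t) = cos (x + t).
  have [x [xp cE sE]] := angle_mod (i%:R * delta - psi).
  exists x; last by move=> t; rewrite [LHS]cosD [RHS]cosD cE sE.
  rewrite ltNge; apply/negP => ax; move: ci; apply/negP; rewrite -leNgt -cE -ca -[cos x]cos_norm.
  apply: cos_le_far; first exact: ltW.
  by rewrite ax; move: xp; rewrite ler_norml mulr2n => /andP[x1 x2]; rewrite ler_norml; apply/andP; split; lra.
have near t : `|t| < a -> k < cos t by move=> ?; rewrite -ca; exact: cos_gt_near.
have far t : a <= t -> t <= pi *+ 2 - a -> cos t <= k.
  by move=> t1 t2; rewrite -ca; apply: cos_le_far; [exact: ltW|rewrite t1 t2].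
move: xa; rewrite ltr_norml => /andP[x1 x2].
have xd : a <= x + delta.
  rewrite leNgt; apply/negP => h; move: ci'; apply/negP; rewrite -ltNge.
  have -> : i.+1%:R * delta - psi = i%:R * delta - psi + delta by rewrite -natr1; ring.
  by rewrite cx; apply: near; rewrite ltr_norml h andbT; lra.
pose y := x + (j%:R * delta - i%:R * delta).
have cy : cos (j%:R * delta - psi) = cos y by rewrite -cx; congr cos; ring.
have cy' : cos (j.+1%:R * delta - psi) = cos (y + delta).
  by rewrite /y -addrA -cx; congr cos; rewrite -natr1; ring.
have y1 : a <= y by rewrite /y; lra.
have y2 : pi *+ 2 - a < y.
  by rewrite ltNge; apply/negP => h; move: cj; rewrite cy ltNge far.
move: cj'; apply/negP; rewrite -ltNge cy' -cosB2pi; apply: near.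
by rewrite ltr_norml; apply/andP; split; rewrite /y in y2 *; lra.
Qed.
End trigonometry.

(** * Taylor bounds, a numerical bound for [pi], and comparisons by derivatives *)

Section calculus.
Variable R : realType.
Implicit Types x y t : R.

Lemma deriv_ge0_le (f df : R -> R) (a b : R) : a <= b ->
  (forall x, a <= x <= b -> is_derive x 1 f (df x)) ->
  (forall x, a <= x <= b -> 0 <= df x) -> f a <= f b.
Proof.
move=> ab fd df0; have [||c cab] := @MVT_segment R f df a b ab.
- by move=> x; rewrite in_itv/= => /andP[ax xb]; apply: fd; rewrite !ltW.
- apply: derivable_within_continuous => x; rewrite in_itv/= => xab.
  exact: (@ex_derive _ _ _ _ _ _ _ (fd x xab)).
- by rewrite in_itv/= in cab => fab; rewrite -subr_ge0 fab mulr_ge0 ?df0// subr_ge0.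
Qed.

Ltac deriv := cbv beta; apply: is_derive_eq; rewrite /GRing.scale/= ?oppr0 ?mulr0 ?addr0 ?add0r.
Lemma sin_le1T x : 0 <= x -> sin x <= x.
Proof.
move=> x0; have := @deriv_ge0_le (fun t => t - sin t) (fun t => 1 - cos t) 0 x x0.
rewrite sin0 !subrr subr_ge0; apply=> t _.
by rewrite subr_ge0 cos_le1.
Qed.

Lemma cos_ge2T x : 0 <= x -> 1 - 2^-1 * x ^+ 2 <= cos x.
Proof.
move=> x0; have := @deriv_ge0_le (fun t => cos t + 2^-1 * t ^+ 2) (fun t => t - sin t) 0 x x0.
rewrite cos0 expr0n/= mulr0 addr0 lerBlDr; apply=> t /andP[t0 _].
  by deriv; field.
by rewrite subr_ge0 sin_le1T.
Qed.

Lemma sin_ge3T x : 0 <= x -> x - 6^-1 * x ^+ 3 <= sin x.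
Proof.
move=> x0; have := @deriv_ge0_le (fun t => sin t - t + 6^-1 * t ^+ 3)
  (fun t => cos t - (1 - 2^-1 * t ^+ 2)) 0 x x0.
rewrite sin0 expr0n/= mulr0 addr0 subrr => h.
suff : 0 <= sin x - x + 6^-1 * x ^+ 3 by lra.
apply: h => t /andP[t0 _]; first by deriv; field.
by rewrite subr_ge0 cos_ge2T.
Qed.

Lemma cos_le4T x : 0 <= x -> cos x <= 1 - 2^-1 * x ^+ 2 + 24^-1 * x ^+ 4.
Proof.
move=> x0; have := @deriv_ge0_le (fun t => 24^-1 * t ^+ 4 - 2^-1 * t ^+ 2 - cos t)
  (fun t => sin t - (t - 6^-1 * t ^+ 3)) 0 x x0.
rewrite cos0 !expr0n/= !mulr0 subrr sub0r => h.
suff : - 1 <= 24^-1 * x ^+ 4 - 2^-1 * x ^+ 2 - cos x by lra.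
apply: h => t /andP[t0 _]; first by deriv; field.
by rewrite subr_ge0 sin_ge3T.
Qed.

Lemma sin_le5T x : 0 <= x -> sin x <= x - 6^-1 * x ^+ 3 + 120^-1 * x ^+ 5.
Proof.
move=> x0; have := @deriv_ge0_le (fun t => t - 6^-1 * t ^+ 3 + 120^-1 * t ^+ 5 - sin t)
  (fun t => 1 - 2^-1 * t ^+ 2 + 24^-1 * t ^+ 4 - cos t) 0 x x0.
rewrite sin0 !expr0n/= !mulr0 !subr0 addr0 subr_ge0; apply=> t /andP[t0 _].
  by deriv; field.
by rewrite subr_ge0 cos_le4T.
Qed.

Lemma cos_ge6T x : 0 <= x ->
  1 - 2^-1 * x ^+ 2 + 24^-1 * x ^+ 4 - 720^-1 * x ^+ 6 <= cos x.
Proof.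
move=> x0; have := @deriv_ge0_le (fun t => cos t + 2^-1 * t ^+ 2 - 24^-1 * t ^+ 4 + 720^-1 * t ^+ 6)
  (fun t => t - 6^-1 * t ^+ 3 + 120^-1 * t ^+ 5 - sin t) 0 x x0.
rewrite cos0 !expr0n/= !mulr0 subr0 !addr0 => h.
suff : 1 <= cos x + 2^-1 * x ^+ 2 - 24^-1 * x ^+ 4 + 720^-1 * x ^+ 6 by lra.
apply: h => t /andP[t0 _]; first by deriv; field.
by rewrite subr_ge0 sin_le5T.
Qed.

Lemma sin_ge7T x : 0 <= x ->
  x - 6^-1 * x ^+ 3 + 120^-1 * x ^+ 5 - 5040^-1 * x ^+ 7 <= sin x.
Proof.
move=> x0; have := @deriv_ge0_le
  (fun t => sin t - t + 6^-1 * t ^+ 3 - 120^-1 * t ^+ 5 + 5040^-1 * t ^+ 7)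
  (fun t => cos t - (1 - 2^-1 * t ^+ 2 + 24^-1 * t ^+ 4 - 720^-1 * t ^+ 6)) 0 x x0.
rewrite sin0 !expr0n/= !mulr0 !subr0 !addr0 => h.
suff : 0 <= sin x - x + 6^-1 * x ^+ 3 - 120^-1 * x ^+ 5 + 5040^-1 * x ^+ 7 by lra.
apply: h => t /andP[t0 _]; first by deriv; field.
by rewrite subr_ge0 cos_ge6T.
Qed.

(** The Taylor lower bound of degree six for cosine is still positive at 1.5652, so [pi / 2] lies
    beyond. The tightest later use is that [pi * kappa] times 0.83 is at least 1/2, for which 3.13
    itself would fall short. *)
Lemma pi_gt_3_13 : 2 * (15652%:R / 10000%:R) < pi :> R.
Proof.
have pi0 := pi_gt0 R; rewrite ltNge; apply/negP => h.
pose x : R := 15652%:R / 10000%:R.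
have x0 : 0 <= x by rewrite /x; lra.
have hx : pi <= 2 * x by [].
have c0 : 0 < cos x.
  by apply: lt_le_trans (cos_ge6T x0); rewrite /x; lra.
have : cos x <= cos (pi / 2).
  apply: cos_le_far; first by lra.
  rewrite [pi *+ 2]mulr2n; have p2 := pi_ge2 R; have x2 : x <= 2 by rewrite /x; lra.
  by apply/andP; split; lra.
by rewrite cos_pihalf leNgt c0.
Qed.

Lemma sec_sin_ge a x y : 0 <= a -> a < pi / 2 -> - a <= y -> y <= x -> x <= a ->
  (x - y) * cos a <= sin x - sin y.
Proof.
move=> a0 ap ay yx xa; have pi0 := pi_gt0 R.
have := @deriv_ge0_le (fun t => sin t - t * cos a) (fun t => cos t - cos a) y x yx.
move=> h; suff : sin y - y * cos a <= sin x - x * cos a by lra.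
apply: h => t /andP[t1 t2]; first by deriv; ring.
rewrite subr_ge0; have [<-//|ne] := eqVneq `|t| a; first by rewrite cos_norm.
apply/ltW/cos_gt_near; first by lra.
by rewrite lt_neqAle ne/= ler_norml; apply/andP; split; lra.
Qed.

(** A cap of angular radius [x] has normalized area [(1 - cos x) / 2], and the tangents from its
    apex to the ball have length [tan x]. The hypothesis compares the derivatives of these two
    functions. *)
Lemma half_cosB_le (K a b : R) : 0 <= a -> a <= b -> b < pi / 2 ->
  (forall x, a <= x <= b -> 2^-1 * sin x * cos x ^+ 2 <= K) ->
  2^-1 * (cos a - cos b) <= K * (tan b - tan a).
Proof.
move=> a0 ab bp hK; have pi0 := pi_gt0 R.
have c0 x : a <= x <= b -> 0 < cos x.
  by move=> /andP[x1 x2]; apply: cos_gt0_pihalf; apply/andP; split; lra.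
have := @deriv_ge0_le (fun t => K * tan t + 2^-1 * cos t) (fun t => K * (cos t) ^- 2 - 2^-1 * sin t) a b ab.
move=> h; suff : K * tan a + 2^-1 * cos a <= K * tan b + 2^-1 * cos b by lra.
apply: h => t tab; have ct := c0 _ tab.
  by have h := is_derive_tan (lt0r_neq0 ct); deriv; ring.
by rewrite subr_ge0 ler_pdivlMr ?exprn_gt0//; exact: hK.
Qed.

Lemma tan_tangent_le (a b : R) : 0 <= a < pi / 2 -> 0 <= b < pi / 2 ->
  tan a + (b - a) * (cos a) ^- 2 <= tan b.
Proof.
move=> /andP[a0 ap] /andP[b0 bp]; have pi0 := pi_gt0 R.
have c0 x : 0 <= x -> x < pi / 2 -> 0 < cos x.
  by move=> x1 x2; apply: cos_gt0_pihalf; apply/andP; split; lra.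
have cle x y : 0 <= x -> x <= y -> y < pi / 2 -> cos y <= cos x.
  by move=> x0 xy yp; apply: cos_le_far => //; rewrite xy [pi *+ 2]mulr2n; lra.
have dF (k : R) x : 0 < cos x -> is_derive x 1 (fun t => k * (tan t - t * cos a ^- 2)) (k * (cos x ^- 2 - cos a ^- 2)).
  by move=> cx; have h := is_derive_tan (lt0r_neq0 cx); deriv; ring.
case: (leP a b) => ab.
  have := @deriv_ge0_le (fun t => 1 * (tan t - t * cos a ^- 2)) (fun x => 1 * (cos x ^- 2 - cos a ^- 2)) a b ab.
  rewrite !mul1r => h.
  suff : tan a - a * cos a ^- 2 <= tan b - b * cos a ^- 2 by lra.
  apply: h => t /andP[t1 t2]; have ct : 0 < cos t by apply: c0; lra.
    exact: dF.
  rewrite mul1r subr_ge0 lef_pV2 ?posrE ?exprn_gt0// ?c0//.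
  by apply: lerXn2r; rewrite ?nnegrE ?(ltW ct) ?(ltW (c0 _ _ _))//; apply: cle; lra.
have := @deriv_ge0_le (fun t => (-1) * (tan t - t * cos a ^- 2)) (fun x => (-1) * (cos x ^- 2 - cos a ^- 2)) b a (ltW ab).
move=> h.
suff : -1 * (tan b - b * cos a ^- 2) <= -1 * (tan a - a * cos a ^- 2) by lra.
apply: h => t /andP[t1 t2]; have ct : 0 < cos t by apply: c0; lra.
  exact: dF.
rewrite mulN1r opprB subr_ge0 lef_pV2 ?posrE ?exprn_gt0// ?c0//.
by apply: lerXn2r; rewrite ?nnegrE ?(ltW ct) ?(ltW (c0 _ _ _))//; apply: cle; lra.
Qed.

End calculus.

(** * The numerical inequality for the change of a cap along an edge *)

Section cap_inequality.
Variable R : realType.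
Implicit Types x y : R.

(** The maximum of [sin x * cos x ^+ 2 / 2], attained at [sin x = 1 / sqrt 3]: the largest rate at
    which the normalized cap area grows per unit of length when the apex moves along a tangent line.
    The constant [6 * sqrt 3] is [2 / kappa]. *)
Definition kappa : R := (3 * Num.sqrt 3)^-1.

Lemma sqrt3_bounds : 173205%:R / 100000%:R <= Num.sqrt 3 :> R /\ Num.sqrt 3 <= 173206%:R / 100000%:R :> R.
Proof.
have s0 : 0 <= Num.sqrt 3 :> R by exact: sqrtr_ge0.
have ss : Num.sqrt 3 ^+ 2 = 3 :> R by rewrite sqr_sqrtr.
by move: (Num.sqrt 3) s0 ss => s s0 ss; split; nra.
Qed.

Lemma kappa_ge : 192449%:R / 1000000%:R <= kappa.
Proof.
have [s1 s2] := sqrt3_bounds; rewrite /kappa -[leRHS]mul1r ler_pdivlMr.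
  by apply: (@le_trans _ _ (192449%:R / 1000000%:R * (3 * (173206%:R / 100000%:R)))); [rewrite ler_pM2l; lra|lra].
lra.
Qed.

(** With [w = sqrt 3], the gap is a positive multiple of [(w * s - 1) ^+ 2 * (w * s + 2)], with its
    double root at the maximizer. *)
Lemma half_sin_cos2_le (s c : R) : s ^+ 2 + c ^+ 2 = 1 -> 2^-1 * s * c ^+ 2 <= kappa.
Proof.
move=> sc; have [s1 s2] := sqrt3_bounds.
have ss : Num.sqrt 3 ^+ 2 = 3 :> R by rewrite sqr_sqrtr.
rewrite /kappa; move: (Num.sqrt 3) s1 s2 ss => w s1 s2 ss.
rewrite -[leRHS]mul1r ler_pdivlMr; last by lra.
have -> : c ^+ 2 = 1 - s ^+ 2 by rewrite -sc; ring.
have sb : -1 <= s by nra.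
have h : 0 <= (w * s - 1) ^+ 2 * (w * s + 2) by rewrite mulr_ge0 ?sqr_ge0//; nra.
have e : (w * s - 1) ^+ 2 * (w * s + 2) = w * w ^+ 2 * s ^+ 3 - 3 * (w * s) + 2 by ring.
rewrite e ss in h.
have -> : 2^-1 * s * (1 - s ^+ 2) * (3 * w) = 1 - 2^-1 * (w * 3 * s ^+ 3 - 3 * (w * s) + 2) by field.
lra.
Qed.

Lemma sin_ratio_le (x y : R) : 0 <= y -> y <= x -> x <= pi / 2 -> y * sin x <= x * sin y.
Proof.
move=> y0 yx xp; have pi0 := pi_gt0 R.
have h1 : sin x - sin y <= (x - y) * cos y.
  have := @deriv_ge0_le R (fun t => t * cos y - sin t) (fun t => cos y - cos t) y x yx.
  move=> h; suff : y * cos y - sin y <= x * cos y - sin x by lra.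
  apply: h => t /andP[t1 t2]; first by apply: is_derive_eq; rewrite /GRing.scale/=; ring.
  by rewrite subr_ge0; apply: cos_le_far => //; rewrite t1 [pi *+ 2]mulr2n; lra.
have h2 : y * cos y <= sin y.
  have [yp|yp] := ltP y (pi / 2).
    by have := @sec_sin_ge R y y 0 y0 yp; rewrite sin0 !subr0; apply; lra.
  have -> : y = pi / 2 by lra.
  by rewrite cos_pihalf mulr0 sin_pihalf ler01.
have : 0 <= (x - y) * (sin y - y * cos y) by rewrite mulr_ge0 ?subr_ge0.
have : y * (sin x - sin y) <= y * ((x - y) * cos y) by rewrite ler_wpM2l.
lra.
Qed.

(** The cosine is just above [3 sqrt 3 / (2 pi) = 0.8269...], the value at which
    [pi * kappa * cos gam] equals 1/2. On the other side, [linear_le_tan] asks for an angle that is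
    not too small. *)
Definition gam : R := acos (83%:R / 100%:R).

Lemma gam_facts : [/\ cos gam = 83%:R / 100%:R, 5577%:R / 10000%:R <= sin gam, sin gam <= 3 / 5,
  0 <= gam & gam < pi / 2].
Proof.
have r1 : -1 <= (83%:R / 100%:R : R) <= 1 by apply/andP; split; lra.
have cg : cos gam = 83%:R / 100%:R by rewrite /gam acosK// in_itv.
have g0 : 0 <= gam by exact: acos_ge0.
have gp : gam <= pi by exact: acos_lepi.
have s0 : 0 <= sin gam by apply: sin_ge0_pi; rewrite g0 gp.
have cs := cos2Dsin2 gam; rewrite cg in cs.
have pi0 := pi_gt0 R.
split => //; first by nra.
  by nra.
rewrite ltNge; apply/negP => h.
have : cos gam <= cos (pi / 2).
  by apply: cos_le_far; [lra|rewrite h [pi *+ 2]mulr2n; lra].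
by rewrite cos_pihalf cg; lra.
Qed.

(** After division by [cos a], the claim bounds [a] by a multiple of [cos gam + sin gam * tan a],
    which is convex in [a], so one tangent line of [tan] suffices. It is taken at [atan (sqrt 2)],
    where the slope is 3, close to the critical slope [1 / (pi * kappa * sin gam)]. *)
Lemma linear_le_tan (a : R) : 0 <= a -> a < pi / 2 ->
  a * cos a <= pi * kappa * cos (a - gam).
Proof.
move=> a0 ap; have [cg sg1 _ _ _] := gam_facts.
have pi0 := pi_gt0 R; have pi3 := pi_gt_3_13 R; have k0 := kappa_ge.
have ca : 0 < cos a by apply: cos_gt0_pihalf; apply/andP; split; lra.
pose P : R := pi * kappa.
have P0 : 602%:R / 1000%:R <= P.
  apply: (@le_trans _ _ (2 * (15652%:R / 10000%:R) * (192449%:R / 1000000%:R))); first by lra.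
  by apply: ler_pM; lra.
have t2 : 0 < Num.sqrt 2 :> R by rewrite sqrtr_gt0; lra.
have s22 : Num.sqrt 2 ^+ 2 = 2 :> R by rewrite sqr_sqrtr.
pose b : R := atan (Num.sqrt 2).
have tb : tan b = Num.sqrt 2 by rewrite /b atanK.
have b0 : 0 <= b by rewrite -[0]atan0; apply: le_atan; exact: ltW.
have bp : b < pi / 2 by exact: atan_ltpi2.
have cb : (cos b) ^- 2 = 3.
  rewrite cos2_tan2 ?tb ?s22; first by lra.
  by apply/lt0r_neq0/cos_gt0_pihalf; apply/andP; split; lra.
(* The true value is 0.9553...; if it exceeded 0.96, then [tan 0.96] would be below [sqrt 2],
   against the Taylor bounds. *)
have b96 : b <= 96%:R / 100%:R.
  rewrite leNgt; apply/negP => h.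
  have x0 : 0 <= 96%:R / 100%:R :> R by lra.
    have xp : (96%:R / 100%:R : R) < pi / 2 by lra.
  have := @tan_tangent_le R (96%:R / 100%:R) b; rewrite tb x0 xp b0 bp => /(_ isT isT) tt.
  have := sin_ge7T x0; have := cos_le4T x0.
  have c0 : 0 < cos (96%:R / 100%:R : R) by apply: cos_gt0_pihalf; apply/andP; split; lra.
  move=> c1 s1.
  have : tan (96%:R / 100%:R : R) < Num.sqrt 2.
    apply: lt_le_trans tt; rewrite ltrDl mulr_gt0 ?subr_gt0// invr_gt0 exprn_gt0//.
  rewrite /tan ltr_pdivrMr//; apply/negP; rewrite -leNgt.
  apply: le_trans s1; apply: (@le_trans _ _ (14143%:R / 10000%:R * cos (96%:R / 100%:R))).
    by rewrite ler_pM2r; [nra|exact: c0].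
  by apply: (@le_trans _ _ (14143%:R / 10000%:R * (1 - 2^-1 * (96%:R / 100%:R) ^+ 2 + 24^-1 * (96%:R / 100%:R) ^+ 4))); [rewrite ler_pM2l; lra|lra].
have tt : Num.sqrt 2 + (a - b) * 3 <= tan a.
  by rewrite -tb -cb; apply: tan_tangent_le; apply/andP.
have s2b : 14142%:R / 10000%:R <= Num.sqrt 2 :> R by nra.
have T : 3 * a - 14658%:R / 10000%:R <= tan a by lra.
have sgT : sin gam * (3 * a - 14658%:R / 10000%:R) <= sin gam * tan a by rewrite ler_pM2l; lra.
have main : a <= P * (cos gam + sin gam * tan a).
  apply: (@le_trans _ _ (P * (cos gam + sin gam * (3 * a - 14658%:R / 10000%:R)))); last first.
    by rewrite ler_pM2l ?lerD2l; lra.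
  rewrite cg.
  have l1 : 5577%:R / 10000%:R * (3 * a) <= sin gam * (3 * a) by clear -sg1 a0; apply: ler_wpM2r; lra.
  have sg2 : sin gam <= 558%:R / 1000%:R.
    by have := cos2Dsin2 gam; rewrite cg; nra.
  have l2 : 83%:R / 100%:R + sin gam * (3 * a - 14658%:R / 10000%:R) >= 1673%:R / 1000%:R * a by lra.
  apply: (@le_trans _ _ (P * (1673%:R / 1000%:R * a))); last by rewrite ler_pM2l; lra.
  have : 602%:R / 1000%:R * (1673%:R / 1000%:R * a) <= P * (1673%:R / 1000%:R * a).
    by clear -P0 a0; apply: ler_wpM2r; lra.
  by move=> h; clear -h a0; lra.
have sa : sin a = tan a * cos a by rewrite /tan divfK// lt0r_neq0.
rewrite -/P cosB sa.
have -> : P * (cos a * cos gam + tan a * cos a * sin gam) = P * (cos gam + sin gam * tan a) * cos a by ring.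
by rewrite ler_pM2r.
Qed.

(** The hypothesis on [d] says that [d] bounds the projections of the edge on all directions. Only
    [w = phi2 - a2 + b] is used: it splits the projection into [cos b * (tan a2 - tan a1)], which
    pays for the growth of the cap, and a remainder, which pays for its rotation by [delta]. The
    tilt [b] distributes the length between the two. *)
Lemma cap_edge_ineq (b a1 a2 phi1 phi2 d : R) : 0 < a1 -> a1 <= a2 -> a2 < pi / 2 ->
  let delta := (phi2 - a2) - (phi1 - a1) in
  (forall w, sin (phi2 - w) / cos a2 - sin (phi1 - w) / cos a1 <= d) ->
  (forall x, a1 <= x <= a2 -> 2^-1 * sin x * cos x ^+ 2 <= kappa * cos b) ->
  sin a1 * delta / pi * cos a1 <= kappa * (sin (a1 - b) - sin (a1 - b - delta)) ->
  sin a1 * delta / pi + 2^-1 * (cos a1 - cos a2) <= kappa * d.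
Proof.
move=> a10 a12 a2p delta hd h1 h2; have pi0 := pi_gt0 R.
have k0 : 0 < kappa by apply: lt_le_trans kappa_ge; lra.
have c1 : 0 < cos a1 by apply: cos_gt0_pihalf; apply/andP; split; lra.
have c2 : 0 < cos a2 by apply: cos_gt0_pihalf; apply/andP; split; lra.
have e1 := half_cosB_le (ltW a10) a12 a2p h1.
have := hd (phi2 - a2 + b).
have -> : phi2 - (phi2 - a2 + b) = a2 - b by ring.
have -> : phi1 - (phi2 - a2 + b) = a1 - b - delta by rewrite /delta; ring.
move=> {}hd.
have t2 : sin (a2 - b) / cos a2 = cos b * tan a2 - sin b.
  by rewrite sinB /tan; field; rewrite gt_eqF.
have t1 : sin (a1 - b) / cos a1 = cos b * tan a1 - sin b.
  by rewrite sinB /tan; field; rewrite gt_eqF.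
have e2 : sin a1 * delta / pi <= kappa * (sin (a1 - b) / cos a1 - sin (a1 - b - delta) / cos a1).
  by rewrite -mulrBl mulrA ler_pdivlMr.
have : kappa * (sin (a2 - b) / cos a2 - sin (a1 - b - delta) / cos a1) <= kappa * d by rewrite ler_pM2l.
rewrite t2; rewrite t1 in e2.
have : kappa * cos b * (tan a2 - tan a1) + kappa * (cos b * tan a1 - sin b - sin (a1 - b - delta) / cos a1) =
  kappa * (cos b * tan a2 - sin b - sin (a1 - b - delta) / cos a1) by ring.
lra.
Qed.

(** The tilt is 0. Since [3 / 5 < pi * kappa], the rotation costs at most [kappa * delta], while the
    sine drops by at least [delta * cos a1] over [[a1 - delta, a1]], an interval inside
    [[- a1, a1]]. *)
Lemma cap_edge_small (a1 a2 phi1 phi2 d : R) : 0 < a1 -> a1 <= a2 -> a2 < pi / 2 ->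
  let delta := (phi2 - a2) - (phi1 - a1) in 0 <= delta -> delta <= a1 *+ 2 ->
  (forall w, sin (phi2 - w) / cos a2 - sin (phi1 - w) / cos a1 <= d) ->
  sin a1 <= 3 / 5 ->
  sin a1 * delta / pi + 2^-1 * (cos a1 - cos a2) <= kappa * d.
Proof.
move=> a10 a12 a2p delta d0 d2 hd s1; have pi0 := pi_gt0 R; rewrite mulr2n in d2.
have pi3 := pi_gt_3_13 R; have k1 := kappa_ge.
have c1 : 0 < cos a1 by apply: cos_gt0_pihalf; apply/andP; split; lra.
apply: (cap_edge_ineq (b := 0)) => //.
  by move=> x _; rewrite cos0 mulr1; apply: half_sin_cos2_le; rewrite addrC cos2Dsin2.
rewrite -/delta subr0.
have := @sec_sin_ge R a1 a1 (a1 - delta) (ltW a10) (le_lt_trans a12 a2p).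
have -> : a1 - (a1 - delta) = delta by ring.
move=> h; apply: (@le_trans _ _ (kappa * (delta * cos a1))); last first.
  by rewrite ler_pM2l; [apply: h; lra|lra].
rewrite mulrA ler_pM2r// mulrAC ler_wpM2r// ler_pdivrMr//.
apply: (le_trans s1); apply: (@le_trans _ _ (192449%:R / 1000000%:R * (2 * (15652%:R / 10000%:R)))).
  lra.
by apply: ler_pM; lra.
Qed.

(** From [sin a1 = 3 / 5] on, the growth rate [sin x * cos x ^+ 2 / 2] is decreasing. This leaves
    room for the tilt [a1 - gam], which moves the sine difference that pays for the rotation to the
    steeper interval [[gam - delta, gam]]. *)
Lemma cap_edge_large (a1 a2 phi1 phi2 d : R) : 0 < a1 -> a1 <= a2 -> a2 < pi / 2 ->
  let delta := (phi2 - a2) - (phi1 - a1) in 0 <= delta -> delta <= a1 *+ 2 ->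
  (forall w, sin (phi2 - w) / cos a2 - sin (phi1 - w) / cos a1 <= d) ->
  3 / 5 <= sin a1 ->
  sin a1 * delta / pi + 2^-1 * (cos a1 - cos a2) <= kappa * d.
Proof.
move=> a10 a12 a2p delta d0 d2 hd s1; have pi0 := pi_gt0 R; rewrite mulr2n in d2.
have pi3 := pi_gt_3_13 R; have k1 := kappa_ge; have [cg sg1 sg2 g0 gp] := gam_facts.
have c1 : 0 < cos a1 by apply: cos_gt0_pihalf; apply/andP; split; lra.
have cs1 := cos2Dsin2 a1.
have s1' : sin a1 <= 1 by exact: sin_le1.
have ga1 : gam <= a1.
  rewrite leNgt; apply/negP => lt.
  have : sin a1 < sin gam by rewrite ltr_sin ?in_itv/=//; apply/andP; split; lra.
  lra.
apply: (cap_edge_ineq (b := a1 - gam)) => //.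
  move=> x /andP[x1 x2].
  have xs : sin a1 <= sin x.
    have [->|ne] := eqVneq a1 x; first exact: lexx.
    apply/ltW; rewrite ltr_sin ?in_itv/=; first by rewrite lt_neqAle ne x1.
    - by apply/andP; split; lra.
    - by apply/andP; split; lra.
  apply: (@le_trans _ _ (2^-1 * sin a1 * cos a1 ^+ 2)).
    have csx := cos2Dsin2 x.
    have -> : cos x ^+ 2 = 1 - sin x ^+ 2 by rewrite -csx; ring.
    have -> : cos a1 ^+ 2 = 1 - sin a1 ^+ 2 by rewrite -cs1; ring.
    rewrite -subr_ge0.
    have -> : 2^-1 * sin a1 * (1 - sin a1 ^+ 2) - 2^-1 * sin x * (1 - sin x ^+ 2) =
      2^-1 * ((sin x - sin a1) * (sin x ^+ 2 + sin x * sin a1 + sin a1 ^+ 2 - 1)) by ring.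
    by apply: mulr_ge0; [lra|apply: mulr_ge0; [lra|nra]].
  rewrite cosB cg; apply: (@le_trans _ _ (192449%:R / 1000000%:R *
     (cos a1 * (83%:R / 100%:R) + sin a1 * (5577%:R / 10000%:R)))); last first.
    by apply: ler_pM; nra.
  move: (cos a1) (sin a1) c1 cs1 s1 s1' => c s c0 cs s1 s1'; clear -c0 cs s1 s1'.
  have cc : c <= 4 / 5 by nra.
  (* As [s ^+ 2 = 1 - c ^+ 2], this is [0 <= (s - 3 / 5) ^+ 2], the tangent at the extreme value of
     [s]; it leaves a polynomial inequality in [c] alone. *)
  have sl : s <= (34%:R / 25%:R - c ^+ 2) / (6 / 5) by nra.
  have : (2^-1 * c ^+ 2 - 192449%:R / 1000000%:R * (5577%:R / 10000%:R)) * s <=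
    192449%:R / 1000000%:R * (83%:R / 100%:R) * c; last by lra.
  have [neg|pos] := leP (2^-1 * c ^+ 2) (192449%:R / 1000000%:R * (5577%:R / 10000%:R)).
    by apply: (@le_trans _ _ 0); nra.
  apply: (@le_trans _ _ ((2^-1 * c ^+ 2 - 192449%:R / 1000000%:R * (5577%:R / 10000%:R)) *
     ((34%:R / 25%:R - c ^+ 2) / (6 / 5)))).
    by rewrite ler_pM2l ?subr_gt0.
  have c46 : 46%:R / 100%:R <= c by nra.
  have c2 : c ^+ 2 <= 4 / 5 * c by nra.
  have c3 : c ^+ 3 <= 16 / 25%:R * c by nra.
  pose A : R := 192449%:R / 1000000%:R * (5577%:R / 10000%:R).
  pose B : R := 192449%:R / 1000000%:R * (83%:R / 100%:R).
  have gc : 0 <= - 2^-1 * (c ^+ 3 + 4 / 5 * c ^+ 2 + 16 / 25%:R * c + 64%:R / 125%:R)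
     + (17%:R / 25%:R + A) * (c + 4 / 5) - 6 / 5 * B by rewrite /A /B; lra.
  have : 0 <= (4 / 5 - c) * (- 2^-1 * (c ^+ 3 + 4 / 5 * c ^+ 2 + 16 / 25%:R * c + 64%:R / 125%:R)
     + (17%:R / 25%:R + A) * (c + 4 / 5) - 6 / 5 * B) by apply: mulr_ge0; lra.
  rewrite /A /B; lra.
rewrite -/delta (_ : a1 - (a1 - gam) = gam); last by ring.
(* Up to [2 * gam] the secant bound on [[- gam, gam]] applies. Beyond, the difference of sines is
   turned into a product, and [sin y / y] is compared at [y = delta / 2] and at [a1]. *)
have [dg|dg] := leP delta (gam *+ 2).
  rewrite mulr2n in dg.
  have := @sec_sin_ge R gam gam (gam - delta) g0 gp.
  have -> : gam - (gam - delta) = delta by ring.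
  move=> h; apply: (@le_trans _ _ (kappa * (delta * cos gam))); last first.
    by rewrite ler_pM2l; [apply: h; lra|lra].
  have -> : sin a1 * delta / pi * cos a1 = delta * (sin a1 * cos a1 / pi) by ring.
  rewrite [leRHS]mulrCA; apply: ler_wpM2l => //; rewrite ler_pdivrMr// cg.
  apply: (@le_trans _ _ 2^-1); first by have := sqr_ge0 (sin a1 - cos a1); lra.
  apply: (@le_trans _ _ (192449%:R / 1000000%:R * (83%:R / 100%:R) * (2 * (15652%:R / 10000%:R)))).
    lra.
  by apply: ler_pM; lra.
rewrite mulr2n in dg.
pose y := delta / 2.
have -> : sin gam - sin (gam - delta) = 2 * (sin y * cos (y - gam)).
  have key (v w : R) : 2 * (sin w * cos v) = sin (w - v) - sin (- v - w).
    by rewrite !sinB sinN cosN; ring.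
  by rewrite key; congr (sin _ - sin _); rewrite /y; field.
have lin := @linear_le_tan a1 (ltW a10) (le_lt_trans a12 a2p).
have y0 : gam < y by rewrite /y; lra.
have ya : y <= a1 by rewrite /y; lra.
have rat : y * sin a1 <= a1 * sin y by apply: sin_ratio_le; lra.
have cm : cos (a1 - gam) <= cos (y - gam).
  by apply: cos_le_far; [lra|rewrite [pi *+ 2]mulr2n; apply/andP; split; lra].
have ca0 : 0 <= cos (a1 - gam) by apply: cos_ge0_pihalf; apply/andP; split; lra.
have -> : delta = 2 * y by rewrite /y; field.
have -> : sin a1 * (2 * y) / pi * cos a1 = 2 / pi * (y * sin a1 * cos a1) by ring.
have sy0 : 0 <= sin y by apply: sin_ge0_pi; apply/andP; split; lra.
apply: (@le_trans _ _ (2 / pi * (a1 * sin y * cos a1))).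
  by rewrite ler_pM2l ?divr_gt0// ler_pM2r.
have -> : 2 / pi * (a1 * sin y * cos a1) = 2 * sin y * (a1 * cos a1 / pi) by ring.
have -> : kappa * (2 * (sin y * cos (y - gam))) = 2 * sin y * (kappa * cos (y - gam)) by ring.
rewrite ler_wpM2l ?mulr_ge0// ler_pdivrMr//; apply: le_trans lin _.
rewrite -mulrA mulrC ler_wpM2r ?(ltW pi0)// ler_pM2l//; lra.
Qed.

End cap_inequality.

(** * The arc seen from a point that moves along a line *)

Section frame.
Variable R : realType.
Implicit Types D t phi a : R.

(* The point (D, t), seen from the unit disc: it lies at angle phi and its cap
   {u : u.(D, t) >= 1} is the arc [phi - a, phi + a]. *)
Definition polar_at D t phi a : Prop :=
  [/\ 0 <= a, a < pi / 2, `|phi| <= a, D * cos a = cos phi & t * cos a = sin phi].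

Lemma cos_gt0_half a : 0 <= a -> a < pi / 2 -> 0 < cos a.
Proof. by move=> a0 ap; have := pi_gt0 R => p; apply: cos_gt0_pihalf; apply/andP; split; lra. Qed.

Lemma cos_le_norm a phi : 0 <= a -> `|phi| <= pi -> cos a <= cos phi -> `|phi| <= a.
Proof.
move=> a0 pp c; rewrite leNgt; apply/negP => lt; move: c; apply/negP; rewrite -ltNge -[cos phi]cos_norm.
have pi0 := pi_gt0 R.
by rewrite ltr_cos// in_itv/= ?normr_ge0 ?pp ?a0//=; lra.
Qed.

Lemma frame_polar D t : 1 <= D -> exists phi a, polar_at D t phi a.
Proof.
move=> D1; have [r [phi [r0 /andP[p1 p2] DE tE]]] := polar_ex D t.
have rr : r ^+ 2 = D ^+ 2 + t ^+ 2.
  by rewrite DE tE !exprMn -mulrDr cos2Dsin2 mulr1.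
have r1 : 1 <= r by nra.
have [a [a0 ap ca _]] := sec_angle r1.
have rn : r != 0 by rewrite gt_eqF//; lra.
exists phi, a; split => //.
- apply: cos_le_norm => //; first by rewrite ler_norml p1 p2.
  rewrite ca -div1r ler_pdivrMr; last by lra.
  by rewrite mulrC -DE.
- by rewrite ca DE mulrAC divff ?mul1r.
- by rewrite ca tE mulrAC divff ?mul1r.
Qed.

Lemma polar_at_norm D t phi a : polar_at D t phi a -> (D ^+ 2 + t ^+ 2) * cos a ^+ 2 = 1.
Proof. by case=> _ _ _ h1 h2; rewrite mulrDl -!exprMn h1 h2 cos2Dsin2. Qed.

Lemma polar_at_proj D t phi a w : polar_at D t phi a ->
  sin (phi - w) / cos a = t * cos w - D * sin w.
Proof.
case=> a0 ap _ h1 h2; have c0 := cos_gt0_half a0 ap.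
by rewrite sinB -h1 -h2; field; rewrite gt_eqF.
Qed.

(** When a point moves up a line at distance at least 1 from the centre, both its tangents to the
    disc turn the same way, so both ends [phi - a] and [phi + a] of the arc advance. In terms of
    cosines this is the Cauchy-Schwarz inequality for [(sqrt (D ^+ 2 - 1), t)] and
    [(sqrt (D ^+ 2 - 1), t')]. *)
Lemma polar_at_mono D t t' phi phi' a a' : 1 <= D -> t <= t' ->
  polar_at D t phi a -> polar_at D t' phi' a' -> `|a' - a| <= phi' - phi.
Proof.
move=> D1 tt' P P'; have N := polar_at_norm P; have N' := polar_at_norm P'.
case: P => a0 ap fa h1 h2; case: P' => a0' ap' fa' h1' h2'.
have c0 := cos_gt0_half a0 ap; have c0' := cos_gt0_half a0' ap'.
have pi0 := pi_gt0 R.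
move: fa fa'; rewrite !ler_norml => /andP[f1 f2] /andP[f1' f2'].
have s0 : 0 <= sin (phi' - phi).
  rewrite sinB -h1 -h2 -h1' -h2'.
  have -> : t' * cos a' * (D * cos a) - D * cos a' * (t * cos a) = D * (t' - t) * (cos a * cos a') by ring.
  by rewrite !mulr_ge0 ?subr_ge0 ?(ltW c0) ?(ltW c0')//; lra.
have d0 : 0 <= phi' - phi.
  rewrite leNgt; apply/negP => lt.
  have : 0 < sin (- (phi' - phi)) by apply: sin_gt0_pi; apply/andP; split; lra.
  by rewrite sinN oppr_gt0 ltNge s0.
have cc : cos (phi' - phi) <= cos (a' - a).
  rewrite [leRHS]cosB cosB -h1 -h2 -h1' -h2'.
  have sa : sin a = Num.sqrt (D ^+ 2 + t ^+ 2 - 1) * cos a.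
    have n0 : 0 <= D ^+ 2 + t ^+ 2 - 1 by nra.
    have s0a : 0 <= sin a by apply: sin_ge0_pi; apply/andP; split; lra.
    apply/eqP; rewrite -(eqrXn2 (n := 2))//; last by rewrite mulr_ge0 ?sqrtr_ge0 ?ltW.
    by rewrite exprMn sqr_sqrtr// mulrBl N mul1r sin2cos2.
  have sa' : sin a' = Num.sqrt (D ^+ 2 + t' ^+ 2 - 1) * cos a'.
    have n0 : 0 <= D ^+ 2 + t' ^+ 2 - 1 by nra.
    have s0a : 0 <= sin a' by apply: sin_ge0_pi; apply/andP; split; lra.
    apply/eqP; rewrite -(eqrXn2 (n := 2))//; last by rewrite mulr_ge0 ?sqrtr_ge0 ?ltW.
    by rewrite exprMn sqr_sqrtr// mulrBl N' mul1r sin2cos2.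
  rewrite sa sa'.
  have -> : D * cos a' * (D * cos a) + t' * cos a' * (t * cos a) = (D ^+ 2 + t * t') * (cos a * cos a') by ring.
  set u := Num.sqrt (D ^+ 2 + t ^+ 2 - 1); set v := Num.sqrt (D ^+ 2 + t' ^+ 2 - 1).
  have -> : cos a' * cos a + v * cos a' * (u * cos a) = (1 + u * v) * (cos a * cos a') by ring.
  rewrite ler_pM2r ?mulr_gt0//.
  have u2 : u ^+ 2 = D ^+ 2 + t ^+ 2 - 1 by rewrite sqr_sqrtr//; nra.
  have v2 : v ^+ 2 = D ^+ 2 + t' ^+ 2 - 1 by rewrite sqr_sqrtr//; nra.
  have uv0 : 0 <= u * v by rewrite mulr_ge0 ?sqrtr_ge0.
  suff : D ^+ 2 - 1 + t * t' <= u * v by lra.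
  have [neg|pos] := leP (D ^+ 2 - 1 + t * t') 0; first exact: le_trans uv0.
  rewrite -(ler_pXn2r (n := 2)) ?nnegrE ?(ltW pos)//.
  rewrite exprMn u2 v2 -subr_ge0.
  have -> : (D ^+ 2 + t ^+ 2 - 1) * (D ^+ 2 + t' ^+ 2 - 1) - (D ^+ 2 - 1 + t * t') ^+ 2 =
    (D ^+ 2 - 1) * (t - t') ^+ 2 by ring.
  by rewrite mulr_ge0 ?sqr_ge0//; nra.

have ap1 : `|a' - a| <= pi by rewrite ler_norml; apply/andP; split; lra.
by rewrite -ler_norml; exact: (cos_le_norm d0 ap1 cc).
Qed.

Lemma polar_at_le D t t' phi phi' a a' : `|t| <= `|t'| ->
  polar_at D t phi a -> polar_at D t' phi' a' -> a <= a'.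
Proof.
move=> tt P P'; have N := polar_at_norm P; have N' := polar_at_norm P'.
case: P => a0 ap _ _ _; case: P' => a0' ap' _ _ _.
have c0 := cos_gt0_half a0 ap; have c0' := cos_gt0_half a0' ap'.
have pi0 := pi_gt0 R.
have t2 : t ^+ 2 <= t' ^+ 2.
  by rewrite -[t ^+ 2]real_normK ?num_real// -[t' ^+ 2]real_normK ?num_real// lerXn2r ?nnegrE.
rewrite leNgt; apply/negP => lt.
have cc : cos a < cos a' by rewrite ltr_cos// in_itv/=; apply/andP; split; lra.
have : cos a ^+ 2 < cos a' ^+ 2 by rewrite ltrXn2r// ?(ltW c0) ?(ltW c0').
have n0 : 0 < D ^+ 2 + t ^+ 2.
  by rewrite lt_neqAle addr_ge0 ?sqr_ge0// andbT; apply/eqP => e; move: N; rewrite -e mul0r; lra.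
rewrite -(ltr_pM2l n0) N => h.
have : (D ^+ 2 + t ^+ 2) * cos a' ^+ 2 <= (D ^+ 2 + t' ^+ 2) * cos a' ^+ 2.
  by rewrite ler_wpM2r ?sqr_ge0// lerD2l.
rewrite N'; lra.
Qed.

End frame.

(** * Volumes of spherical caps *)

(** Stated with preimages, whose slices are again preimages, so that it passes to products fibre by
    fibre; a dilation by [r] therefore appears as the map [r^-1 * x]. *)
Definition scales_measure d (T : measurableType d) (R : realType) (mu : set T -> \bar R) (k : R)
    (f : T -> T) : Prop :=
  measurable_fun setT f /\
  forall S, measurable S -> mu (f @^-1` S) = (k%:E * mu S)%E.

Section product_scaling.
Context d1 d2 (T1 : measurableType d1) (T2 : measurableType d2) (R : realType).
Variables (m1 : {sigma_finite_measure set T1 -> \bar R})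
          (m2 : {sigma_finite_measure set T2 -> \bar R}).

Lemma product_measure12 (S : set (T1 * T2)) : measurable S ->
  (m1 \x m2)%E S = (m1 \x^ m2)%E S.
Proof.
move=> mS; apply: (product_measure_unique (m' := (m1 \x^ m2)%E)) => // A B mA mB.
exact: product_measure2E.
Qed.

Lemma scales_product2 (k : R) (f : T1 * T2 -> T1) : 0 <= k ->
  measurable_fun setT (fun p => (f p, p.2)) ->
  (forall b, scales_measure m1 k (fun a => f (a, b))) ->
  scales_measure (m1 \x m2)%E k (fun p => (f p, p.2)).
Proof.
move=> k0 mf hf; split => // S mS.
have mpre : measurable ((fun p => (f p, p.2)) @^-1` S).
  by rewrite -[X in measurable X]setTI; exact: mf.
rewrite !product_measure12// /product_measure2.
rewrite -ge0_integralZl//; last first.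
  by apply: measurable_fun_ysection => //; rewrite inE.
apply: eq_integral => b _ /=.
have -> : ysection ((fun p => (f p, p.2)) @^-1` S) b =
   (fun a => f (a, b)) @^-1` (ysection S b).
  by apply/seteqP; split => a /=; rewrite /ysection /= !inE.
by apply: (hf b).2; exact: measurable_ysection.
Qed.

Lemma scales_product1 (k : R) (f : T1 * T2 -> T2) : 0 <= k ->
  measurable_fun setT (fun p => (p.1, f p)) ->
  (forall a, scales_measure m2 k (fun b => f (a, b))) ->
  scales_measure (m1 \x m2)%E k (fun p => (p.1, f p)).
Proof.
move=> k0 mf hf; split => // S mS.
have mpre : measurable ((fun p => (p.1, f p)) @^-1` S).
  by rewrite -[X in measurable X]setTI; exact: mf.
rewrite /product_measure1 -ge0_integralZl//; last first.
  exact: measurable_fun_xsection.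
apply: eq_integral => a _ /=.
have -> : xsection ((fun p => (p.1, f p)) @^-1` S) a =
   (fun b => f (a, b)) @^-1` (xsection S a).
  by apply/seteqP; split => b /=; rewrite /xsection /= !inE.
by apply: (hf a).2; exact: measurable_xsection.
Qed.

End product_scaling.

Lemma scales_comp d (T : measurableType d) (R : realType) (mu : set T -> \bar R) (k l : R)
    (f g : T -> T) :
  scales_measure mu k f -> scales_measure mu l g ->
  scales_measure mu (k * l) (g \o f).
Proof.
move=> [mf hf] [mg hg]; split; first exact: measurableT_comp.
move=> S mS; rewrite comp_preimage hf; last first.
  by rewrite -[X in measurable X]setTI; exact: mg.
by rewrite hg// muleA -EFinM.
Qed.

Section lebesgue_affine.
Variable R : realType.
Notation mu := (@lebesgue_measure R).

Lemma lebesgue_scales_translation (c : R) : scales_measure mu 1 (fun x => x + c).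
Proof.
pose phi : measurableTypeR R -> measurableTypeR R := fun x => x + c.
have mf : measurable_fun setT phi by exact: measurable_funD.
split => // S mS; rewrite mul1e.
suff : pushforward mu phi S = mu S by [].
apply/esym/lebesgue_measure_unique => //= _ [[a b]] _ <-.
rewrite /pushforward.
have -> : phi @^-1` `]a, b]%classic = `]a - c, b - c]%classic.
  by apply/seteqP; split => x /=; rewrite !in_itv/= ltrBlDr lerBrDr.
rewrite !lebesgue_measure_itv/= !lte_fin ltrD2r; case: ifP => // _.
by rewrite -!EFinB; congr EFin; ring.
Qed.

Lemma lebesgue_scales_dilation (r : R) : 0 < r -> scales_measure mu r (fun x => r^-1 * x).
Proof.
move=> r0.
pose phi : measurableTypeR R -> measurableTypeR R := fun x => r^-1 * x.
have mf : measurable_fun setT phi by exact: measurable_funM.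
split => // S mS.
have r'0 : 0 <= r^-1 by rewrite invr_ge0 ltW.
pose nu := measure_function_pushforward__canonical__measure_function_Measure mu mf.
suff -> : mu S = mscale (NngNum r'0) nu S.
  by rewrite /mscale/= /pushforward muleA -EFinM divff ?gt_eqF// mul1e.
apply: lebesgue_measure_unique => //= _ [[a b]] _ <-.
rewrite /mscale/= /pushforward.
have -> : phi @^-1` `]a, b]%classic = `]a * r, b * r]%classic.
  by apply/seteqP; split => x /=; rewrite !in_itv/= /phi ![r^-1 * _]mulrC ltr_pdivlMr// ler_pdivrMr.
rewrite !lebesgue_measure_itv/= !lte_fin ltr_pM2r//; case: ifP => // _; last by rewrite mule0.
by rewrite -!EFinB -EFinM; congr EFin; field; rewrite gt_eqF.
Qed.
End lebesgue_affine.

Section plane_measure.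
Variable R : realType.
Notation mR := (measurableTypeR R).
Notation mu := (@lebesgue_measure R).

(** Named so that it can carry its own sigma-finiteness, which the product with the third axis asks
    for. *)
Definition plane_measure : set (mR * mR) -> \bar R := (mu \x mu)%E.

HB.instance Definition _ := Measure.on plane_measure.

Lemma plane_measure_sigma_finite : sigma_finite setT plane_measure.
Proof.
have /sigma_finiteP[F [TF ndF Foo]] := sigma_finiteT mu.
exists (fun n => F n `*` F n).
  rewrite -setXTT TF predeqE => -[x y]; split.
    move=> [/= [n _ Fnx] [k _ Gky]]; exists (maxn n k) => //; split.
    - by move: x Fnx; exact/subsetPset/ndF/leq_maxl.
    - by move: y Gky; exact/subsetPset/ndF/leq_maxr.
  by move=> [n _ []/= ? ?]; split; exists n.
move=> k; have [? ?] := Foo k.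
split; first exact: measurableX.
by rewrite /plane_measure product_measure1E// lte_mul_pinfty// ge0_fin_numE.
Qed.

HB.instance Definition _ := Measure_isSigmaFinite.Build _ _ _ plane_measure
  plane_measure_sigma_finite.

End plane_measure.

Section space_rotations.
Variable R : realType.
Notation mR := (measurableTypeR R).
Notation mu := (@lebesgue_measure R).
Notation mu2 := (@plane_measure R).
Notation mu3 := (mu2 \x mu)%E.
Notation V3 := (mR * mR * mR)%type.

Ltac meas := repeat first
  [ apply: measurable_funD | apply: measurable_funB | apply: measurable_funM
  | exact: measurable_cst | exact: measurable_id
  | exact: measurable_fst | exact: measurable_snd
  | apply: (measurableT_comp measurable_fst)
  | apply: (measurableT_comp measurable_snd) ].

Lemma plane_scales_xtrans (c : R) : scales_measure mu2 1 (fun p : mR * mR => (p.1 + c, p.2)).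
Proof.
apply: (@scales_product2 _ _ _ _ R mu mu _ (fun p : mR * mR => p.1 + c : mR)) => //.
  by apply/measurable_fun_pairP; split; rewrite /comp/=; meas.
by move=> b /=; exact: lebesgue_scales_translation.
Qed.

Lemma plane_scales_ytrans (c : R) : scales_measure mu2 1 (fun p : mR * mR => (p.1, p.2 + c)).
Proof.
apply: (@scales_product1 _ _ _ _ R mu mu _ (fun p : mR * mR => p.2 + c : mR)) => //.
  by apply/measurable_fun_pairP; split; rewrite /comp/=; meas.
by move=> b /=; exact: lebesgue_scales_translation.
Qed.

Lemma plane_scales_xshear (t : R) : scales_measure mu2 1 (fun p : mR * mR => (p.1 + t * p.2, p.2)).
Proof.
apply: (@scales_product2 _ _ _ _ R mu mu _ (fun p : mR * mR => p.1 + t * p.2 : mR)) => //.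
  by apply/measurable_fun_pairP; split; rewrite /comp/=; meas.
by move=> b /=; exact: lebesgue_scales_translation.
Qed.

Lemma plane_scales_yshear (t : R) : scales_measure mu2 1 (fun p : mR * mR => (p.1, p.2 + t * p.1)).
Proof.
apply: (@scales_product1 _ _ _ _ R mu mu _ (fun p : mR * mR => p.2 + t * p.1 : mR)) => //.
  by apply/measurable_fun_pairP; split; rewrite /comp/=; meas.
by move=> b /=; exact: lebesgue_scales_translation.
Qed.

Lemma plane_scales_dilation (r : R) : 0 < r ->
  scales_measure mu2 (r * r) (fun p : mR * mR => (r^-1 * p.1, r^-1 * p.2)).
Proof.
move=> r0; have r0' := ltW r0.
have h1 : scales_measure mu2 r (fun p : mR * mR => (r^-1 * p.1, p.2)).
  apply: (@scales_product2 _ _ _ _ R mu mu _ (fun p : mR * mR => r^-1 * p.1 : mR)) => //.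
    by apply/measurable_fun_pairP; split; rewrite /comp/=; meas.
  by move=> b /=; exact: lebesgue_scales_dilation.
have h2 : scales_measure mu2 r (fun p : mR * mR => (p.1, r^-1 * p.2)).
  apply: (@scales_product1 _ _ _ _ R mu mu _ (fun p : mR * mR => r^-1 * p.2 : mR)) => //.
    by apply/measurable_fun_pairP; split; rewrite /comp/=; meas.
  by move=> b /=; exact: lebesgue_scales_dilation.
exact: (scales_comp h1 h2).
Qed.

Let slice (f : V3 -> mR * mR) : 
  measurable_fun setT f ->
  (forall z, scales_measure mu2 1 (fun p => f (p, z))) ->
  scales_measure mu3 1 (fun X : V3 => (f X, X.2)).
Proof.
move=> mf hf; apply: (@scales_product2 _ _ _ _ R mu2 mu 1 f) => //.
by apply/measurable_fun_pairP; split => //; exact: measurable_snd.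
Qed.

Let fiber (f : V3 -> mR) : measurable_fun setT f ->
  (forall p, scales_measure mu 1 (fun z => f (p, z))) ->
  scales_measure mu3 1 (fun X : V3 => (X.1, f X)).
Proof.
move=> mf hf; apply: (@scales_product1 _ _ _ _ R mu2 mu 1 f) => //.
by apply/measurable_fun_pairP; split => //; exact: measurable_fst.
Qed.

Definition rot_xy (c s : R) (X : V3) : V3 :=
  ((c * X.1.1 - s * X.1.2, s * X.1.1 + c * X.1.2), X.2).
Definition rot_xz (c s : R) (X : V3) : V3 :=
  ((c * X.1.1 - s * X.2, X.1.2), s * X.1.1 + c * X.2).
Definition rot_yz (c s : R) (X : V3) : V3 :=
  ((X.1.1, c * X.1.2 - s * X.2), s * X.1.2 + c * X.2).

(* A rotation is a product of three shears, unless it is the half-turn. *)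
Let rot_scales (A B : R -> V3 -> V3) (rot : R -> R -> V3 -> V3) :
  (forall t, scales_measure mu3 1 (A t)) -> (forall t, scales_measure mu3 1 (B t)) ->
  (forall c s t, s = t * (1 + c) -> c = 1 - s * t -> rot c s = A (- t) \o (B s \o A (- t))) ->
  rot (-1) 0 = rot 0 1 \o rot 0 1 ->
  forall c s, c ^+ 2 + s ^+ 2 = 1 -> scales_measure mu3 1 (rot c s).
Proof.
move=> hA hB hr hh.
have h1 c s : 1 + c != 0 -> c ^+ 2 + s ^+ 2 = 1 -> scales_measure mu3 1 (rot c s).
  move=> c1 cs; rewrite (hr _ _ (s / (1 + c))).
  - by rewrite -[1]mulr1 -{1}[1]mulr1; apply: scales_comp => //; apply: scales_comp.
  - by rewrite divfK.
  - rewrite mulrA -expr2; have -> : s ^+ 2 = 1 - c ^+ 2 by rewrite -cs; ring.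
    by field.
move=> c s cs; have [c1|/h1] := eqVneq (1 + c) 0; last by apply.
have cE : c = -1 by apply/eqP; rewrite -subr_eq0 opprK addrC c1.
have s0 : s = 0.
  by apply/eqP; rewrite -sqrf_eq0; move: cs; rewrite cE; nra.
rewrite cE s0 hh -[1]mulr1; apply: scales_comp; apply: h1;
  by [rewrite addr0 oner_eq0 | ring].
Qed.

Lemma rot_xy_scales c s : c ^+ 2 + s ^+ 2 = 1 -> scales_measure mu3 1 (rot_xy c s).
Proof.
apply: (@rot_scales (fun t X => ((X.1.1 + t * X.1.2, X.1.2), X.2))
                   (fun t X => ((X.1.1, X.1.2 + t * X.1.1), X.2))) => //.
- move=> t; apply: (@slice (fun X => (X.1.1 + t * X.1.2, X.1.2))).
    by apply/measurable_fun_pairP; split; rewrite /comp/=; meas.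
  by move=> z /=; exact: plane_scales_xshear.
- move=> t; apply: (@slice (fun X => (X.1.1, X.1.2 + t * X.1.1))).
    by apply/measurable_fun_pairP; split; rewrite /comp/=; meas.
  by move=> z /=; exact: plane_scales_yshear.
- move=> {}c {}s t st ct; apply/funext => -[[x y] z]; rewrite /rot_xy /=.
  have e w : s * w = t * (1 + (1 - s * t)) * w by rewrite -ct -st.
  by congr ((_, _), _); rewrite ct ?(e y); ring.
- by apply/funext => -[[x y] z]; rewrite /rot_xy /=; congr ((_, _), _); ring.
Qed.

Lemma rot_xz_scales c s : c ^+ 2 + s ^+ 2 = 1 -> scales_measure mu3 1 (rot_xz c s).
Proof.
apply: (@rot_scales (fun t X => ((X.1.1 + t * X.2, X.1.2), X.2))
                   (fun t X => (X.1, X.2 + t * X.1.1))) => //.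
- move=> t; apply: (@slice (fun X => (X.1.1 + t * X.2, X.1.2))).
    by apply/measurable_fun_pairP; split; rewrite /comp/=; meas.
  by move=> z /=; exact: plane_scales_xtrans.
- move=> t; apply: (@fiber (fun X => X.2 + t * X.1.1)).
    by meas.
  by move=> z /=; exact: lebesgue_scales_translation.
- move=> {}c {}s t st ct; apply/funext => -[[x y] z]; rewrite /rot_xz /=.
  have e w : s * w = t * (1 + (1 - s * t)) * w by rewrite -ct -st.
  by congr ((_, _), _); rewrite ct ?(e z); ring.
- by apply/funext => -[[x y] z]; rewrite /rot_xz /=; congr ((_, _), _); ring.
Qed.

Lemma rot_yz_scales c s : c ^+ 2 + s ^+ 2 = 1 -> scales_measure mu3 1 (rot_yz c s).
Proof.
apply: (@rot_scales (fun t X => ((X.1.1, X.1.2 + t * X.2), X.2))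
                   (fun t X => (X.1, X.2 + t * X.1.2))) => //.
- move=> t; apply: (@slice (fun X => (X.1.1, X.1.2 + t * X.2))).
    by apply/measurable_fun_pairP; split; rewrite /comp/=; meas.
  by move=> z /=; exact: plane_scales_ytrans.
- move=> t; apply: (@fiber (fun X => X.2 + t * X.1.2)).
    by meas.
  by move=> z /=; exact: lebesgue_scales_translation.
- move=> {}c {}s t st ct; apply/funext => -[[x y] z]; rewrite /rot_yz /=.
  have e w : s * w = t * (1 + (1 - s * t)) * w by rewrite -ct -st.
  by congr ((_, _), _); rewrite ct ?(e z); ring.
- by apply/funext => -[[x y] z]; rewrite /rot_yz /=; congr ((_, _), _); ring.
Qed.

End space_rotations.

Lemma integral_deriv_poly (R : realType) (p : {poly R}) (a b : R) : a < b ->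
  (\int[lebesgue_measure]_(x in `[a, b]) ((deriv p).[x])%:E = (p.[b] - p.[a])%:E)%E.
Proof.
move=> ab; rewrite (@continuous_FTC2 _ _ (fun x => p.[x]))//.
- by apply/continuous_subspaceT => x; exact: continuous_horner.
- split=> [x _| |].
  + exact: derivable_horner.
  + by apply: cvg_at_right_filter; exact: continuous_horner.
  + by apply: cvg_at_left_filter; exact: continuous_horner.
- by move=> x _; rewrite derivE.
Qed.

Lemma integral_quadratic (R : realType) (u v a b : R) : a < b ->
  (\int[lebesgue_measure]_(x in `[a, b]) (u + v * x ^+ 2)%:E =
   (u * (b - a) + v * ((b ^+ 3 - a ^+ 3) / 3))%:E)%E.
Proof.
move=> ab; pose p : {poly R} := u *: 'X + (v / 3) *: 'X^3.
have -> : u * (b - a) + v * ((b ^+ 3 - a ^+ 3) / 3) = p.[b] - p.[a].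
  by rewrite /p !(hornerD, hornerZ, hornerX, hornerXn); field.
rewrite -integral_deriv_poly//; apply: eq_integral => x _; congr EFin.
by rewrite /p !poly.derivE !(hornerD, hornerZ, hornerX, hornerXn, hornerMn, hornerC)/=; field.
Qed.

Lemma sqr_cube_inv (R : realType) (x y : R) : x * y = 1 -> x ^+ 2 * y ^+ 3 = y.
Proof.
move=> xy; have -> : x ^+ 2 * y ^+ 3 = (x * y) ^+ 2 * y by ring.
by rewrite xy; ring.
Qed.

Section space_volumes.
Variable R : realType.
Notation mR := (measurableTypeR R).
Notation mu := (@lebesgue_measure R).
Notation mu2 := (@plane_measure R).
Notation mu3 := (mu2 \x mu)%E.
Notation V3 := (mR * mR * mR)%type.

Ltac meas := repeat lazymatch goal with
  | |- measurable_fun _ (fun x => @GRing.add _ _ (@GRing.opp _ _)) => apply: measurable_funB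
  | |- measurable_fun _ (fun x => @GRing.add _ _ _) => apply: measurable_funD
  | |- measurable_fun _ (fun x => @GRing.mul _ _ _) => apply: measurable_funM
  | |- measurable_fun _ (fun x => @GRing.exp _ _ _) => apply: measurable_funX
  | |- measurable_fun _ (fun x => x) => exact: measurable_id
  | |- measurable_fun _ (fun x => fst _) => apply: (measurableT_comp measurable_fst)
  | |- measurable_fun _ (fun x => snd _) => apply: (measurableT_comp measurable_snd)
  | |- measurable_fun _ (fun x => _) => exact: measurable_cst
  end.

Definition disc (c : R) : set (mR * mR) := [set p | p.1 ^+ 2 + p.2 ^+ 2 < c].

Lemma measurable_bool d (T : measurableType d) (f : T -> bool) :
  measurable_fun setT f -> measurable [set x | f x].
Proof.
move=> mf; have := mf measurableT [set true] I; rewrite setTI.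
by congr measurable; apply/seteqP; split => x /=.
Qed.

Lemma measurable_disc c : measurable (disc c).
Proof. by apply: measurable_bool; apply: measurable_fun_ltr; meas. Qed.

(** This number is pi; all volumes below are proportional to it, and it cancels in [vol]. *)
Definition disc_area : R := fine (mu2 (disc 1)).

Lemma disc1_fin : mu2 (disc 1) = disc_area%:E.
Proof.
rewrite /disc_area fineK// ge0_fin_numE//.
apply: (@le_lt_trans _ _ (mu2 (`[-1, 1]%classic `*` `[-1, 1]%classic))).
  apply: le_measure; rewrite ?inE; [exact: measurable_disc|by apply: measurableX|].
  move=> [x y]; rewrite /disc/= => xy; rewrite !in_itv/=.
  by split; apply/andP; split; nra.
rewrite /plane_measure product_measure1E//= !lebesgue_measure_itv/= !lte_fin.
by rewrite ifT ?ltry//; lra.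
Qed.

Lemma disc_area_gt0 : 0 < disc_area.
Proof.
rewrite -lte_fin -disc1_fin.
apply: (@lt_le_trans _ _ (mu2 (`[0, 2^-1]%classic `*` `[0, 2^-1]%classic))).
  rewrite /plane_measure product_measure1E//= !lebesgue_measure_itv/= !lte_fin ifT; last by lra.
  by rewrite oppr0 adde0 -EFinM lte_fin; lra.
apply: le_measure; rewrite ?inE; [by apply: measurableX|exact: measurable_disc|].
move=> [x y]; rewrite /disc/= !in_itv/= => -[/andP[x0 x1] /andP[y0 y1]].
nra.
Qed.

Lemma area_disc c : mu2 (disc c) = (disc_area * Num.max 0 c)%:E.
Proof.
case: (ltP 0 c) => c0; last first.
  rewrite mulr0; have -> : disc c = set0; last by rewrite measure0.
  by apply/seteqP; split => // -[x y]; rewrite /disc/=; nra.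
have r0 : 0 < Num.sqrt c by rewrite sqrtr_gt0.
have rr : Num.sqrt c * Num.sqrt c = c by rewrite -expr2 sqr_sqrtr// ltW.
have [_ /(_ (disc 1) (measurable_disc 1))] := plane_scales_dilation r0.
rewrite rr disc1_fin -EFinM mulrC => <-; congr (mu2 _).
have key x y : ((Num.sqrt c)^-1 * x) ^+ 2 + ((Num.sqrt c)^-1 * y) ^+ 2 =
    (x ^+ 2 + y ^+ 2) / c.
  by rewrite !exprMn -mulrDr exprVn expr2 rr mulrC.
by apply/seteqP; split => -[x y]; rewrite /disc/= key ltr_pdivrMr// mul1r.
Qed.

Definition dot3 (X p : V3) : R := X.1.1 * p.1.1 + X.1.2 * p.1.2 + X.2 * p.2.

(* The open solid cone over the spherical cap {u : u.p > 1}, cut by the unit ball. *)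
Definition cap (p : V3) : set V3 :=
  [set X | [&& dot3 X X < 1, 0 < dot3 X p & dot3 X X < dot3 X p ^+ 2]].

Lemma measurable_cap p : measurable (cap p).
Proof.
apply: measurable_bool; apply: measurable_and; last apply: measurable_and;
  by apply: measurable_fun_ltr; rewrite /dot3; meas.
Qed.

Lemma vol_slices (S : set V3) : measurable S ->
  mu3 S = (\int[mu]_z mu2 (ysection S z))%E.
Proof. by move=> mS; rewrite product_measure12. Qed.

(** Up to the height [c = 1 / rho] the horizontal slices are bounded by the cone, with squared
    radius [(rho ^+ 2 - 1) * z ^+ 2]; above it they are bounded by the sphere, with squared radius
    [1 - z ^+ 2]. *)
Lemma vol_cap_axis (rho : R) : 1 <= rho ->
  mu3 (cap ((0, 0), rho)) = (disc_area * (2 / 3) * (1 - rho^-1))%:E.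
Proof.
move=> r1; rewrite vol_slices; last exact: measurable_cap.
have A0 := disc_area_gt0.
have r0 : 0 < rho by lra.
pose c := rho^-1.
have c0 : 0 < c by rewrite invr_gt0.
have c1 : c <= 1 by rewrite invf_le1.
have rc : rho * c = 1 by rewrite /c divff ?gt_eqF.
rewrite -/c.
pose g1 (z : R) : \bar R := (0 + disc_area * (rho ^+ 2 - 1) * z ^+ 2)%:E.
pose g2 (z : R) : \bar R := (disc_area + (- disc_area) * z ^+ 2)%:E.
have mg1 D : measurable_fun D g1.
  by apply/measurable_EFinP; apply: measurable_funTS; meas.
have mg2 D : measurable_fun D g2.
  by apply/measurable_EFinP; apply: measurable_funTS; meas.
pose I1 : set R := `[0, c]%classic; pose I2 : set R := `]c, 1]%classic.
transitivity (\int[mu]_z ((g1 \_ I1) z + (g2 \_ I2) z))%E.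
  apply: eq_integral => z _.
  have -> : ysection (cap (0, 0, rho)) z =
      if 0 < z then disc (Num.min (1 - z ^+ 2) ((rho ^+ 2 - 1) * z ^+ 2)) else set0.
    case: ifP => z0; apply/seteqP; split => -[x y];
      rewrite /ysection/cap/disc/dot3/= ?inE/= ?lt_min ?mulr0 ?add0r.
    + by move=> /and3P[h1 h2 h3]; apply/andP; split; nra.
    + move=> /andP[h1 h2]; apply/and3P; split; [nra| |nra].
      by rewrite mulr_gt0.
    + by move=> /and3P[h1 h2 h3]; move: h2; rewrite pmulr_lgt0// z0.
    + by [].
  (* Off its domain a restricted function takes the default [point], which is 0 in [\bar R]. *)
  have pt0 : (point : \bar R) = 0%E by [].
  rewrite !patchE /I1 /I2 !mem_setE !in_itv/= /g1 /g2.
  have [z0|z0] := ltP 0 z; last first.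
    rewrite measure0; case: (ltP c z) => cz /=; first by exfalso; move: (lt_trans c0 cz); rewrite ltNge z0.
    have [->|zn0] := eqVneq z 0.
      by rewrite lexx/= expr0n/= mulr0 !addr0.
    by rewrite andbT (negbTE (_ : ~~ (0 <= z))) ?adde0// -ltNge lt_neqAle zn0.
  rewrite area_disc (ltW z0)/=; have [cz|cz] := ltP c z.
    rewrite pt0 ?andbF ?add0e; have [z1|z1] := leP z 1.
      congr EFin; rewrite min_l; last first.
        have : 1 <= rho * z by rewrite -rc ler_pM2l// ltW.
        nra.
      by rewrite max_r; [ring|nra].
    by rewrite max_l ?mulr0// ge_min; apply/orP; left; nra.
  rewrite pt0 adde0; congr EFin; rewrite min_r; last first.
    have h : rho * z <= 1 by rewrite -rc ler_pM2l.
    have : 0 <= rho * z by rewrite mulr_ge0 ?ltW.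
    nra.
  by rewrite max_r; [ring|rewrite mulr_ge0 ?sqr_ge0//; nra].
rewrite ge0_integralD//; last 4 first.
- move=> x _; rewrite patchE /I1; case: ifP => // _; rewrite lee_fin.
  by rewrite add0r mulr_ge0 ?sqr_ge0// mulr_ge0 ?(ltW A0)//; nra.
- by apply: (measurable_restrictT g1 _).1 => //; exact: measurable_itv.
- move=> x _; rewrite patchE /I2; case: ifP => //; rewrite mem_setE in_itv/= => /andP[x0 x1].
  have x2 : x ^+ 2 <= 1 by nra.
  by rewrite lee_fin mulNr subr_ge0 ler_piMr ?(ltW A0).
- by apply: (measurable_restrictT g2 _).1 => //; exact: measurable_itv.
rewrite -!integral_mkcond integral_itv_obnd_cbnd//.
rewrite integral_quadratic//.
have rc2 : rho ^+ 2 * c ^+ 3 = c by exact: sqr_cube_inv.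
have [c1'|c1'] := ltP c 1.
  rewrite integral_quadratic// -EFinD; congr EFin.
  have -> : disc_area * (2 / 3) * (1 - c) = disc_area * (rho ^+ 2 * c ^+ 3 / 3 + (2 / 3 - c)).
    by rewrite rc2; field.
  by move: c {c0 c1 rc g2 mg1 mg2 I1 I2 g1 rc2 c1'} => c; field.
have cE : c = 1 by apply/le_anti; rewrite c1 c1'.
have rE : rho = 1 by rewrite -rc cE mulr1.
by rewrite cE rE set_itv1 integral_set1 adde0; congr EFin; ring.
Qed.

(** The part of the unit ball over the belt of latitudes below [asin s]: the region swept by a cap
    of angular radius [asin s] whose centre runs along the equator. *)
Definition zone (s : R) : set V3 :=
  [set X | (dot3 X X < 1) && (X.2 ^+ 2 < s ^+ 2 * dot3 X X)].

Lemma measurable_zone s : measurable (zone s).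
Proof.
by apply: measurable_bool; apply: measurable_and; apply: measurable_fun_ltr; rewrite /dot3; meas.
Qed.

(** A slice with [|z| <= s] lies in a ring, the disc of the ball minus the disc of the double cone,
    of area proportional to [1 - z ^+ 2 / s ^+ 2]. Integration gives the share [s] of the ball, as
    in the hat-box theorem of Archimedes. *)
Lemma vol_zone_le (s : R) : 0 < s -> s <= 1 ->
  (mu3 (zone s) <= (disc_area * (4 / 3) * s)%:E)%E.
Proof.
move=> s0 s1; rewrite vol_slices; last exact: measurable_zone.
have A0 := disc_area_gt0.
have ss : s ^- 2 * s ^+ 2 = 1 by rewrite mulVf// expf_neq0// gt_eqF.
have i0 : 0 < s ^- 2 by rewrite invr_gt0 exprn_gt0.
pose I : set R := `[- s, s]%classic.
pose g (z : R) : \bar R := (disc_area + (- (disc_area * s ^- 2)) * z ^+ 2)%:E.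
have mg D : measurable_fun D g.
  by apply/measurable_EFinP; apply: measurable_funTS; meas.
have g0 z : I z -> (0 <= g z)%E.
  rewrite /I/= in_itv/= => /andP[z1 z2]; rewrite lee_fin.
  have : s ^- 2 * z ^+ 2 <= s ^- 2 * s ^+ 2 by rewrite ler_pM2l//; nra.
  by rewrite ss; nra.
have -> : (disc_area * (4 / 3) * s)%:E = (\int[mu]_(z in I) g z)%E.
  rewrite integral_quadratic; last by lra.
  by congr EFin; field; rewrite gt_eqF.
rewrite [leRHS]integral_mkcond; apply: ge0_le_integral => //.
- by apply: (measurable_fun_ysection (@plane_measure R)); exact: measurable_zone.
- by apply: (measurable_restrictT g _).1 => //; exact: measurable_itv.
move=> z _.
have sub : ysection (zone s) z `<=` disc (1 - z ^+ 2) `\` disc (s ^- 2 * z ^+ 2 - z ^+ 2).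
  move=> [x y]; rewrite /ysection/zone/disc/dot3/= ?inE/= => /andP[h1 h2].
  split; first by rewrite /=; nra.
  rewrite /=; apply/negP; rewrite -leNgt.
  have : s ^- 2 * z ^+ 2 <= s ^- 2 * (s ^+ 2 * (x * x + y * y + z * z)) by rewrite ler_pM2l// ltW.
  by rewrite [s ^- 2 * (s ^+ 2 * _)]mulrA ss; nra.
apply: (@le_trans _ _ (mu2 (disc (1 - z ^+ 2) `\` disc (s ^- 2 * z ^+ 2 - z ^+ 2)))).
  apply: le_measure => //; rewrite inE; first by apply: measurable_ysection; exact: measurable_zone.
  by apply: measurableD; exact: measurable_disc.
rewrite patchE /I mem_setE in_itv/=; case: ifP => [/andP[z1 z2]|/negbT zn].
  rewrite measureD//; [|exact: measurable_disc|exact: measurable_disc|by have := area_disc (1 - z ^+ 2) => /= ->; rewrite ltry].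
  rewrite (_ : _ `&` _ = disc (s ^- 2 * z ^+ 2 - z ^+ 2)); last first.
    apply/setIidr => -[x y]; rewrite /disc/= => /lt_le_trans; apply.
    have : s ^- 2 * z ^+ 2 <= s ^- 2 * s ^+ 2 by rewrite ler_pM2l//; nra.
    by rewrite ss; nra.
  have := area_disc (1 - z ^+ 2) => /= ->; have := area_disc (s ^- 2 * z ^+ 2 - z ^+ 2) => /= ->.
  rewrite -EFinB lee_fin.
  have h1 : z ^+ 2 <= s ^- 2 * z ^+ 2.
    by rewrite -[leLHS]mul1r ler_wpM2r ?sqr_ge0// -ss ler_piMr ?(ltW i0)//; nra.
  have h2 : z ^+ 2 <= 1 by nra.
  rewrite !max_r; [nra| |]; lra.
rewrite (_ : _ `\` _ = set0) ?measure0//; apply/seteqP; split => // -[x y]; rewrite /disc/=.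
move=> [h1]; apply.
have : s ^- 2 * s ^+ 2 < s ^- 2 * z ^+ 2.
  rewrite ltr_pM2l// ; move: zn; rewrite negb_and -!ltNge => /orP[] ?; nra.
by rewrite ss; lra.
Qed.

End space_volumes.

(** * Normalized volumes, rotations of space and the distance between caps *)

Section cap_distance.
Variable R : realType.
Notation mR := (measurableTypeR R).
Notation mu := (@lebesgue_measure R).
Notation mu2 := (@plane_measure R).
Notation mu3 := (mu2 \x mu)%E.
Notation V3 := (mR * mR * mR)%type.
Implicit Types (p q : V3) (S : set V3).

Definition in_ball S := measurable S /\ S `<=` [set X : V3 | dot3 X X < 1].

(* Normalized by the volume of the unit ball. *)
Definition vol S : R := fine (mu3 S) / (disc_area R * (4 / 3)).

Lemma vol_cst_gt0 : 0 < disc_area R * (4 / 3).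
Proof. by rewrite mulr_gt0 ?disc_area_gt0//; lra. Qed.

Lemma in_ball_fin S : in_ball S -> mu3 S \is a fin_num.
Proof.
move=> [mS sS]; rewrite ge0_fin_numE//.
pose I : set mR := `[-1, 1]%classic.
have mI : measurable I by exact: measurable_itv.
have mII : measurable (I `*` I) by exact: measurableX.
apply: (@le_lt_trans _ _ (mu3 ((I `*` I) `*` I))).
  apply: le_measure; rewrite ?inE//; first exact: measurableX.
  move=> [[x y] z] /sS; rewrite /dot3/= /I/= !in_itv/= => h.
  by split; [split|]; apply/andP; split; nra.
rewrite product_measure1E//=.
rewrite /plane_measure product_measure1E//=.
rewrite /I !lebesgue_measure_itv/= !lte_fin.
by rewrite ifT ?ltry//; lra.
Qed.

Lemma vol_ge0 S : 0 <= vol S.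
Proof. by rewrite divr_ge0 ?(ltW vol_cst_gt0)// fine_ge0. Qed.

Lemma vol_le S S' : in_ball S' -> measurable S -> S `<=` S' -> vol S <= vol S'.
Proof.
move=> bS' mS sS; have bS : in_ball S by split=> // x /sS /bS'.2.
rewrite /vol ler_pM2r ?invr_gt0 ?vol_cst_gt0// fine_le ?in_ball_fin// le_measure ?inE//.
exact: bS'.1.
Qed.

Lemma vol_le_of S (c : R) : in_ball S -> (mu3 S <= (disc_area R * (4 / 3) * c)%:E)%E -> vol S <= c.
Proof.
move=> bS h; rewrite /vol ler_pdivrMr ?vol_cst_gt0// [leRHS]mulrC -lee_fin fineK//.
exact: in_ball_fin.
Qed.

Lemma vol_eq_of S (c : R) : mu3 S = (disc_area R * (4 / 3) * c)%:E -> vol S = c.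
Proof.
move=> h; by rewrite /vol h/= mulrAC divff ?mul1r// gt_eqF// vol_cst_gt0.
Qed.

Lemma volU_disj S S' : in_ball S -> in_ball S' -> S `&` S' = set0 ->
  vol (S `|` S') = vol S + vol S'.
Proof.
move=> bS bS' d; rewrite /vol measureU//; [|exact: bS.1|exact: bS'.1].
by rewrite fineD ?in_ball_fin// mulrDl.
Qed.

Lemma in_ballD S S' : in_ball S -> measurable S' -> in_ball (S `\` S').
Proof. by move=> [mS sS] mS'; split; [exact: measurableD|move=> x [/sS]]. Qed.

Lemma in_ballI S S' : in_ball S -> measurable S' -> in_ball (S `&` S').
Proof. by move=> [mS sS] mS'; split; [exact: measurableI|move=> x [/sS]]. Qed.

Lemma in_ballU S S' : in_ball S -> in_ball S' -> in_ball (S `|` S').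
Proof. by move=> [mS sS] [mS' sS']; split; [exact: measurableU|move=> x [/sS|/sS']]. Qed.

Lemma volU_le S S' : in_ball S -> in_ball S' -> vol (S `|` S') <= vol S + vol S'.
Proof.
move=> bS bS'; have bD : in_ball (S' `\` S) by apply: in_ballD => //; exact: bS.1.
have -> : S `|` S' = S `|` (S' `\` S).
  by apply/seteqP; split=> x; [case: (pselect (S x)) => ? []; [left|left|left|right]|move=> [|[]]; [left|right]].
rewrite volU_disj ?lerD2l//; last by apply/seteqP; split=> // x [? []].
by apply: vol_le => //; exact: bD.1.
Qed.

Lemma volDI S S' : in_ball S -> measurable S' -> vol S = vol (S `\` S') + vol (S `&` S').
Proof.
move=> bS mS'; rewrite -volU_disj; [|exact: in_ballD|exact: in_ballI|].
  by congr vol; rewrite setUC setUIDK.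
by apply/seteqP; split=> // x [[_ ?] [_ ?]].
Qed.

Lemma vol_bigU_le n (F : nat -> set V3) : (forall i, in_ball (F i)) ->
  in_ball (\big[setU/set0]_(i < n) F i) /\
  vol (\big[setU/set0]_(i < n) F i) <= \sum_(i < n) vol (F i).
Proof.
move=> bF; elim: n => [|n [IH1 IH2]].
  rewrite !big_ord0 /vol measure0 mul0r; split => //; split; first exact: measurable0.
  by move=> ? [].
rewrite !big_ord_recr/=; split; first exact: in_ballU.
by apply: le_trans (volU_le _ _) _ => //; rewrite lerD2r.
Qed.

Lemma vol_bigU_disj n (F : nat -> set V3) : (forall i, in_ball (F i)) ->
  (forall i j, (i < j < n)%N -> F i `&` F j = set0) ->
  vol (\big[setU/set0]_(i < n) F i) = \sum_(i < n) vol (F i).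
Proof.
move=> bF; elim: n => [|n IH] dF.
  by rewrite !big_ord0 /vol measure0 mul0r.
rewrite !big_ord_recr/= volU_disj ?IH//; last 2 first.
- exact: (vol_bigU_le n bF).1.
- apply/seteqP; split=> // x [+ Fn]; rewrite -bigcup_mkord => -[i /= ilt Fi].
  by have : (F i `&` F n) x by []; rewrite dF// ilt/=.
by move=> i j /andP[ij jn]; apply: dF; rewrite ij/= ltnS ltnW.
Qed.

Lemma in_ball_cap p : in_ball (cap p).
Proof. by split; [exact: measurable_cap|move=> X /and3P[]]. Qed.

Definition isometry3 (O : V3 -> V3) : Prop :=
  scales_measure mu3 1 O /\ forall X Y, dot3 (O X) (O Y) = dot3 X Y.

Lemma isometry3_comp O O' : isometry3 O -> isometry3 O' -> isometry3 (O' \o O).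
Proof.
move=> [h1 h2] [h1' h2']; split; last by move=> X Y /=; rewrite h2' h2.
by rewrite -[1]mulr1; exact: scales_comp.
Qed.

Lemma isometry3_rot_xy c s : c ^+ 2 + s ^+ 2 = 1 -> isometry3 (rot_xy c s).
Proof.
move=> cs; split; first exact: rot_xy_scales.
move=> [[x y] z] [[x' y'] z']; rewrite /dot3/=.
rewrite [LHS](_ : _ = (c ^+ 2 + s ^+ 2) * (x * x' + y * y') + z * z'); last by ring.
by rewrite cs; ring.
Qed.

Lemma isometry3_rot_xz c s : c ^+ 2 + s ^+ 2 = 1 -> isometry3 (rot_xz c s).
Proof.
move=> cs; split; first exact: rot_xz_scales.
move=> [[x y] z] [[x' y'] z']; rewrite /dot3/=.
rewrite [LHS](_ : _ = (c ^+ 2 + s ^+ 2) * (x * x' + z * z') + y * y'); last by ring.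
by rewrite cs; ring.
Qed.

Lemma isometry3_rot_yz c s : c ^+ 2 + s ^+ 2 = 1 -> isometry3 (rot_yz c s).
Proof.
move=> cs; split; first exact: rot_yz_scales.
move=> [[x y] z] [[x' y'] z']; rewrite /dot3/=.
rewrite [LHS](_ : _ = (c ^+ 2 + s ^+ 2) * (z * z' + y * y') + x * x'); last by ring.
by rewrite cs; ring.
Qed.

Lemma rotation_to_axis (x y : R) : exists c s : R, [/\ c ^+ 2 + s ^+ 2 = 1,
  c * x - s * y = 0 & s * x + c * y = Num.sqrt (x ^+ 2 + y ^+ 2)].
Proof.
pose r := Num.sqrt (x ^+ 2 + y ^+ 2); rewrite -/r.
have rr : r ^+ 2 = x ^+ 2 + y ^+ 2 by rewrite sqr_sqrtr// addr_ge0 ?sqr_ge0.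
have [r0|r0] := eqVneq r 0.
  exists 1, 0; move: rr; rewrite r0 expr0n/= => rr.
  by split; nra.
exists (y / r), (x / r); split.
- by rewrite !expr_div_n -mulrDl addrC -rr divff// expf_neq0.
- by ring.
- by rewrite [LHS](_ : _ = (x ^+ 2 + y ^+ 2) / r); [rewrite -rr expr2 mulfK|ring].
Qed.

Lemma isometry3_axis p : exists2 O, isometry3 O & O p = ((0, 0), Num.sqrt (dot3 p p)).
Proof.
case: p => -[x y] z.
have [c [s [cs h1 h2]]] := rotation_to_axis x y.
pose r := Num.sqrt (x ^+ 2 + y ^+ 2).
have [c' [s' [cs' h1' h2']]] := rotation_to_axis r z.
exists (rot_yz c' s' \o rot_xy c s).
  by apply: isometry3_comp; [exact: isometry3_rot_xy|exact: isometry3_rot_yz].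
rewrite /= /rot_yz /rot_xy/= h1 h2 h1' h2'; congr (_, Num.sqrt _).
by rewrite /r sqr_sqrtr ?addr_ge0 ?sqr_ge0// /dot3/= !expr2.
Qed.

(** Two rotations make the edge parallel to the second axis; a third takes its common first and
    third coordinates to [(D, 0)]. *)
Lemma isometry3_frame p q : exists2 O, isometry3 O & exists D t t' : R,
  [/\ 0 <= D, t <= t', O p = ((D, t), 0) & O q = ((D, t'), 0)].
Proof.
case: p => -[x y] z; case: q => -[x' y'] z'.
have [c [s [cs h1 h2]]] := rotation_to_axis (x' - x) (y' - y).
set r := Num.sqrt _ in h2.
have [c1 [s1 [cs1 h11 h12]]] := rotation_to_axis (z' - z) r.
set r1 := Num.sqrt _ in h12.
pose x1 := c * x - s * y; pose y1 := s * x + c * y.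
pose y2 := c1 * y1 + s1 * z; pose z2 := - s1 * y1 + c1 * z.
have [c2 [s2 [cs2 h21 h22]]] := rotation_to_axis z2 x1.
have x1' : c * x' - s * y' = x1 by rewrite /x1; lra.
have y1' : s * x' + c * y' = y1 + r by rewrite /y1; lra.
have y2' : c1 * (y1 + r) + s1 * z' = y2 + r1 by rewrite /y2; lra.
have z2' : - s1 * (y1 + r) + c1 * z' = z2 by rewrite /z2; lra.
exists (rot_xz c2 (- s2) \o (rot_yz c1 (- s1) \o rot_xy c s)).
  apply: isometry3_comp; first apply: isometry3_comp.
  - exact: isometry3_rot_xy.
  - by apply: isometry3_rot_yz; rewrite sqrrN.
  - by apply: isometry3_rot_xz; rewrite sqrrN.
exists (Num.sqrt (z2 ^+ 2 + x1 ^+ 2)), y2, (y2 + r1).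
rewrite sqrtr_ge0 lerDl sqrtr_ge0; split => //; rewrite /= /rot_xz /rot_yz /rot_xy/=.
- rewrite -/x1 -/y1 !mulNr !opprK -/y2 -mulNr -/z2 -h22; congr ((_, _), _); lra.
- rewrite x1' y1' !mulNr !opprK y2' -[- (s1 * _)]mulNr z2' -h22; congr ((_, _), _); lra.
Qed.

Definition cdist p q : R := vol (cap p `\` cap q) + vol (cap q `\` cap p).

Lemma cdistC p q : cdist p q = cdist q p.
Proof. exact: addrC. Qed.

Lemma cdist_ge0 p q : 0 <= cdist p q.
Proof. by rewrite addr_ge0 ?vol_ge0. Qed.

Lemma cdist_triangle q p p' : cdist p p' <= cdist p q + cdist q p'.
Proof.
have key u v w : vol (cap u `\` cap w) <= vol (cap u `\` cap v) + vol (cap v `\` cap w).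
  have bD u' v' : in_ball (cap u' `\` cap v').
    by apply: in_ballD; [exact: in_ball_cap|exact: measurable_cap].
  apply: le_trans (volU_le (bD _ _) (bD _ _)).
  apply: vol_le; [exact: in_ballU|exact: (bD u w).1|].
  by move=> X [uX wX]; case: (pselect (cap v X)) => vX; [right|left].
rewrite /cdist; have := key p q p'; have := key p' q p.
move: (vol (cap p `\` cap p')) (vol (cap p' `\` cap p)) (vol (cap p `\` cap q))
  (vol (cap q `\` cap p)) (vol (cap p' `\` cap q)) (vol (cap q `\` cap p')) => a b c d e f.
lra.
Qed.

Lemma vol_isometry O S : isometry3 O -> measurable S -> vol (O @^-1` S) = vol S.
Proof. by move=> [[_ h] _] mS; rewrite /vol h// mul1e. Qed.

Lemma cap_isometry O p : isometry3 O -> O @^-1` (cap (O p)) = cap p.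
Proof.
by move=> [_ h]; apply/seteqP; split => X; rewrite /cap/= !h.
Qed.

Lemma vol_cap p : 1 <= dot3 p p -> vol (cap p) = 2^-1 * (1 - (Num.sqrt (dot3 p p))^-1).
Proof.
move=> p1; have [f iO Op] := isometry3_axis p.
rewrite -(cap_isometry p iO) vol_isometry//; last exact: measurable_cap.
apply: vol_eq_of; rewrite Op vol_cap_axis; last first.
  by rewrite -[leLHS]sqrtr1; exact: ler_wsqrtr.
by congr EFin; move: (Num.sqrt _)^-1 => x; field.
Qed.

Lemma vol_capD_isometry O p q : isometry3 O ->
  vol (cap (O p) `\` cap (O q)) = vol (cap p `\` cap q).
Proof.
move=> iO; rewrite -(cap_isometry p iO) -(cap_isometry q iO).
rewrite -[RHS]/(vol (O @^-1` (cap (O p) `\` cap (O q)))) vol_isometry//.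
by apply: measurableD; exact: measurable_cap.
Qed.

Lemma cdist_isometry O p q : isometry3 O -> cdist (O p) (O q) = cdist p q.
Proof. by move=> iO; rewrite /cdist !vol_capD_isometry. Qed.

Lemma cdist_nested p q : cap p `<=` cap q -> cdist p q = vol (cap q) - vol (cap p).
Proof.
move=> pq; rewrite /cdist (_ : cap p `\` cap q = set0); last first.
  by apply/seteqP; split => // X [/pq].
rewrite {1}/vol measure0 mul0r add0r.
rewrite [X in _ = X - _](volDI (in_ball_cap q) (measurable_cap p)).
by rewrite [cap q `&` cap p]setIidr ?addrK.
Qed.

Lemma cdist_le_vol p q : cdist p q <= vol (cap p) + vol (cap q).
Proof.
have key u v : vol (cap u `\` cap v) <= vol (cap u).
  apply: vol_le; [exact: in_ball_cap| |exact: subDsetl].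
  by apply: measurableD; exact: measurable_cap.
exact: lerD (key p q) (key q p).
Qed.

End cap_distance.

Section cap_rotation.
Variable R : realType.
Notation mR := (measurableTypeR R).
Notation mu := (@lebesgue_measure R).
Notation mu2 := (@plane_measure R).
Notation mu3 := (mu2 \x mu)%E.
Notation V3 := (mR * mR * mR)%type.
Implicit Types (p q X : V3) (rho t phi delta : R).

Local Opaque vol.

Definition arc_pt rho t : V3 := ((rho * cos t, rho * sin t), 0).

Lemma rot_arc_pt rho t u : rot_xy (cos u) (sin u) (arc_pt rho t) = arc_pt rho (t + u).
Proof.
by rewrite /rot_xy /arc_pt/= cosD sinD; congr ((_, _), _); ring.
Qed.

Lemma isometry3_angle (u : R) : isometry3 (rot_xy (cos u) (sin u)).
Proof. by apply: isometry3_rot_xy; rewrite cos2Dsin2. Qed.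

Lemma dot3_arc_pt rho t : dot3 (arc_pt rho t) (arc_pt rho t) = rho ^+ 2.
Proof.
rewrite /dot3/=; rewrite [LHS](_ : _ = rho ^+ 2 * (cos t ^+ 2 + sin t ^+ 2)); last by ring.
by rewrite cos2Dsin2 mulr1.
Qed.

Lemma vol_cap_arc_pt rho t : 1 <= rho -> vol (cap (arc_pt rho t)) = 2^-1 * (1 - rho^-1).
Proof.
move=> r1; rewrite vol_cap dot3_arc_pt; first by rewrite sqrtr_sqr ger0_norm//; lra.
by nra.
Qed.

(** For a cap centred on the equator, membership of a point depends on the angle [t - psi] to its
    azimuth alone, through a threshold that rotation about the axis does not change. A rotating cap
    therefore contains the point during a single arc of angles. *)
Lemma cap_arc_pt_cos rho t (r psi z : R) : 0 < rho -> 0 < r ->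
  let X : V3 := ((r * cos psi, r * sin psi), z) in dot3 X X < 1 ->
  (X \in cap (arc_pt rho t)) = (Num.sqrt (dot3 X X) / (rho * r) < cos (t - psi)).
Proof.
move=> rho0 r0 X X1; have rr : 0 < rho * r by rewrite mulr_gt0.
have dE : dot3 X (arc_pt rho t) = rho * r * cos (t - psi).
  by rewrite /X/dot3/= cosB; ring.
have n0 : 0 < dot3 X X.
  rewrite /X/dot3/= [X in 0 < X](_ : _ = r ^+ 2 * (cos psi ^+ 2 + sin psi ^+ 2) + z ^+ 2); last by ring.
  by rewrite cos2Dsin2; nra.
rewrite ltr_pdivrMr// mulrC; apply/idP/idP.
  rewrite inE/= /cap/= dE => /and3P[_ d0 d1].
  by rewrite -[ltRHS]ger0_norm ?(ltW d0)// -sqrtr_sqr ltr_sqrt// (lt_trans n0).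
move=> h; rewrite inE/= /cap/= X1 dE/=.
have s0 : 0 < Num.sqrt (dot3 X X) by rewrite sqrtr_gt0.
have h0 := lt_trans s0 h; rewrite h0/=.
by rewrite -(sqr_sqrtr (ltW n0)) ltrXn2r// ?(ltW s0) ?(ltW h0).
Qed.

Lemma cap_arc_pt_zone rho t : 1 < rho ->
  cap (arc_pt rho t) `<=` zone (Num.sqrt (1 - rho ^- 2)).
Proof.
move=> r1 [[x y] z] /and3P[X1 d0 d1]; rewrite /zone/= X1/=.
have r0 : 0 < rho ^+ 2 by rewrite exprn_gt0//; lra.
have h : 0 <= 1 - rho ^- 2 by rewrite subr_ge0 invf_le1//; nra.
rewrite sqr_sqrtr// mulrBl mul1r ltrBrDr -ltrBrDl mulrC ltr_pdivrMr//.
apply: lt_le_trans d1 _; rewrite /dot3/= mulr0 addr0.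
have := cos2Dsin2 t; move: (cos t) (sin t) => c s cs.
have -> : (x * x + y * y + z * z - z ^+ 2) * rho ^+ 2 =
  (x * x + y * y) * (c ^+ 2 + s ^+ 2) * rho ^+ 2 by rewrite cs; ring.
rewrite -subr_ge0.
by rewrite [X in 0 <= X](_ : _ = (rho * (x * s - y * c)) ^+ 2) ?sqr_ge0//; ring.
Qed.

(** By [arc_exit_once] the sets lost in the [N] successive rotations by [delta] are disjoint. They
    have equal volume and lie in the belt swept by the cap, whose share is at most
    [sqrt (1 - rho ^- 2)], the sine of the angular radius. *)
Lemma rotation_gap rho delta (N : nat) : 1 < rho -> 0 < delta -> N%:R * delta <= pi *+ 2 ->
  N%:R * vol (cap (arc_pt rho 0) `\` cap (arc_pt rho delta)) <= Num.sqrt (1 - rho ^- 2).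
Proof.
move=> r1 d0 Nd; have r0 : 0 < rho by lra.
pose E (j : nat) := cap (arc_pt rho (j%:R * delta)) `\` cap (arc_pt rho (j.+1%:R * delta)).
have bE j : in_ball (E j) by apply: in_ballD; [exact: in_ball_cap|exact: measurable_cap].
have volE j : vol (E j) = vol (cap (arc_pt rho 0) `\` cap (arc_pt rho delta)).
  rewrite -(vol_capD_isometry _ _ (isometry3_angle (j%:R * delta))) !rot_arc_pt add0r.
  by rewrite /E -natr1 mulrDl mul1r [delta + _]addrC.
have h0 : 0 < 1 - rho ^- 2 by rewrite subr_gt0 invf_lt1 ?exprn_gt0//; nra.
have s0 : 0 < Num.sqrt (1 - rho ^- 2) by rewrite sqrtr_gt0.
have s1 : Num.sqrt (1 - rho ^- 2) <= 1.
  by rewrite -[leRHS]sqrtr1 ler_wsqrtr// lerBlDr lerDl invr_ge0 exprn_ge0// ltW.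
have bz : in_ball (zone (Num.sqrt (1 - rho ^- 2))).
  by split; [exact: measurable_zone|move=> X /andP[]].
apply: (@le_trans _ _ (vol (zone (Num.sqrt (1 - rho ^- 2))))); last first.
  by apply: vol_le_of => //; exact: vol_zone_le.
have dE i j : (i < j < N)%N -> E i `&` E j = set0.
  move=> /andP[ij jN]; apply/seteqP; split => // -[[x y] z] [[ci ci'] [cj cj']].
  have [r [psi [rge0 _ xE yE]]] := polar_ex x y.
  subst x y; have X1 := (in_ball_cap _).2 _ ci; rewrite /= in X1.
  have rgt0 : 0 < r.
    rewrite lt_neqAle rge0 andbT; apply/eqP => r00; move: ci => /and3P[_ + _].
    by rewrite /dot3/= -r00 !mul0r mulr0 !addr0 ltxx.
  have cE t := cap_arc_pt_cos t r0 rgt0 X1.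
  have {}ci := mem_set ci; have {}ci' := memNset ci'.
  have {}cj := mem_set cj; have {}cj' := memNset cj'.
  rewrite cE in ci; rewrite cE in ci'; rewrite cE in cj; rewrite cE in cj'.
  have jd : j.+1%:R * delta <= pi *+ 2.
    by apply: le_trans Nd; rewrite ler_pM2r// ler_nat.
  apply: (arc_exit_once (k := Num.sqrt (dot3 (r * cos psi, r * sin psi, z) (r * cos psi, r * sin psi, z)) / (rho * r)) _ _ d0 ij jd (psi := psi)) => //.
  - rewrite divr_gt0 ?mulr_gt0// sqrtr_gt0.
    rewrite /dot3/= [X in 0 < X](_ : _ = r ^+ 2 * (cos psi ^+ 2 + sin psi ^+ 2) + z ^+ 2); last by ring.
    by rewrite cos2Dsin2; nra.
  - exact: lt_le_trans ci (cos_le1 _).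
  - by rewrite leNgt; apply/negP => h; rewrite h in ci'.
  - by rewrite leNgt; apply/negP => h; rewrite h in cj'.
rewrite -(_ : \sum_(i < N) vol (E i) = N%:R * _); last first.
  by under eq_bigr do rewrite volE; rewrite sumr_const card_ord mulr_natl.
rewrite -vol_bigU_disj//; apply: vol_le => //; first exact: (vol_bigU_le N bE).1.1.
rewrite -bigcup_mkord => X [i _ [Xi _]]; exact: cap_arc_pt_zone Xi.
Qed.

Lemma vol_setD_sym (S S' : set V3) : in_ball S -> in_ball S' -> vol S = vol S' ->
  vol (S `\` S') = vol (S' `\` S).
Proof.
move=> bS bS'; rewrite (volDI bS bS'.1) (volDI bS' bS.1) (setIC S').
exact: addIr.
Qed.

Lemma subadditive_steps (F : R -> R -> R) (v K : R) :
  (forall u w x, F u x <= F u w + F w x) -> (forall u, F u u = 0) ->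
  (forall u, F u (u + v) = K) -> forall n u, F u (u + n%:R * v) <= n%:R * K.
Proof.
move=> tri refl step; elim=> [|n IH] u; first by rewrite !mul0r addr0 refl.
have -> : u + n.+1%:R * v = (u + n%:R * v) + v by rewrite -natr1; ring.
apply: le_trans (tri _ (u + n%:R * v) _) _.
by rewrite step -natr1 mulrDl mul1r lerD2r.
Qed.

Lemma cdist_arc_pt_shift rho u v : 1 <= rho ->
  cdist (arc_pt rho u) (arc_pt rho (u + v)) =
    2 * vol (cap (arc_pt rho 0) `\` cap (arc_pt rho v)).
Proof.
move=> r1; rewrite -{1}[u]add0r [u + v]addrC -!rot_arc_pt cdist_isometry; last exact: isometry3_angle.
have aux (a b : R) : b = a -> a + b = 2 * a by move=> ->; ring.
apply: aux; apply: vol_setD_sym; try exact: in_ball_cap.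
exact: etrans (vol_cap_arc_pt v r1) (esym (vol_cap_arc_pt 0 r1)).
Qed.

Lemma cdist_refl p : cdist p p = 0.
Proof. by rewrite cdist_nested// subrr. Qed.

(** Over a full turn the belt is lost at most once and gained at most once, which gives [2 * s] for
    the angle [2 * pi]. As [2 * pi / delta] need not be an integer, [delta] is cut into [n] equal
    steps, and the rounding error [c / n] vanishes for large [n]. *)
Lemma cdist_rotation rho phi delta : 1 < rho -> 0 <= delta ->
  cdist (arc_pt rho phi) (arc_pt rho (phi + delta)) <= Num.sqrt (1 - rho ^- 2) * delta / pi.
Proof.
move=> r1; rewrite le_eqVlt => /predU1P[<-|d0].
  by rewrite addr0 mulr0 mul0r cdist_refl.
have r1' := ltW r1; have pi0 := pi_gt0 R.
set s := Num.sqrt _; have s0 : 0 <= s by exact: sqrtr_ge0.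
pose F u w := cdist (arc_pt rho u) (arc_pt rho w).
rewrite -/(F phi (phi + delta)).
have F0 u w : 0 <= F u w by exact: cdist_ge0.
have tri u w x : F u x <= F u w + F w x by exact: cdist_triangle.
have refl u : F u u = 0 by exact: cdist_refl.
have gap v (N : nat) : 0 < v -> N%:R * v <= pi *+ 2 -> 
    exists2 K : R, N%:R * K <= s & forall u, F u (u + v) = 2 * K.
  move=> v0 Nv; exists (vol (cap (arc_pt rho 0) `\` cap (arc_pt rho v))); first exact: rotation_gap.
  by move=> u; exact: cdist_arc_pt_shift.
move: F F0 tri refl gap => F F0 tri refl gap.
set c := F _ _; have c0 : 0 <= c by exact: F0.
have main (n : nat) : (0 < n)%N -> c * (2 * pi / delta) <= 2 * s + c / n%:R.
  move=> n0; have n0' : 0 < n%:R :> R by rewrite ltr0n.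
  pose v := delta / n%:R; have v0 : 0 < v by rewrite divr_gt0.
  pose N := Num.truncn (2 * pi / v).
  have x0 : 0 <= 2 * pi / v by rewrite divr_ge0 ?mulr_ge0 ?(ltW pi0)// ltW.
  have /andP[N1 N2] : N%:R <= 2 * pi / v < N.+1%:R by rewrite truncn_itv.
  have [|K gK step] := gap v N v0.
    by rewrite -ler_pdivlMr// -[pi *+ 2]mulr_natl.
  have := subadditive_steps tri refl step n phi; rewrite mulrC divfK ?gt_eqF// -/c => cs.
  have h1 : N%:R * c <= n%:R * (2 * s).
    apply: le_trans (ler_wpM2l _ cs) _ => //.
    by rewrite mulrCA ler_pM2l// mulrCA ler_pM2l.
  have h2 : c * (2 * pi / v) <= c * N%:R + c.
    by rewrite -[X in _ <= _ + X]mulr1 -mulrDr ler_wpM2l// natr1 ltW.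
  have h3 : c * (2 * pi / v) <= n%:R * (2 * s) + c by apply: le_trans h2 _; rewrite lerD2r mulrC.
  have e1 : c * (2 * pi / v) = n%:R * (c * (2 * pi / delta)).
    by rewrite /v; field; rewrite !gt_eqF.
  rewrite -(ler_pM2l n0') -e1.
  have -> : n%:R * (2 * s + c / n%:R) = n%:R * (2 * s) + c by field; rewrite gt_eqF.
  by [].
have : c * (2 * pi / delta) <= 2 * s.
  rewrite leNgt; apply/negP => lt.
  pose e := c * (2 * pi / delta) - 2 * s; have e0 : 0 < e by rewrite subr_gt0.
  pose n := (Num.truncn (c / e)).+1.
  have nlt : c / e < n%:R by apply: truncnS_gt.
  have := main n isT; rewrite -lerBlDl -/e ler_pdivlMr ?ltr0n// mulrC.
  by apply/negP; rewrite -ltNge -ltr_pdivrMr.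
move=> h; rewrite ler_pdivlMr//.
have : c * (2 * pi / delta) * delta <= 2 * s * delta by rewrite ler_pM2r.
rewrite mulrA divfK ?gt_eqF//; lra.
Qed.

End cap_rotation.

(** * Closed polygons around the unit ball *)

Section edge.
Variable R : realType.
Local Notation V3 := ((R * R) * R)%type.
Implicit Types D t : R.

Definition dist3 (p q : V3) : R := Num.sqrt (dot3 p p - 2 * dot3 p q + dot3 q q).

Definition frame_pt D t : V3 := ((D, t), 0).

Lemma dot3_frame_pt D t t' : dot3 (frame_pt D t) (frame_pt D t') = D ^+ 2 + t * t'.
Proof. by rewrite /dot3/=; ring. Qed.

(** The line meets the ball, and a point that moves along it away from the foot of the perpendicular
    gains directions without losing any. Indeed a point of the smaller cone has [y >= 0]: otherwise
    its product with the apex would be at most [x * D], hence at most its norm. *)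
Lemma cap_frame_pt_sub D t t' : 0 <= D -> D <= 1 -> 0 <= t -> t <= t' ->
  cap (frame_pt D t) `<=` cap (frame_pt D t').
Proof.
move=> D0 D1 t0 tt [[x y] z]; rewrite /cap /dot3/= !mulr0 !addr0 => /and3P[X1 d0 dd].
have y0 : 0 <= y.
  rewrite leNgt; apply/negP => y0.
  have ty : y * t <= 0 by nra.
  have : (x * D + y * t) ^+ 2 <= (x * D) ^+ 2 by rewrite ler_pXn2r ?nnegrE//; lra.
  have : x ^+ 2 * D ^+ 2 <= x ^+ 2 by rewrite ler_piMr ?sqr_ge0// expr_le1.
  have := sqr_ge0 y; have := sqr_ge0 z; rewrite exprMn; lra.
have yt : y * t <= y * t' by nra.
rewrite X1/=; apply/andP; split; first by lra.
apply: (lt_le_trans dd); rewrite ler_pXn2r ?nnegrE//; lra.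
Qed.

Lemma frame_flip : exists2 O, isometry3 O & forall D t, O (frame_pt D t) = frame_pt D (- t).
Proof.
exists (@rot_yz R (-1) 0); first by apply: isometry3_rot_yz; rewrite sqrrN expr1n expr0n addr0.
by move=> D t; rewrite /rot_yz /frame_pt/=; congr ((_, _), _); ring.
Qed.

Lemma cap_isometry_sub O (p q : V3) : isometry3 O -> cap (O p) `<=` cap (O q) -> cap p `<=` cap q.
Proof. by move=> iO h; rewrite -(cap_isometry p iO) -(cap_isometry q iO) => X /h. Qed.

(** This is growth from the empty cap: the square root is the length [tan a] of a tangent from [p]
    to the ball. *)
Lemma vol_cap_le (p : V3) : 1 <= dot3 p p -> vol (cap p) <= kappa R * Num.sqrt (dot3 p p - 1).
Proof.
move=> p1; rewrite vol_cap//; move: (dot3 p p) p1 => r2 r1.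
have r1' : 1 <= Num.sqrt r2 by rewrite -[leLHS]sqrtr1; exact: ler_wsqrtr.
have rr : Num.sqrt r2 ^+ 2 = r2 by rewrite sqr_sqrtr//; lra.
rewrite -rr sqrtr_sqr ger0_norm ?sqrtr_ge0//.
move: (Num.sqrt r2) r1' => r {}r1.
have [a [a0 ap ca sa]] := sec_angle r1.
have := @half_cosB_le R (kappa R) 0 a (lexx 0) a0 ap.
rewrite cos0 ca tan0 subr0 => h; apply: le_trans (h _) _.
  by move=> x _; apply: half_sin_cos2_le; rewrite addrC cos2Dsin2.
apply: ler_wpM2l; first by rewrite invr_ge0 mulr_ge0 ?sqrtr_ge0.
have rn : r != 0 by rewrite gt_eqF//; lra.
have r20 : 0 <= 1 - r ^- 2 by rewrite subr_ge0 invf_le1 ?exprn_gt0 ?exprn_ege1//; lra.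
rewrite /tan ca invrK sa -{2}[r](@ger0_norm _ r) ?(le_trans ler01)// -sqrtr_sqr -sqrtrM//.
by rewrite le_eqVlt; apply/orP; left; apply/eqP; congr Num.sqrt; field.
Qed.

(** The arcs [[l, l + 2 * a]] share the end [l], so their apexes lie on one tangent line and the
    caps are nested; the distance is a difference of areas. *)
Lemma cdist_tangent (l a1 a2 : R) : 0 <= a1 -> a1 <= a2 -> a2 < pi / 2 ->
  cdist (arc_pt (cos a1)^-1 (l + a1)) (arc_pt (cos a2)^-1 (l + a2)) = 2^-1 * (cos a1 - cos a2).
Proof.
move=> a10 a12 a2p; have pi0 := pi_gt0 R.
have c1 : 0 < cos a1 by apply: cos_gt0_half => //; lra.
have c2 : 0 < cos a2 by apply: cos_gt0_half => //; lra.
rewrite [l + a1]addrC [l + a2]addrC -!rot_arc_pt cdist_isometry; last exact: isometry3_angle.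
have fE a : 0 < cos a -> arc_pt (cos a)^-1 a = frame_pt 1 (tan a).
  by move=> ca; rewrite /arc_pt mulVf ?gt_eqF// mulrC.
rewrite cdist_nested.
  rewrite !vol_cap_arc_pt; first by rewrite !invrK; lra.
  - by rewrite invf_ge1// cos_le1.
  - by rewrite invf_ge1// cos_le1.
rewrite !fE//; apply: cap_frame_pt_sub => //.
- by apply: mulr_ge0; [apply: sin_ge0_pi; apply/andP; split; lra|rewrite invr_ge0 ltW].
- have [->//|ne] := eqVneq a1 a2.
  by rewrite ltW// ltr_tan ?in_itv/=; [lra|apply/andP; split; lra|apply/andP; split; lra].
Qed.

(* First rotate the cap of [p] about the ball until it has a tangent line in common with the cap
   of [q], then enlarge it along that line. *)
Lemma cdist_frame_outer D t t' : 1 <= D -> 1 < D ^+ 2 + t ^+ 2 -> `|t| <= t' ->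
  cdist (frame_pt D t) (frame_pt D t') <= kappa R * (t' - t).
Proof.
move=> D1 n1 tt; have pi0 := pi_gt0 R.
have [phi1 [a1 P1]] := frame_polar t D1; have [phi2 [a2 P2]] := frame_polar t' D1.
have t'0 : 0 <= t' := le_trans (normr_ge0 _) tt.
have t12 : t <= t' := le_trans (ler_norm _) tt.
have a12 : a1 <= a2 by apply: (polar_at_le _ P1 P2); rewrite (ger0_norm t'0).
have := polar_at_mono D1 t12 P1 P2; rewrite ler_norml => /andP[m1 m2].
have N1 := polar_at_norm P1.
have proj w := (polar_at_proj w P1, polar_at_proj w P2).
case: P1 => a10 a1p; rewrite ler_norml => /andP[f1 f1'] E1 E1'.
case: P2 => a20 a2p; rewrite ler_norml => /andP[f2 f2'] E2 E2'.
have c1 := cos_gt0_half a10 a1p; have c2 := cos_gt0_half a20 a2p.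
have fE phi a s : 0 < cos a -> D * cos a = cos phi -> s * cos a = sin phi ->
    frame_pt D s = arc_pt (cos a)^-1 phi.
  by rewrite /arc_pt /frame_pt => ca <- <-; congr ((_, _), _); field; rewrite gt_eqF.
have a1n : a1 != 0 by apply/eqP => e; move: N1; rewrite e cos0 expr1n mulr1; lra.
have a1g : 0 < a1 by rewrite lt_neqAle eq_sym a1n.
have c11 : cos a1 < 1.
  rewrite -cos0 ltr_cos// in_itv/=; apply/andP; split; lra.
have s1 : 0 <= sin a1 by apply: sin_ge0_pi; apply/andP; split; lra.
pose delta := (phi2 - a2) - (phi1 - a1).
have d0 : 0 <= delta by rewrite /delta; lra.
have d2 : delta <= a1 *+ 2 by rewrite /delta mulr2n; lra.
have hd w : sin (phi2 - w) / cos a2 - sin (phi1 - w) / cos a1 <= t' - t.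
  rewrite !proj; have := cos_le1 w; nra.
rewrite (fE _ _ _ c1 E1 E1') (fE _ _ _ c2 E2 E2').
apply: (le_trans (cdist_triangle (arc_pt (cos a1)^-1 (phi1 + delta)) _ _)).
have T := cdist_tangent (phi2 - a2) a10 a12 a2p.
rewrite (_ : phi2 - a2 + a1 = phi1 + delta) in T; last by rewrite /delta; ring.
rewrite (_ : phi2 - a2 + a2 = phi2) in T; last by ring.
rewrite T.
have rr : 1 < (cos a1)^-1 by rewrite invf_gt1.
have := cdist_rotation phi1 rr d0.
rewrite exprVn invrK -sin2cos2 sqrtr_sqr ger0_norm// => rot.
have bd : sin a1 * delta / pi + 2^-1 * (cos a1 - cos a2) <= kappa R * (t' - t).
  have [h|h] := leP (sin a1) (3 / 5).
    exact: cap_edge_small h.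
  by apply: cap_edge_large (ltW h).
by apply: le_trans bd; rewrite lerD2r.
Qed.

(** If the line of the edge meets the open ball ([D < 1]), incomparable caps force the foot of the
    perpendicular between [p] and [q], and the two pieces of the edge pay for the two whole caps.
    Otherwise a half-turn arranges [|t| <= t']. *)
Lemma cdist_edge (p q : V3) : 1 < dot3 p p -> 1 < dot3 q q ->
  ~ cap p `<=` cap q -> ~ cap q `<=` cap p -> cdist p q <= kappa R * dist3 p q.
Proof.
have [f iO [D [t [t' [D0 tt Op Oq]]]]] := isometry3_frame p q.
rewrite /dist3 -(iO.2 p p) -(iO.2 p q) -(iO.2 q q) => p1 q1 npq nqp; rewrite -(cdist_isometry p q iO).
have {}npq : ~ cap (f p) `<=` cap (f q) by move=> h; apply: npq; apply: cap_isometry_sub h.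
have {}nqp : ~ cap (f q) `<=` cap (f p) by move=> h; apply: nqp; apply: cap_isometry_sub h.
move: p1 q1 npq nqp; rewrite Op Oq -!/(frame_pt _ _) !dot3_frame_pt => p1 q1 npq nqp.
rewrite (_ : D ^+ 2 + t * t - _ + _ = (t' - t) ^+ 2); last by ring.
rewrite sqrtr_sqr ger0_norm ?subr_ge0//.
have [g iG gE] := frame_flip.
have gE' s : frame_pt D s = g (frame_pt D (- s)) by rewrite gE opprK.
have [D1|D1] := ltP D 1.
  have t0 : t < 0.
    by rewrite ltNge; apply/negP => t0; apply: npq; apply: cap_frame_pt_sub => //; exact: ltW.
  have t'0 : 0 < t'.
    rewrite ltNge; apply/negP => t0'; apply: nqp; apply: (cap_isometry_sub iG).
    by rewrite !gE; apply: cap_frame_pt_sub => //; [exact: ltW|rewrite oppr_ge0|rewrite lerN2].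
  apply: (le_trans (cdist_le_vol _ _)).
  have k0 : 0 <= kappa R by rewrite invr_ge0 mulr_ge0 ?sqrtr_ge0.
  have key s : 1 < D ^+ 2 + s * s -> vol (cap (frame_pt D s)) <= kappa R * `|s|.
    move=> s1; have := @vol_cap_le (frame_pt D s); rewrite dot3_frame_pt.
    move=> /(_ (ltW s1)) h; apply: (le_trans h).
    by rewrite ler_wpM2l// -sqrtr_sqr ler_wsqrtr//; nra.
  have := key _ p1; have := key _ q1; rewrite (gtr0_norm t'0) (ltr0_norm t0).
  by move: (vol _) (vol _) => A B h1 h2; lra.
have [le|lt] := leP `|t| t'; first by apply: cdist_frame_outer => //; rewrite expr2.
have tn : t < 0.
  by rewrite ltNge; apply/negP => t0; move: lt; rewrite (ger0_norm t0) ltNge tt.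
rewrite (gE' t) (gE' t') cdist_isometry// cdistC (_ : t' - t = - t - (- t')); last by ring.
apply: cdist_frame_outer => //; first by rewrite sqrrN.
by rewrite ltr0_norm// in lt; rewrite normrN ler_norml; apply/andP; split; lra.
Qed.

End edge.

(** * Sums along closed lists of vertices *)

Section closed_lists.
Variables (T : eqType) (R : realType).
Implicit Types (f : T -> T -> R) (s t c : seq T).

Fixpoint psum f p t : R := if t is q :: t' then f p q + psum f q t' else 0.

Definition csum f c : R := if c is p :: s then psum f p (rcons s p) else 0.

Lemma psum_cat f p s t : psum f p (s ++ t) = psum f p s + psum f (last p s) t.
Proof. by elim: s p => [|q s IH] p /=; rewrite ?add0r// IH addrA. Qed.

Lemma psum_rcons f p s q : psum f p (rcons s q) = psum f p s + f (last p s) q.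
Proof. by rewrite -cats1 psum_cat /= addr0. Qed.

Lemma psumD f g p t : psum (fun x y => f x y + g x y) p t = psum f p t + psum g p t.
Proof. by elim: t p => [|q t IH] p /=; rewrite ?addr0// IH; ring. Qed.

Lemma csum_rot f n c : csum f (rot n c) = csum f c.
Proof.
have [nc|nc] := leqP (size c) n; first by rewrite rot_oversize.
rewrite -{2}(cat_take_drop n c) /rot; case: (take n c) => [|p s]; first by rewrite cats0.
case: (drop n c) => [|q t]; first by rewrite cats0.
by rewrite /= !rcons_cat !psum_cat /= !psum_rcons; ring.
Qed.

Lemma csum_del f p q s : (forall x y z, f x z <= f x y + f y z) ->
  csum f (p :: s) <= csum f (p :: q :: s) /\ csum f (q :: s) <= csum f (p :: q :: s).
Proof.
move=> tri; split => /=.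
  by case: s => [|y s] /=; rewrite ?addr0 ?addrA ?lerD2r tri.
by rewrite !psum_rcons /=; have := tri (last q s) p q; lra.
Qed.

(** A closed list may be rotated so that a violating pair comes first; [head p t] makes the vertex
    of a one-element list its own neighbour. *)
Lemma not_cycle (e : rel T) c : ~~ cycle e c ->
  exists n p t, rot n c = p :: t /\ ~~ e p (head p t).
Proof.
case: c => [//|x s] /= /(pathP x) h.
have [i [si ei]] : exists i, (i < size (rcons s x))%N /\ ~~ e (nth x (x :: rcons s x) i) (nth x (rcons s x) i).
  apply: contrapT => nh; apply: h => i si; apply: contrapT => /negP he; apply: nh; by exists i.
rewrite size_rcons in si; exists i, (nth x (x :: s) i), (drop i.+1 (x :: s) ++ take i (x :: s)).
split; first by rewrite /rot (drop_nth x).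
move: ei; rewrite -rcons_cons nth_rcons si.
congr (~~ e _ _); rewrite nth_rcons.
have [lt|ge] := ltnP i (size s).
  by rewrite (drop_nth x)//=.
have ii : i = size s by apply/eqP; rewrite eqn_leq ge -ltnS si.
rewrite ii eqxx /= drop_oversize//=; case: (s) => //.
Qed.

Lemma path_switch (b : T -> Prop) p t y : y \in p :: t -> b y -> ~ b (last p t) ->
  exists t1 x z t2, [/\ p :: t = t1 ++ x :: z :: t2, b x & ~ b z].
Proof.
elim: t p y => [|q t IH] p y; first by rewrite inE => /eqP <- /=.
have [bp|nbp] := pselect (b p).
  have [bq|nbq] := pselect (b q); last by exists [::], p, q, t.
  move=> _ _ /= nl; have [t1 [x [z [t2 [e bx bz]]]]] := IH q q (mem_head _ _) bq nl.
  by exists (p :: t1), x, z, t2; rewrite e.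
rewrite inE => /orP[/eqP ->//|yt] bb /= nl.
have [t1 [x [z [t2 [e bx bz]]]]] := IH q y yt bb nl.
by exists (p :: t1), x, z, t2; rewrite e.
Qed.

End closed_lists.

Section cover.
Variable R : realType.
Local Notation V3 := ((R * R) * R)%type.
Local Opaque vol.

Fixpoint along (D : V3 -> V3 -> set V3) (p : V3) (t : seq V3) : set V3 :=
  if t is q :: t' then D p q `|` along D q t' else set0.

Lemma along_vol D p t : (forall p q, in_ball (D p q)) ->
  in_ball (along D p t) /\ vol (along D p t) <= psum (fun x y => vol (D x y)) p t.
Proof.
move=> bD; elim: t p => [|q t IH] p /=.
  by have := @vol_bigU_le R 0 (fun=> set0); rewrite !big_ord0; apply; move=> _; split; [exact: measurable0|].
have [b1 b2] := IH q; split; first exact: in_ballU.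
by apply: le_trans (volU_le (bD p q) b1) _; rewrite lerD2l.
Qed.

Lemma along_mem D p t t1 x z t2 X : p :: t = t1 ++ x :: z :: t2 -> D x z X -> along D p t X.
Proof.
elim: t p t1 => [|q t IH] p [|y t1] //=.
- by case=> _; case: t1.
- by case=> -> -> _ h; left.
- by case=> _ e h; right; apply: IH e h.
Qed.

(** A property that holds somewhere and fails somewhere on a closed list is lost on some edge. *)
Lemma along_closed D p s X (b : V3 -> Prop) :
  (forall x z, b x -> ~ b z -> D x z X) ->
  (exists2 y, y \in p :: s & b y) -> (exists2 z, z \in p :: s & ~ b z) ->
  along D p (rcons s p) X.
Proof.
move=> hD [y ys bb] [z zs bz].
have ysr : y \in p :: rcons s p by rewrite inE mem_rcons ys orbT.
have zsr : z \in p :: rcons s p by rewrite inE mem_rcons zs orbT.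
have [bp|nbp] := pselect (b p); last first.
  have [|t1 [x [w [t2 [e bx bw]]]]] := path_switch ysr bb; first by rewrite last_rcons.
  exact: along_mem e (hD _ _ bx bw).
(* Reversing the closed list turns an exit from [b] into an exit from its complement. *)
have [i zE] : exists i, rcons s p = take i (rcons s p) ++ z :: drop i.+1 (rcons s p).
  have zr : z \in rcons s p by rewrite mem_rcons.
  exists (index z (rcons s p)); rewrite -[X in X :: _](nth_index p zr) -drop_nth ?index_mem//.
  by rewrite cat_take_drop.
have [|t1 [x [w [t2 [e bx bw]]]]] := @path_switch _ b p (rcons (take i (rcons s p)) z) p (mem_head _ _) bp.
  by rewrite last_rcons.
apply: (@along_mem _ _ _ t1 x w (t2 ++ drop i.+1 (rcons s p))) (hD _ _ bx bw).
by rewrite {1}zE -cat_rcons -cat_cons e -catA.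
Qed.

(** A condition on directions, written homogeneously: some vertex has a component greater than 1
    along [X / |X|]. *)
Definition covers (c : seq V3) := forall X : V3, X != 0 ->
  exists2 p, p \in c & (0 < dot3 X p) && (dot3 X X < dot3 X p ^+ 2).

Lemma dot3N (X p : V3) : dot3 (- X) p = - dot3 X p.
Proof. by case: X => -[x y] z; rewrite /dot3/=; ring. Qed.

(** A direction [X] is seen by some vertex, and [- X] by another, which then does not see [X].
    Around the closed list [X] is therefore both lost and gained, so the sets lost fill the ball,
    and so do the sets gained. *)
Lemma cdist_cover c : covers c -> 2 <= csum (@cdist R) c.
Proof.
case: c => [|p s] cov.
  have [|q //] := cov ((1, 0), 0); apply/eqP => -[] /eqP; by rewrite oner_eq0.
pose F1 (x y : V3) := cap x `\` cap y; pose F2 (x y : V3) := cap y `\` cap x.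
have b1 x y : in_ball (F1 x y) by apply: in_ballD; [exact: in_ball_cap|exact: measurable_cap].
have b2 x y : in_ball (F2 x y) by apply: in_ballD; [exact: in_ball_cap|exact: measurable_cap].
pose e (r : R) : V3 := ((0, 0), r).
have de r : dot3 (e r) (e r) = r ^+ 2 by rewrite /dot3/=; ring.
(* The volume of the ball enters through two opposite caps, whose shares tend to 1/2 each as [rho]
   grows. *)
have key D rho : 1 <= rho -> (forall x y, in_ball (D x y)) ->
    (forall X, X != 0 -> dot3 X X < 1 -> along D p (rcons s p) X) ->
    1 - rho^-1 <= psum (fun x y => vol (D x y)) p (rcons s p).
  move=> r1 bD hD; have [bA vA] := along_vol p (rcons s p) bD.
  apply: le_trans vA.
  have sub : cap (e rho) `|` cap (e (- rho)) `<=` along D p (rcons s p).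
    by move=> X [] /and3P[X1 d0 _]; apply: hD => //; apply/eqP => X0; move: d0; rewrite X0 /dot3/= !mul0r !addr0 ltxx.
  have disj : cap (e rho) `&` cap (e (- rho)) = set0.
    apply/seteqP; split => // -[[x y] z] [/and3P[_ + _] /and3P[_ + _]]; rewrite /dot3/= !mulr0 !add0r; lra.
  have := vol_le bA _ sub; rewrite volU_disj//; try exact: in_ball_cap.
  rewrite !vol_cap ?de ?sqrrN ?sqrtr_sqr ?ger0_norm//; try nra.
  move=> h; apply: le_trans (h _); first by lra.
  by apply: measurableU; exact: measurable_cap.
have inout (X : V3) : X != 0 -> dot3 X X < 1 ->
    (exists2 y, y \in p :: s & cap y X) /\ (exists2 z, z \in p :: s & ~ cap z X).
  move=> X0 X1; split; first by have [q qc h] := cov X X0; exists q => //; rewrite /cap/= X1.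
  have [|q qc /andP[h _]] := cov (- X); first by rewrite oppr_eq0.
  by exists q => // /and3P[_ h' _]; move: h; rewrite dot3N; lra.
have H1 rho : 1 <= rho -> 1 - rho^-1 <= psum (fun x y => vol (F1 x y)) p (rcons s p).
  move=> r1; apply: key => // X X0 X1; have [h1 h2] := inout X X0 X1.
  exact: (@along_closed _ _ _ _ (fun y => cap y X)).
have H2 rho : 1 <= rho -> 1 - rho^-1 <= psum (fun x y => vol (F2 x y)) p (rcons s p).
  move=> r1; apply: key => // X X0 X1; have [h1 h2] := inout X X0 X1.
  apply: (@along_closed _ _ _ _ (fun y => ~ cap y X)) => //.
    by move=> x z nx nz; split => //; apply: contrapT.
  by case: h1 => y ys h; exists y => //; apply.
rewrite /csum (_ : psum _ _ _ = psum (fun x y => vol (F1 x y)) p (rcons s p) +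
  psum (fun x y => vol (F2 x y)) p (rcons s p)); last by rewrite -psumD.
have lim (x : R) : (forall rho, 1 <= rho -> 1 - rho^-1 <= x) -> 1 <= x.
  move=> h; rewrite leNgt; apply/negP => x1.
  have := h (Num.max 1 (2 / (1 - x))); rewrite le_max lexx => /(_ isT).
  have m0 : 0 < Num.max 1 (2 / (1 - x)) by rewrite lt_max ltr01.
  have : 2 / (1 - x) <= Num.max 1 (2 / (1 - x)) by rewrite le_max lexx orbT.
  move: (Num.max _ _) m0 => y y0; rewrite ler_pdivrMr ?subr_gt0// => h1.
  rewrite lerBlDl -lerBlDr -(ler_pM2r y0) mulVf ?gt_eqF//; nra.
by rewrite -[2]/(1 + 1); apply: lerD; apply: lim.
Qed.

Lemma dist3_triangle (q p p' : V3) : dist3 p p' <= dist3 p q + dist3 q p'.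
Proof.
have E (u v : V3) : dist3 u v = Num.sqrt ((v.1.1 - u.1.1) ^+ 2 + (v.1.2 - u.1.2) ^+ 2 + (v.2 - u.2) ^+ 2).
  by rewrite /dist3 /dot3; congr Num.sqrt; ring.
rewrite !E; case: p q p' => -[x y] z [[x1 y1] z1] [[x2 y2] z2] /=.
have -> : x2 - x = (x1 - x) + (x2 - x1) by ring.
have -> : y2 - y = (y1 - y) + (y2 - y1) by ring.
have -> : z2 - z = (z1 - z) + (z2 - z1) by ring.
move: (x1 - x) (y1 - y) (z1 - z) (x2 - x1) (y2 - y1) (z2 - z1) => {x y z x1 y1 z1 x2 y2 z2} a b c d e f.
have n0 (u v w : R) : 0 <= u ^+ 2 + v ^+ 2 + w ^+ 2 by rewrite !addr_ge0 ?sqr_ge0.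
have u2 := sqr_sqrtr (n0 a b c); have v2 := sqr_sqrtr (n0 d e f).
move: (Num.sqrt (a ^+ 2 + b ^+ 2 + c ^+ 2)) (Num.sqrt (d ^+ 2 + e ^+ 2 + f ^+ 2)) (sqrtr_ge0 (a ^+ 2 + b ^+ 2 + c ^+ 2)) (sqrtr_ge0 (d ^+ 2 + e ^+ 2 + f ^+ 2)) u2 v2 => u v u0 v0 u2 v2.
have cs : a * d + b * e + c * f <= u * v.
  have [h|h] := leP (a * d + b * e + c * f) 0; first by apply: le_trans h _; rewrite mulr_ge0.
  rewrite -(ler_pXn2r (n := 2)) ?nnegrE ?(ltW h) ?mulr_ge0// exprMn u2 v2 -subr_ge0.
  rewrite (_ : _ - _ = (a * e - b * d) ^+ 2 + (a * f - c * d) ^+ 2 + (b * f - c * e) ^+ 2)//; ring.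
rewrite -(@ger0_norm _ (u + v)) ?addr_ge0// -sqrtr_sqr ler_wsqrtr//.
lra.
Qed.

Lemma cap_empty (p : V3) : dot3 p p <= 1 -> cap p = set0.
Proof.
case: p => -[a b] c; rewrite /dot3/= => p1; apply/seteqP; split => // -[[x y] z] /and3P[_ _].
rewrite /dot3/= => h.
have : (x * a + y * b + z * c) ^+ 2 <= (x * x + y * y + z * z) * (a * a + b * b + c * c).
  rewrite -subr_ge0 (_ : _ - _ = (x * b - y * a) ^+ 2 + (x * c - z * a) ^+ 2 + (y * c - z * b) ^+ 2); last by ring.
  by rewrite !addr_ge0 ?sqr_ge0.
have n0 : 0 <= x * x + y * y + z * z by rewrite !addr_ge0 ?mulr_ge0_le0// -expr2 sqr_ge0.
move: h; rewrite ltNge => /negP h h'; apply: h; apply: (le_trans h').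
by rewrite ler_piMr.
Qed.

(* A vertex whose cap lies in the cap of a neighbour can be deleted; otherwise [cdist_edge] applies
   to all edges. *)
Lemma closed_length_cover c : covers c -> 6 * Num.sqrt 3 <= csum (@dist3 R) c.
Proof.
pose e : rel V3 := fun p q => `[< ~ cap p `<=` cap q /\ ~ cap q `<=` cap p >].
have k0 : 0 < kappa R by rewrite invr_gt0 mulr_gt0 ?sqrtr_gt0.
have [n] := ubnP (size c); elim: n c => // n IH c sz cov.
have [cy|/not_cycle[i [p [t [ce]]]]] := boolP (cycle e c).
  suff h : csum (@cdist R) c <= kappa R * csum (@dist3 R) c.
    have := le_trans (cdist_cover cov) h; rewrite /kappa mulrC ler_pdivlMr ?mulr_gt0 ?sqrtr_gt0//.
    by rewrite mulrA (_ : 2 * 3 = 6)//; ring.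
  case: c cy {sz cov} => [|x s] /=; first by rewrite mulr0.
  move: (rcons s x) => u; move: {s} x u => p u; elim: u p => [|q t IHt] p /=; first by rewrite mulr0.
  move=> /andP[/asboolP[npq nqp] pt]; rewrite mulrDr lerD ?IHt//.
  apply: cdist_edge => //; rewrite ltNge; apply/negP => h.
    by apply: npq; rewrite cap_empty.
  by apply: nqp; rewrite cap_empty.
rewrite -(csum_rot _ i); have {}cov : covers (p :: t).
  by move=> X /cov[q qc h]; exists q => //; rewrite -ce mem_rot.
have {}sz : (size (p :: t) < n.+1)%N by rewrite -ce size_rot.
rewrite ce; case: t {ce} cov sz => [|q t] cov sz /=.
  by have := cdist_cover cov; rewrite /= cdist_refl addr0 => ?; lra.
have [d1 d2] := @csum_del _ _ (@dist3 R) p q t (fun x y z => dist3_triangle y x z).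
have step r r' : perm_eq [:: p; q] [:: r; r'] -> cap r `<=` cap r' ->
    csum (@dist3 R) (r' :: t) <= csum (@dist3 R) [:: p, q & t] ->
    6 * Num.sqrt 3 <= csum (@dist3 R) [:: p, q & t].
  move=> pe sub le; apply: le_trans le; apply: IH => // X X0.
  have n0 : 0 <= dot3 X X by case: X {X0} => -[x y] z; rewrite /dot3/= !addr_ge0// -expr2 sqr_ge0.
  (* Caps are cut by the unit ball, so [X] is shrunk into it before an inclusion of caps can be
     applied. *)
  pose b := (1 + dot3 X X)^-1.
  have b0 : 0 < b by rewrite invr_gt0; lra.
  pose Y : V3 := ((b * X.1.1, b * X.1.2), b * X.2).
  have YE u : dot3 Y u = b * dot3 X u by rewrite /dot3/=; ring.
  have YY : dot3 Y Y = b ^+ 2 * dot3 X X by rewrite /dot3/=; ring.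
  have Y1 : dot3 Y Y < 1.
    by rewrite YY exprVn mulrC ltr_pdivrMr ?exprn_gt0//; [nra|lra].
  have coneE u : cap u Y <-> (0 < dot3 X u) && (dot3 X X < dot3 X u ^+ 2).
    by rewrite /cap/= Y1/= YY YE exprMn pmulr_rgt0// ltr_pM2l ?exprn_gt0.
  have [u uc /coneE hu] := cov X X0.
  have : u \in [:: r, r' & t].
    by move: uc; rewrite -[p :: q :: t]/([:: p; q] ++ t) -[r :: r' :: t]/([:: r; r'] ++ t) !mem_cat (perm_mem pe).
  rewrite inE => /orP[/eqP ur|ut].
    by exists r'; rewrite ?mem_head//; apply/coneE; apply: sub; rewrite -ur.
  by exists u => //; apply/coneE.
have [h|h] := pselect (cap p `<=` cap q).
  by move=> _; apply: (step p q).
move=> /asboolPn ne; have {}ne : cap q `<=` cap p.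
  by apply: contrapT => h'; apply: ne.
by apply: (step q p) => //; apply/permP => x /=; rewrite !addn0 addnC.
Qed.

End cover.

(** * Directions with four alternations *)

Section tucker.

(* [(false, _)] stands for +-1 and [(true, _)] for +-2; the second component is the sign bit. *)
Definition label := (bool * bool)%type.
Definition antipode (a : label) : label := (a.1, ~~ a.2).
Definition compatible (a b : label) := (a.1 == b.1) ==> (a.2 == b.2).

Local Definition plus_edge (a b : label) := [&& ~~ a.2, ~~ b.2 & a.1 (+) b.1].

(** Compatibility of all pairs, diagonals included, leaves one sign for each kind of label. If both
    signs are plus, the edges counted are the changes of kind around the cell, an even number;
    otherwise none is counted. *)
Lemma plus_edge_cell (a b c d : label) :
  compatible a b -> compatible a c -> compatible a d ->
  compatible b c -> compatible b d -> compatible c d ->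
  plus_edge a b (+) plus_edge c d = plus_edge a c (+) plus_edge b d.
Proof.
by case: a => -[] []; case: b => -[] []; case: c => -[] []; case: d => -[] [].
Qed.

(* Walking around the 4-cycle +1, +2, -1, -2 of labels, a step crosses the cut
   separating {+1, -2} from {+2, -1} exactly along the edges {+1, +2} and {-1, -2}. *)
Lemma plus_edge_antipode (a b : label) : compatible a b ->
  plus_edge a b (+) plus_edge (antipode a) (antipode b) = (a.1 (+) a.2) (+) (b.1 (+) b.2).
Proof. by case: a => -[] []; case: b => -[] []. Qed.

Lemma plus_edgeC a b : plus_edge a b = plus_edge b a.
Proof. by rewrite /plus_edge addbC; case: (~~ a.2); case: (~~ b.2). Qed.

Lemma xor_telescope (f : nat -> bool) n :
  \big[addb/false]_(i < n) (f i (+) f i.+1) = f 0%N (+) f n.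
Proof.
elim: n => [|n IH]; first by rewrite big_ord0 addbb.
by rewrite big_ord_recr/= IH -addbA; congr addb; rewrite addbA addbb.
Qed.

(** By [plus_edge_cell] the number of edges [{+1, +2}] on the boundary of the square is even.
    Pairing opposite boundary edges with [plus_edge_antipode] makes this parity a telescoping sum
    that compares the labels at [(N, 0)] and [(0, N)]; these are antipodes, so it is odd. *)
Lemma tucker N (l : nat -> nat -> label) :
  (forall i j (a b c d : bool), (i < N)%N -> (j < N)%N ->
     compatible (l (a + i) (b + j)) (l (c + i) (d + j)))%N ->
  (forall i, (i <= N)%N -> l (N - i) N = antipode (l i 0))%N ->
  (forall j, (j <= N)%N -> l N (N - j) = antipode (l 0 j))%N -> False.
Proof.
move=> comp anti_h anti_v.
pose H i j := plus_edge (l i j) (l i.+1 j).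
pose V i j := plus_edge (l i j) (l i j.+1).
pose s i j := (l i j).1 (+) (l i j).2.
have cell i j : (i < N)%N -> (j < N)%N -> H i j (+) H i j.+1 = V i j (+) V i.+1 j.
  move=> iN jN; have c a b c d := comp i j a b c d iN jN.
  apply: plus_edge_cell; [exact: (c false false true false)|exact: (c false false false true)|
    exact: (c false false true true)|exact: (c true false false true)|
    exact: (c true false true true)|exact: (c false true true true)].
have total : \big[addb/false]_(i < N) (H i 0%N (+) H i N) =
             \big[addb/false]_(j < N) (V 0%N j (+) V N j).
  under eq_bigr => i _ do rewrite -(xor_telescope (H i)).
  under [RHS]eq_bigr => j _ do rewrite -(xor_telescope (V^~ j)).
  rewrite exchange_big; apply: eq_bigr => j _; apply: eq_bigr => i _; exact: cell.
have hor : \big[addb/false]_(i < N) (H i 0%N (+) H i N) = s 0%N 0%N (+) s N 0%N.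
  rewrite big_split/= [X in _ (+) X](reindex_inj rev_ord_inj)/= -big_split/=.
  rewrite -(xor_telescope (s^~ 0%N)); apply: eq_bigr => i _.
  rewrite -plus_edge_antipode; last exact: (comp i 0%N false false true false (ltn_ord i) (leq_ltn_trans (leq0n _) (ltn_ord i))).
  congr addb; rewrite /H -!anti_h ?(ltnW (ltn_ord i))// plus_edgeC; congr plus_edge.
  by rewrite subnSK.
have ver : \big[addb/false]_(j < N) (V 0%N j (+) V N j) = s 0%N 0%N (+) s 0%N N.
  rewrite big_split/= [X in _ (+) X](reindex_inj rev_ord_inj)/= -big_split/=.
  rewrite -(xor_telescope (s 0%N)); apply: eq_bigr => i _.
  rewrite -plus_edge_antipode; last exact: (comp 0%N i false false false true (leq_ltn_trans (leq0n _) (ltn_ord i)) (ltn_ord i)).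
  congr addb; rewrite /V -!anti_v ?(ltnW (ltn_ord i))// plus_edgeC; congr plus_edge.
  by rewrite subnSK.
move: total; rewrite hor ver => /addbI; rewrite /s.
have -> : l 0%N N = antipode (l N 0%N) by rewrite -anti_h// subnn.
by rewrite /=; case: (l N 0%N) => -[] [].
Qed.

End tucker.

(** * Alternation between near extrema *)

Section alternation.
Variables (R : realType) (m : nat).
Implicit Types (h : nat -> R) (e : R).

(** The slack makes the notion stable: when the profile changes by at most [d], near extrema persist
    with slack [e + 2 * d], which allows neighbouring directions to be compared. *)
Definition near_max e h i := (i <= m)%N /\ forall j, (j <= m)%N -> h j <= h i + e.
Definition near_min e h i := near_max e (fun j => - h j) i.

Definition alt3 e h := exists i j k, [/\ (i < j < k)%N, near_max e h i, near_min e h j & near_max e h k].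
Definition alt3' e h := alt3 e (fun j => - h j).
Definition alt4 e h := exists i j k l, [/\ (i < j < k)%N, (k < l)%N & 
  [/\ near_max e h i, near_min e h j, near_max e h k & near_min e h l] \/
  [/\ near_min e h i, near_max e h j, near_min e h k & near_max e h l]].

Definition spread e h := exists i j, [/\ (i <= m)%N, (j <= m)%N & h j + e < h i].

Lemma funNK h : (fun j => - - h j) = h.
Proof. by apply/funext => j; rewrite opprK. Qed.

Lemma near_maxW e e' h i : e <= e' -> near_max e h i -> near_max e' h i.
Proof. by move=> ee [im hi]; split => // j /hi; lra. Qed.

Lemma near_max_close e d h h' i : (forall j, (j <= m)%N -> `|h j - h' j| <= d) ->
  near_max e h i -> near_max (e + 2 * d) h' i.
Proof.
move=> hh [im hi]; split => // j jm; have := hi j jm.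
by have := hh j jm; have := hh i im; rewrite !ler_norml => /andP[? ?] /andP[? ?]; lra.
Qed.

Lemma alt3_close e d h h' : (forall j, (j <= m)%N -> `|h j - h' j| <= d) ->
  alt3 e h -> alt3 (e + 2 * d) h'.
Proof.
move=> hh [i [j [k [ijk h1 h2 h3]]]]; exists i, j, k; split => //; try exact: near_max_close hh _.
by apply: near_max_close h2 => n nm; rewrite -opprD normrN; exact: hh.
Qed.

Lemma near_max_min e h i j : near_max e h i -> near_min e h j -> spread (e *+ 2) h -> i != j.
Proof.
move=> [_ h1] [_ h2] [i0 [j0 [im jm s]]]; apply/eqP => ij; rewrite ij in h1.
by have := h1 _ im; have := h2 _ jm; rewrite mulr2n in s; lra.
Qed.

(** The first indices of the two alternations differ, since no index is near both extremes; the
    earlier one, put in front of the other alternation, gives four terms. *)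
Lemma alt3_alt3' e h : spread (e *+ 2) h -> alt3 e h -> alt3' e h -> alt4 e h.
Proof.
move=> sp [i [j [k [/andP[ij jk] Mi mj Mk]]]] [i' [j' [k' [/andP[ij' jk'] mi']]]].
rewrite /near_min funNK => Mj' mk'.
have [lt|gt|e0] := ltngtP i i'.
- by exists i, i', j', k'; split; rewrite ?lt//; left.
- by exists i', i, j, k; split; rewrite ?gt//; right.
- by move: (near_max_min Mi mi' sp); rewrite e0 eqxx.
Qed.

Lemma alt2_alt3 e h i j i' j' : spread (e *+ 2) h -> (i < j)%N -> (i' < j')%N ->
  near_max e h i -> near_min e h j -> near_min e h i' -> near_max e h j' ->
  alt3 e h \/ alt3' e h.
Proof.
move=> sp ij ij' Mi mj mi' Mj'; have [lt|gt|e0] := ltngtP j j'.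
- by left; exists i, j, j'; split; rewrite ?ij.
- by right; exists i', j', j; split; rewrite ?ij'// /near_min funNK.
- by move: (near_max_min Mj' mj sp); rewrite e0 eqxx.
Qed.

Lemma near_max_ex h : exists i, near_max 0 h i.
Proof.
have [i _ hi] := @Order.TotalTheory.arg_maxP _ R 'I_m.+1 ord0 xpredT (fun i => h i) isT.
exists i; split; first by rewrite -ltnS ltn_ord.
by move=> j jm; rewrite addr0; exact: (hi (Ordinal (jm : (j < m.+1)%N))).
Qed.

(** A profile is labelled +-2 if it has an alternation of three terms, the sign telling which kind;
    otherwise +-1, the sign telling which extreme comes first. Without an alternation of four terms
    the sign is unambiguous and flips with the profile, and neighbours never carry opposite labels,
    against [tucker]. *)
Lemma grid_alt4 e N (h : nat -> nat -> nat -> R) : 0 <= e ->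
  (forall i, (i <= N)%N -> h (N - i)%N N = fun k => - h i 0%N k) ->
  (forall j, (j <= N)%N -> h N (N - j)%N = fun k => - h 0%N j k) ->
  (forall i j (a b c d : bool) k, (i < N)%N -> (j < N)%N -> (k <= m)%N ->
     `|h (a + i)%N (b + j)%N k - h (c + i)%N (d + j)%N k| <= e / 2) ->
  (forall i j, (i <= N)%N -> (j <= N)%N -> spread (e *+ 4) (h i j)) ->
  exists i j, [/\ (i <= N)%N, (j <= N)%N & alt4 (e *+ 2) (h i j)].
Proof.
move=> e0 anti_h anti_v close sp; apply: contrapT => nalt.
have sp1 i j : (i <= N)%N -> (j <= N)%N -> spread (e *+ 2) (h i j).
  move=> iN jN; have [i0 [j0 [im jm s]]] := sp i j iN jN; exists i0, j0; split => //.
  apply: le_lt_trans s; rewrite lerD2l (mulrnA e 2 2) [leRHS]mulr2n lerDl mulrn_wge0//.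
have no4 i j : (i <= N)%N -> (j <= N)%N -> alt3 (e *+ 2) (h i j) -> alt3' (e *+ 2) (h i j) -> False.
  move=> iN jN h1 h2; apply: nalt; exists i, j; split => //; apply: alt3_alt3' => //.
  by rewrite -mulrnA; exact: sp.
have W (e1 e2 : R) g : e1 <= e2 -> alt3 e1 g -> alt3 e2 g.
  by move=> ee [x [y [z [xyz h1 h2 h3]]]]; exists x, y, z; split => //; apply: near_maxW ee _.
have e2 : e <= e *+ 2 by rewrite mulr2n; lra.
have E1 : e + 2 * (e / 2) = e *+ 2 by rewrite mulr2n; field.
have E2 : 0 + 2 * (e / 2) = e by field.
(* Exact extrema, of slack 0: at a neighbour they have slack [e], where both orders together would
   yield an alternation of three terms of slack [e]. Such alternations in turn acquire slack [2 * e]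
   at a neighbour, which is the slack of the conclusion. *)
pose first_max g := exists i j, [/\ (i < j)%N, near_max 0 g i & near_min 0 g j].
pose lab g : label := if `[< alt3 e g \/ alt3' e g >] then (true, `[< alt3' e g >])
                      else (false, ~~ `[< first_max g >]).
have labN g : spread (e *+ 2) g -> ~ (alt3 e g /\ alt3' e g) ->
    lab (fun k => - g k) = antipode (lab g).
  move=> spg no; rewrite /lab /alt3' funNK.
  have -> : `[< alt3 e (fun k => - g k) \/ alt3 e g >] = `[< alt3 e g \/ alt3' e g >].
    by apply/asbool_equiv_eq; rewrite /alt3'; tauto.
  case: asboolP => [h1|h1] /=; rewrite /antipode/=; congr pair.
    apply/idP/idP; last by move=> /asboolPn h2; apply/asboolP; case: h1.
    by move=> /asboolP h2; apply/asboolPn => h3; apply: no.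
  have [x Mx] := near_max_ex g; have [y my] := near_max_ex (fun k => - g k).
  have Mx' := near_maxW e0 Mx; have my' := near_maxW e0 my.
  have xy : x != y := near_max_min Mx' my' spg.
  rewrite negbK; apply/idP/idP => [/asboolPn h2|].
    apply/asboolP; exists x, y; split => //.
    rewrite ltn_neqAle xy/= leqNgt; apply/negP => yx; apply: h2.
    by exists y, x; split => //; rewrite /near_min funNK.
  move=> /asboolP [a [b [ab Ma mb]]]; apply/asboolPn => -[a' [b' [ab' ma']]].
  rewrite /near_min funNK => Mb'.
  apply: h1; apply: (alt2_alt3 spg ab ab'); exact: near_maxW e0 _.
have no i j : (i <= N)%N -> (j <= N)%N -> ~ (alt3 e (h i j) /\ alt3' e (h i j)).
  by move=> iN jN [h1 h2]; apply: (no4 i j) => //; apply: W e2 _.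
apply: (@tucker N (fun i j => lab (h i j))); last 2 first.
- by move=> i iN; rewrite anti_h// labN//; [exact: sp1|exact: no].
- by move=> j jN; rewrite anti_v// labN//; [exact: sp1|exact: no].
move=> i j a b c d iN jN.
have ai : (a + i <= N)%N by case: (a) => //; rewrite add0n ltnW.
have bj : (b + j <= N)%N by case: (b) => //; rewrite add0n ltnW.
have ci : (c + i <= N)%N by case: (c) => //; rewrite add0n ltnW.
have dj : (d + j <= N)%N by case: (d) => //; rewrite add0n ltnW.
have cl1 k : (k <= m)%N -> `|h (a + i)%N (b + j)%N k - h (c + i)%N (d + j)%N k| <= e / 2 by exact: close.
have cl2 k : (k <= m)%N -> `|h (c + i)%N (d + j)%N k - h (a + i)%N (b + j)%N k| <= e / 2 by exact: close.
move: (no _ _ ai bj) (no _ _ ci dj) (no4 _ _ ai bj) (no4 _ _ ci dj) (sp1 _ _ ai bj) (sp1 _ _ ci dj) cl1 cl2.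
move: (h (a + i)%N (b + j)%N) (h (c + i)%N (d + j)%N) => g g' no1 no2 n1 n2 s1 s2 cl1 cl2.
(* Two neighbouring profiles with complementary labels would both show up, at a coarser level, in one of them. *)
have key (u v : nat -> R) : (forall k, (k <= m)%N -> `|u k - v k| <= e / 2) ->
    (forall k, (k <= m)%N -> `|v k - u k| <= e / 2) ->
    (alt3 (e *+ 2) v -> alt3' (e *+ 2) v -> False) -> spread (e *+ 2) u -> spread (e *+ 2) v ->
    (lab u).1 = (lab v).1 -> ~~ (lab u).2 -> (lab v).2 -> False.
  move=> uv vu n4 su sv; rewrite /lab.
  case: (asboolP (alt3 e u \/ _)) => [h1|h1]; case: (asboolP (alt3 e v \/ _)) => [h2|h2] //= _.
    move=> /asboolPn nb /asboolP b'; case: h1 => // au; apply: n4.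
      by have := alt3_close uv au; rewrite E1.
    exact: (W _ _ _ e2 b').
  rewrite negbK => /asboolP[x [y [xy Mx my]]] /asboolPn nf.
  have [x' Mx'] := near_max_ex v; have [y' my'] := near_max_ex (fun k => - v k).
  have xy' : x' != y' := near_max_min (near_maxW e0 Mx') (near_maxW e0 my') sv.
  have yx : (y' < x')%N.
    by rewrite ltn_neqAle eq_sym xy' leqNgt; apply/negP => lt; apply: nf; exists x', y'.
  apply: h2; apply: (alt2_alt3 sv xy yx); last 2 first.
  - exact: near_maxW e0 my'.
  - exact: near_maxW e0 Mx'.
  - by have := near_max_close uv Mx; rewrite E2.
  - have vu' k : (k <= m)%N -> `|- u k - - v k| <= e / 2 by move=> km; rewrite -opprD normrN; exact: uv.
    by have := near_max_close vu' my; rewrite E2.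
apply/implyP => /eqP k12; apply: contrapT.
case L1: (lab g).2; case L2: (lab g').2 => nn; try exact: nn.
  by apply: (@key g' g); rewrite ?L2 ?L1 ?k12.
by apply: (@key g g'); rewrite ?L2 ?L1 ?k12.
Qed.

End alternation.

Section total_variation.
Variables (R : realType) (m : nat).
Implicit Types (h : nat -> R) (e : R).

Definition tv h := \sum_(i < m) `|h i.+1 - h i|.

Lemma var_between_ge h i j : (i <= j)%N -> `|h j - h i| <= \sum_(i <= l < j) `|h l.+1 - h l|.
Proof.
elim: j => [|j IH]; first by rewrite leqn0 => /eqP ->; rewrite big_geq// subrr normr0.
rewrite leq_eqVlt => /orP[/eqP ->|]; first by rewrite big_geq// subrr normr0.
rewrite ltnS => ij; rewrite big_nat_recr//=.
have -> : h j.+1 - h i = (h j - h i) + (h j.+1 - h j) by ring.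
by apply: le_trans (ler_normD _ _) _; rewrite lerD2r; exact: IH.
Qed.

Lemma tv_split h i j k l : (i <= j)%N -> (j <= k)%N -> (k <= l)%N -> (l <= m)%N ->
  `|h i - h 0%N| + `|h j - h i| + `|h k - h j| + `|h l - h k| + `|h m - h l| <= tv h.
Proof.
move=> ij jk kl lm; rewrite /tv -(big_mkord xpredT (fun i => `|h i.+1 - h i|)).
rewrite (big_cat_nat (n := l))//= (big_cat_nat (n := k))//=.
rewrite (big_cat_nat (n := j))//=.
rewrite (big_cat_nat (n := i))//=.
by rewrite !lerD// var_between_ge.
Qed.

Lemma tv_ge0 h : 0 <= tv h. Proof. by rewrite sumr_ge0. Qed.

(** The four indices bound three swings; on a closed profile the way from the last index through the
    common end point to the first is a fourth. *)
Lemma alt4_tv e h W a b : alt4 m e h -> (a <= m)%N -> (b <= m)%N -> W <= h a - h b ->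
  3 * (W - e *+ 2) <= tv h /\ (h m = h 0%N -> 4 * (W - e *+ 2) <= tv h).
Proof.
move=> [i [j [k [l [/andP[ij jk] kl alt]]]]] am bm Wab; rewrite mulr2n.
have near x y : near_max m e h x -> near_min m e h y -> W - (e + e) <= h x - h y.
  by move=> [xm /(_ _ am) hx] [ym /(_ _ bm) hy]; lra.
have lm : (l <= m)%N by case: alt => -[_ _ _ []].
have := tv_split h (ltnW ij) (ltnW jk) (ltnW kl) lm.
have := ler_norm (h i - h 0%N); have := ler_norm (h 0%N - h i).
have := ler_norm (h m - h l); have := ler_norm (h l - h m).
have := ler_norm (h j - h i); have := ler_norm (h i - h j).
have := ler_norm (h k - h j); have := ler_norm (h j - h k).
have := ler_norm (h l - h k); have := ler_norm (h k - h l).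
rewrite (distrC (h i) (h j)) (distrC (h j) (h k)) (distrC (h k) (h l)) (distrC (h l) (h m)) (distrC (h 0%N) (h i)).
have := normr_ge0 (h i - h 0%N); have := normr_ge0 (h m - h l).
move: `|_| `|_| `|_| `|_| `|_| => t1 t2 t3 t4 t5.
case: alt => -[h1 h2 h3 h4].
- by have := near _ _ h1 h2; have := near _ _ h3 h2; have := near _ _ h3 h4; have := near _ _ h1 h4;
    move=> *; split=> *; lra.
- by have := near _ _ h2 h1; have := near _ _ h2 h3; have := near _ _ h4 h3; have := near _ _ h4 h1;
    move=> *; split=> *; lra.
Qed.

End total_variation.

Section alternating_direction.
Variables (R : realType) (m : nat).

Definition has_spread (W : R) (h : nat -> R) := exists i j, [/\ (i <= m)%N, (j <= m)%N & W <= h i - h j].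

(* The point of the upper half of an octahedron over (x, y) is (x, y, 1 - max(|x|,|y|)). *)
Lemma alternating_direction (A B C : nat -> R) (W eps : R) : 0 < eps ->
  (forall x y z, x ^+ 2 + y ^+ 2 + z ^+ 2 = 1 -> has_spread W (fun i => x * A i + y * B i + z * C i)) ->
  exists x y z, x ^+ 2 + y ^+ 2 + z ^+ 2 = 1 /\
   let h i := x * A i + y * B i + z * C i in
   3 * (W - eps) <= tv m h /\ (h m = h 0%N -> 4 * (W - eps) <= tv m h).
Proof.
move=> eps0 wide.
have [We|We] := leP W eps.
  exists 1, 0, 0; split; first by rewrite expr1n !expr0n/=; ring.
  by have := tv_ge0 m (fun i => 1 * A i + 0 * B i + 0 * C i); split=> *; lra.
(* Slack [2 * e] costs [4 * e = eps / 2] per swing; the remaining factor 2 is used up by the norm of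
   the unnormalized direction, which is only known to be at least 1/2. *)
pose e := eps / 8; have e0 : 0 < e by rewrite /e; lra.
have e4 : e *+ 4 = eps / 2 by rewrite -mulr_natr /e; field.
pose S := \sum_(k < m.+1) (`|A k| + `|B k| + `|C k|).
have S0 : 0 <= S by apply: sumr_ge0 => k _; rewrite !addr_ge0.
have [N N0 NS] : exists2 N : nat, (0 < N)%N & 2 / N%:R * S <= e / 2.
  exists (Num.truncn (4 * S / e)).+1 => //.
  have n0 : 0 < (Num.truncn (4 * S / e)).+1%:R :> R by rewrite ltr0n.
  have := truncnS_gt (4 * S / e); move: (_%:R) n0 => n n0.
  by rewrite ltr_pdivrMr// => h; rewrite mulrAC ler_pdivrMr//; lra.
have Nr : 0 < N%:R :> R by rewrite ltr0n.
pose c (i : nat) : R := 2 * i%:R / N%:R - 1.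
pose mx (x y : R) := Num.max `|x| `|y|.
pose h i j k := c i * A k + c j * B k + (1 - mx (c i) (c j)) * C k.
have cN i : (i <= N)%N -> c (N - i)%N = - c i.
  by move=> iN; rewrite /c natrB//; field; rewrite gt_eqF.
have c0 : c 0%N = -1 by rewrite /c mulr0 mul0r sub0r.
have c1 : c N = 1 by rewrite /c mulfK ?gt_eqF//; ring.
have cb i : (i <= N)%N -> `|c i| <= 1.
  move=> iN; rewrite ler_norml /c; apply/andP; split.
    have h0 : 0 <= 2 * i%:R / N%:R :> R by rewrite divr_ge0 ?mulr_ge0.
    lra.
  by rewrite lerBlDr ler_pdivrMr// -[1 + 1]/2 ler_pM2l// ler_nat.
have cs (a b : bool) i : `|c (a + i)%N - c (b + i)%N| <= 2 / N%:R.
  have -> : c (a + i)%N - c (b + i)%N = (a%:R - b%:R) * (2 / N%:R).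
    by rewrite /c !natrD; field; rewrite gt_eqF.
  have n0 : 0 <= 2 / N%:R :> R by rewrite divr_ge0// ltW.
  rewrite normrM (ger0_norm n0); apply: ler_piMl => //.
  by case: a; case: b; rewrite ?subrr ?sub0r ?subr0 ?normrN ?normr0 ?normr1.
have mxc (x y x' y' d : R) : `|x - x'| <= d -> `|y - y'| <= d -> mx x y - mx x' y' <= d.
  move=> hx hy; rewrite lerBlDr /mx ge_max; apply/andP; split.
    apply: (@le_trans _ _ (d + `|x'|)); last by rewrite lerD2l le_max lexx.
    by rewrite -lerBlDr; exact: le_trans (lerB_dist _ _) hx.
  apply: (@le_trans _ _ (d + `|y'|)); last by rewrite lerD2l le_max lexx orbT.
  by rewrite -lerBlDr; exact: le_trans (lerB_dist _ _) hy.
pose n2 i j := c i ^+ 2 + c j ^+ 2 + (1 - mx (c i) (c j)) ^+ 2.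
have n2g i j : (i <= N)%N -> (j <= N)%N -> 4^-1 <= n2 i j.
  move=> iN jN; have mx2 : mx (c i) (c j) ^+ 2 <= c i ^+ 2 + c j ^+ 2.
    rewrite /mx; have := sqr_ge0 (c i); have := sqr_ge0 (c j).
    by case: (leP `|c i| `|c j|) => _; rewrite real_normK ?num_real// => *; lra.
  by rewrite /n2; move: (mx _ _) mx2 => t ht; have := sqr_ge0 (t - 2^-1); lra.
have rg i j : (i <= N)%N -> (j <= N)%N -> 2^-1 <= Num.sqrt (n2 i j).
  move=> iN jN; rewrite -[leLHS](@ger0_norm _)// -sqrtr_sqr ler_wsqrtr//.
  by apply: le_trans (n2g _ _ iN jN); rewrite exprVn; lra.
have rsc i j : (i <= N)%N -> (j <= N)%N -> exists x y z,
    [/\ x ^+ 2 + y ^+ 2 + z ^+ 2 = 1 & forall k, h i j k = Num.sqrt (n2 i j) * (x * A k + y * B k + z * C k)].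
  move=> iN jN; have r0 : Num.sqrt (n2 i j) != 0 by rewrite gt_eqF//; have := rg _ _ iN jN; lra.
  have rr : Num.sqrt (n2 i j) ^+ 2 = n2 i j by rewrite sqr_sqrtr//; have := n2g _ _ iN jN; lra.
  exists (c i / Num.sqrt (n2 i j)), (c j / Num.sqrt (n2 i j)), ((1 - mx (c i) (c j)) / Num.sqrt (n2 i j)).
  split; last by move=> k; rewrite /h; field.
  have -> (a b d r : R) : (a / r) ^+ 2 + (b / r) ^+ 2 + (d / r) ^+ 2 = (a ^+ 2 + b ^+ 2 + d ^+ 2) / r ^+ 2.
    by rewrite !expr_div_n; ring.
  by rewrite -/(n2 i j) rr divff// -rr expf_neq0.
have [i [j [iN jN alt]]] : exists i j, [/\ (i <= N)%N, (j <= N)%N & alt4 m (e *+ 2) (h i j)].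
  apply: grid_alt4; first exact: ltW.
  - move=> i iN; apply/funext => k; rewrite /h cN// c1 c0 /mx !normrN normr1.
    by rewrite (max_idPr (cb _ iN)); ring.
  - move=> i iN; apply/funext => k; rewrite /h cN// c1 c0 /mx !normrN normr1.
    by rewrite (max_idPl (cb _ iN)); ring.
  - move=> i j a b a' b' k iN jN km; apply: le_trans NS.
    have kS : `|A k| + `|B k| + `|C k| <= S.
      rewrite /S (bigD1 (Ordinal (km : (k < m.+1)%N)))//= lerDl.
      by apply: sumr_ge0 => l _; rewrite !addr_ge0.
    rewrite /h; set x := c (a + i)%N; set y := c (b + j)%N; set x' := c (a' + i)%N; set y' := c (b' + j)%N.
    have hx : `|x - x'| <= 2 / N%:R by exact: cs.
    have hy : `|y - y'| <= 2 / N%:R by exact: cs.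
    have hz : `|mx x' y' - mx x y| <= 2 / N%:R.
      by rewrite ler_norml lerNl opprB !mxc// distrC.
    have -> : x * A k + y * B k + (1 - mx x y) * C k - (x' * A k + y' * B k + (1 - mx x' y') * C k) =
      (x - x') * A k + (y - y') * B k + (mx x' y' - mx x y) * C k by ring.
    apply: (@le_trans _ _ (2 / N%:R * (`|A k| + `|B k| + `|C k|))); last first.
      by rewrite ler_wpM2l// divr_ge0// ltW.
    apply: le_trans (ler_normD _ _) _; rewrite mulrDr lerD//; last by rewrite normrM ler_wpM2r.
    by apply: le_trans (ler_normD _ _) _; rewrite mulrDr lerD// normrM ler_wpM2r.
  - move=> i j iN jN; have [x [y [z [u1 hE]]]] := rsc _ _ iN jN.
    have [i0 [j0 [im jm sp]]] := wide _ _ _ u1; exists i0, j0; split => //.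
    rewrite !hE -ltrBrDl -mulrBr; apply: (@lt_le_trans _ _ (2^-1 * W)).
      by rewrite e4; lra.
    by apply: ler_pM => //; [lra|exact: rg].
have [x [y [z [u1 hE]]]] := rsc _ _ iN jN; exists x, y, z; split => // g.
have [i0 [j0 [im jm sp]]] := wide _ _ _ u1.
have r2 := rg _ _ iN jN; move: (Num.sqrt _) hE r2 => r hE r2.
have {}hE : h i j = fun k => r * g k by apply/funext.
rewrite hE in alt.
have tvE : tv m (fun k => r * g k) = r * tv m g.
  rewrite /tv mulr_sumr; apply: eq_bigr => k _; rewrite -mulrBr normrM ger0_norm//; lra.
have := alt4_tv alt im jm; rewrite -mulrBr => /(_ (r * W)).
rewrite ler_pM2l; last by lra.
move=> /(_ sp); rewrite tvE -mulrnA e4.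
have re : eps / 2 <= r * eps by rewrite [leRHS]mulrC ler_pM2l//; lra.
have r0 : 0 < r by lra.
move=> [h3 h4]; split; first by rewrite -(ler_pM2l r0); lra.
by move=> gm; rewrite -(ler_pM2l r0); have := h4 (congr1 _ gm); lra.
Qed.

End alternating_direction.

(** * Dropping a dimension *)

Section edot_theory.
Variables (R : realType).

Section dim.
Variable n : nat.
Implicit Types u v x y : 'rV[R]_n.

Lemma edotC u v : edot u v = edot v u.
Proof. by apply: eq_bigr => i _; rewrite mulrC. Qed.

Lemma edotDl u v x : edot (u + v) x = edot u x + edot v x.
Proof. by rewrite -big_split; apply: eq_bigr => i _; rewrite mxE mulrDl. Qed.

Lemma edotZl c u x : edot (c *: u) x = c * edot u x.
Proof. by rewrite mulr_sumr; apply: eq_bigr => i _; rewrite mxE mulrA. Qed.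

Lemma edotNl u x : edot (- u) x = - edot u x.
Proof. by rewrite -scaleN1r edotZl mulN1r. Qed.

Lemma edotBl u v x : edot (u - v) x = edot u x - edot v x.
Proof. by rewrite edotDl edotNl. Qed.

Lemma edotDr u v x : edot x (u + v) = edot x u + edot x v.
Proof. by rewrite !(edotC x) edotDl. Qed.

Lemma edotZr c u x : edot x (c *: u) = c * edot x u.
Proof. by rewrite !(edotC x) edotZl. Qed.

Lemma edotNr u x : edot x (- u) = - edot x u.
Proof. by rewrite !(edotC x) edotNl. Qed.

Lemma edotBr u v x : edot x (u - v) = edot x u - edot x v.
Proof. by rewrite !(edotC x) edotBl. Qed.

Lemma edot_ge0 u : 0 <= edot u u.
Proof. by apply: sumr_ge0 => i _; rewrite -expr2 sqr_ge0. Qed.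

Lemma enorm_ge0 u : 0 <= enorm u. Proof. exact: sqrtr_ge0. Qed.

Lemma enorm_sqr u : enorm u ^+ 2 = edot u u.
Proof. by rewrite sqr_sqrtr ?edot_ge0. Qed.

Lemma enormN u : enorm (- u) = enorm u.
Proof. by rewrite /enorm edotNl edotNr opprK. Qed.

Lemma enorm0_eq0 u : enorm u = 0 -> u = 0.
Proof.
move=> /(congr1 (fun t => t ^+ 2)); rewrite enorm_sqr expr0n/= => /eqP.
rewrite psumr_eq0 => [/allP h|i _]; last by rewrite -expr2 sqr_ge0.
apply/rowP => i; rewrite mxE; have := h i (mem_index_enum _).
by rewrite -expr2 sqrf_eq0 => /eqP.
Qed.

Lemma enorm1_sqr u : enorm u = 1 <-> edot u u = 1.
Proof.
by rewrite -enorm_sqr; split=> [->|/eqP]; rewrite ?expr1n// sqrf_eq1 => /orP[/eqP//|/eqP h];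
  have := enorm_ge0 u; rewrite h oppr_ge0 ler10.
Qed.

Lemma edot_delta i x : edot (delta_mx ord0 i) x = x ord0 i.
Proof.
rewrite /edot (bigD1 i)//= big1 => [|j ji]; first by rewrite mxE !eqxx mul1r addr0.
by rewrite mxE (negbTE ji) andbF mul0r.
Qed.

Lemma cauchy_schwarz x y : edot x y <= enorm x * enorm y.
Proof.
have [h|h] := leP (edot x y) 0; first by apply: le_trans h _; rewrite mulr_ge0 ?enorm_ge0.
have [x0|x0] := eqVneq (enorm x) 0.
  by move: h; rewrite (enorm0_eq0 x0) -(scale0r y) edotZl mul0r ltxx.
have X0 : 0 < enorm x by rewrite lt_neqAle eq_sym x0 enorm_ge0.
have := edot_ge0 (enorm x ^+ 2 *: y - edot x y *: x).
rewrite edotBl !edotBr !edotZl !edotZr (edotC y x) -!enorm_sqr => h2.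
rewrite -(ler_pXn2r (n := 2)) ?nnegrE ?mulr_ge0 ?enorm_ge0 ?(ltW h)// exprMn.
have X2 : 0 < enorm x ^+ 2 by rewrite exprn_gt0.
rewrite -(ler_pM2l X2); move: h2; set a := enorm x; set b := edot x y; set c := enorm y => h2.
nra.
Qed.

Lemma enorm_triangle x y : enorm (x + y) <= enorm x + enorm y.
Proof.
rewrite -(ler_pXn2r (n := 2)) ?nnegrE ?addr_ge0 ?enorm_ge0// enorm_sqr edotDl !edotDr (edotC y x).
by rewrite sqrrD !enorm_sqr mulr2n; have := cauchy_schwarz x y; lra.
Qed.

Definition plen m (P : nat -> 'rV[R]_n) := \sum_(i < m) enorm (P i.+1 - P i).

Lemma plen_ge0 m P : 0 <= plen m P.
Proof. by apply: sumr_ge0 => i _; exact: enorm_ge0. Qed.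

Definition every_direction (Phi : (nat -> R) -> Prop) (P : nat -> 'rV[R]_n) :=
  forall u, enorm u = 1 -> Phi (fun i => edot u (P i)).

(** The reflection in the hyperplane orthogonal to [w]; for [w = 0] the convention [0^-1 = 0] makes
    it the identity. *)
Definition mirror (w x : 'rV[R]_n) := x - (2 * edot w x / edot w w) *: w.

Lemma mirrorB w x y : mirror w (x - y) = mirror w x - mirror w y.
Proof.
rewrite /mirror edotBr mulrBr mulrBl scalerBl; set a := _ *: w; set b := _ *: w.
by rewrite opprB opprB -!addrA; congr (_ + _); rewrite addrCA [RHS]addrC addrA.
Qed.

Lemma mirrorZ w c x : mirror w (c *: x) = c *: mirror w x.
Proof. by rewrite /mirror edotZr scalerBr scalerA; congr (_ - _); congr (_ *: _); ring. Qed.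

Lemma edot_mirror w x y : edot (mirror w x) y = edot x (mirror w y).
Proof. by rewrite /mirror edotBl edotBr edotZl edotZr (edotC x w); ring. Qed.

Lemma mirror_isometry w x y : edot (mirror w x) (mirror w y) = edot x y.
Proof.
have [w0|w0] := eqVneq (edot w w) 0.
  by rewrite /mirror w0 invr0 !mulr0 !scale0r !subr0.
by rewrite /mirror edotBl !edotBr !edotZl !edotZr (edotC x w); field.
Qed.

Lemma mirror_swap u v : enorm u = 1 -> enorm v = 1 -> mirror (u - v) v = u.
Proof.
move=> /enorm1_sqr u1 /enorm1_sqr v1.
have [e|ne] := eqVneq (edot (u - v) (u - v)) 0.
  have /enorm0_eq0 /eqP : enorm (u - v) = 0 by rewrite /enorm e sqrtr0.
  by rewrite subr_eq0 => /eqP ->; rewrite /mirror subrr scaler0 subr0.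
rewrite /mirror (_ : _ / _ = -1) ?scaleN1r ?opprK ?[v + _]addrC ?subrK//.
move: ne; rewrite !edotBl !edotBr u1 v1 (edotC v u) => ne.
rewrite -[RHS](@mulfK _ (1 - edot u v - (edot u v - 1)))//; congr (_ / _); ring.
Qed.

End dim.

(** The triangle inequality for the sum of the planar vectors [(a i, b i)]. *)
Lemma sum_sqr_le_sqr_sum m (a b c : nat -> R) :
  (forall i, 0 <= a i) -> (forall i, 0 <= b i) -> (forall i, 0 <= c i) ->
  (forall i, a i ^+ 2 + b i ^+ 2 <= c i ^+ 2) ->
  (\sum_(i < m) a i) ^+ 2 + (\sum_(i < m) b i) ^+ 2 <= (\sum_(i < m) c i) ^+ 2.
Proof.
move=> a0 b0 c0 h; elim: m => [|m IH]; first by rewrite !big_ord0 expr0n addr0.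
rewrite !big_ord_recr/=; move: IH (h m) (a0 m) (b0 m) (c0 m).
have : 0 <= \sum_(i < m) a i by exact: sumr_ge0.
have : 0 <= \sum_(i < m) b i by exact: sumr_ge0.
have : 0 <= \sum_(i < m) c i by exact: sumr_ge0.
move: (\sum_(i < m) a i) (\sum_(i < m) b i) (\sum_(i < m) c i) (a m) (b m) (c m) => A B C x y z C0 B0 A0 H1 H2 x0 y0 z0.
suff : A * x + B * y <= C * z by lra.
rewrite -(ler_pXn2r (n := 2)) ?nnegrE ?mulr_ge0 ?addr_ge0 ?mulr_ge0//.
apply: (@le_trans _ _ ((A ^+ 2 + B ^+ 2) * (x ^+ 2 + y ^+ 2))).
  by rewrite -subr_ge0 (_ : _ - _ = (A * y - B * x) ^+ 2) ?sqr_ge0//; ring.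
by rewrite exprMn; apply: ler_pM => //; rewrite addr_ge0 ?sqr_ge0.
Qed.

(** The direction is sought in the span of the first three coordinate vectors. A reflection takes it
    to the first axis, which is then deleted. A unit vector of the smaller space pulls back to one
    of the larger space with the same profile, so any property of all profiles is inherited. *)
Lemma alternating_drop (n m : nat) (closed : bool) (P : nat -> 'rV[R]_n.+3) W eps :
  0 < eps -> every_direction (has_spread m W) P -> (closed -> P m = P 0%N) ->
  exists (Q : nat -> 'rV[R]_n.+2) (A : R),
  [/\ A ^+ 2 + plen m Q ^+ 2 <= plen m P ^+ 2,
      (if closed then 4 else 3) * (W - eps) <= A, 0 <= A,
      (forall Phi, every_direction Phi P -> every_direction Phi Q) &
      (closed -> Q m = Q 0%N)].
Proof.
move=> eps0 wide clo.
pose e (k : nat) : 'rV[R]_n.+3 := delta_mx ord0 (inord k).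
have edE i j : edot (e i) (e j) = (inord i == inord j :> 'I_n.+3)%:R by rewrite edot_delta mxE eqxx.
have [e00 e11 e22] : [/\ edot (e 0%N) (e 0%N) = 1, edot (e 1%N) (e 1%N) = 1 & edot (e 2%N) (e 2%N) = 1].
  by rewrite !edE !eqxx.
have [e01 e02 e12] : [/\ edot (e 0%N) (e 1%N) = 0, edot (e 0%N) (e 2%N) = 0 & edot (e 1%N) (e 2%N) = 0].
  by rewrite !edE -!val_eqE/= !inordK.
pose dir x y z := x *: e 0%N + y *: e 1%N + z *: e 2%N.
have dirE x y z p : edot (dir x y z) p = x * edot (e 0%N) p + y * edot (e 1%N) p + z * edot (e 2%N) p.
  by rewrite !edotDl !edotZl.
have dir1 x y z : x ^+ 2 + y ^+ 2 + z ^+ 2 = 1 -> enorm (dir x y z) = 1.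
  move=> h; apply/enorm1_sqr; rewrite dirE !(edotC (e _) (dir _ _ _)) !dirE.
  by rewrite e00 e11 e22 (edotC (e 1%N) (e 0%N)) (edotC (e 2%N) (e 0%N)) (edotC (e 2%N) (e 1%N)) e01 e02 e12 -[RHS]h; ring.
have [|x [y [z [u1 hu]]]] := @alternating_direction R m (fun i => edot (e 0%N) (P i)) (fun i => edot (e 1%N) (P i))
    (fun i => edot (e 2%N) (P i)) W eps eps0.
  by move=> x y z /dir1 /wide [i [j [im jm h]]]; exists i, j; split => //; rewrite -!dirE.
set u := dir x y z; have {}u1 : enorm u = 1 by exact: dir1.
have uE i : x * edot (e 0%N) (P i) + y * edot (e 1%N) (P i) + z * edot (e 2%N) (P i) = edot u (P i) by rewrite dirE.
rewrite (_ : (fun i => _) = fun i => edot u (P i)) in hu; last by apply/funext.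
pose f0 : 'rV[R]_n.+3 := delta_mx ord0 ord0.
have f01 : enorm f0 = 1 by apply/enorm1_sqr; rewrite edot_delta mxE !eqxx.
pose H := @mirror n.+3 (u - f0).
have H0 p : H p ord0 ord0 = edot u p by rewrite -edot_delta -/f0 edotC edot_mirror edotC mirror_swap.
pose tail (p : 'rV[R]_n.+3) : 'rV[R]_n.+2 := \row_j p ord0 (lift ord0 j).
pose cns (v : 'rV[R]_n.+2) : 'rV[R]_n.+3 := \row_j (if unlift ord0 j is Some k then v ord0 k else 0).
have tailE v p : edot v (tail p) = edot (cns v) p.
  rewrite /edot [RHS]big_ord_recl !mxE unlift_none mul0r add0r.
  by apply: eq_bigr => i _; rewrite !mxE liftK.
have tail2 p : edot p p = p ord0 ord0 ^+ 2 + edot (tail p) (tail p).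
  by rewrite {1}/edot big_ord_recl -expr2; congr (_ + _); apply: eq_bigr => i _; rewrite !mxE.
have cns1 v : edot (cns v) (cns v) = edot v v.
  rewrite tail2 mxE unlift_none expr0n add0r/=; congr edot; apply/rowP => i; by rewrite !mxE liftK.
exists (fun i => tail (H (P i))), (tv m (fun i => edot u (P i))); split.
- have step i : edot u (P i.+1 - P i) ^+ 2 + enorm (tail (H (P i.+1)) - tail (H (P i))) ^+ 2 <= enorm (P i.+1 - P i) ^+ 2.
    have -> : tail (H (P i.+1)) - tail (H (P i)) = tail (H (P i.+1 - P i)).
      by rewrite /H mirrorB; apply/rowP => j; rewrite !mxE.
    by rewrite !enorm_sqr -H0 -tail2 /H mirror_isometry.
  have := @sum_sqr_le_sqr_sum m (fun i => `|edot u (P i.+1) - edot u (P i)|)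
    (fun i => enorm (tail (H (P i.+1)) - tail (H (P i)))) (fun i => enorm (P i.+1 - P i)).
  apply; rewrite ?enorm_ge0//; try by move=> i; exact: enorm_ge0.
  by move=> i; rewrite -edotBr real_normK ?num_real//; exact: step.
- case: closed clo => clo; last by case: hu.
  by case: hu => _; apply; rewrite clo.
- exact: tv_ge0.
- move=> Phi hP v v1; have := hP (H (cns v)).
  have -> : (fun i => edot (H (cns v)) (P i)) = (fun i => edot v (tail (H (P i)))).
    by apply/funext => i; rewrite tailE -edot_mirror.
  by apply; apply/enorm1_sqr; rewrite mirror_isometry cns1; apply/enorm1_sqr.
- by move=> /clo ->.
Qed.

(** A general property [Phi] is carried down because the inradius bounds need heights in the base
    dimension, while dropping a dimension only uses the spread. *)
Lemma length_step (n m : nat) (closed : bool) W (Phi : (nat -> R) -> Prop) (c : R) :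
  0 <= W ->
  (forall (P : nat -> 'rV[R]_n.+3), every_direction Phi P -> every_direction (has_spread m W) P) ->
  (forall (Q : nat -> 'rV[R]_n.+2), every_direction Phi Q -> (closed -> Q m = Q 0%N) -> c <= plen m Q ^+ 2) ->
  forall (P : nat -> 'rV[R]_n.+3), every_direction Phi P -> (closed -> P m = P 0%N) ->
    c + (if closed then 16 else 9) * W ^+ 2 <= plen m P ^+ 2.
Proof.
move=> W0 spread base P hP clo; pose q : R := if closed then 4 else 3.
have -> : (if closed then 16 else 9) = q ^+ 2 :> R by rewrite /q; case: (closed); ring.
have q0 : 0 < q by rewrite /q; case: (closed).
have q4 : q <= 4 by rewrite /q; case: (closed); lra.
have key eps : 0 < eps -> eps <= W -> c + q ^+ 2 * (W - eps) ^+ 2 <= plen m P ^+ 2.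
  move=> e0 eW; have [Q [A [h1 h2 A0 h3 h4]]] := alternating_drop e0 (spread P hP) clo.
  apply: le_trans h1; rewrite addrC lerD//; last by apply: base => //; exact: h3.
  by rewrite -exprMn ler_pXn2r ?nnegrE ?mulr_ge0 ?subr_ge0// ltW.
move: W0; rewrite le_eqVlt => /predU1P[<-|W0].
  rewrite expr0n mulr0 addr0; have [Q [A [h1 h2 A0 h3 h4]]] := alternating_drop ltr01 (spread P hP) clo.
  by apply: le_trans h1; rewrite -[c]add0r lerD ?sqr_ge0//; apply: base => //; exact: h3.
rewrite leNgt; apply/negP => lt.
set d := c + q ^+ 2 * W ^+ 2 - plen m P ^+ 2; have d0 : 0 < d by rewrite subr_gt0.
(* Small enough for the loss [2 * q ^+ 2 * W * eps] to stay below the supposed deficit [d]. *)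
pose eps := Num.min W (d / (q ^+ 2 * W *+ 4)).
have qW : 0 < q ^+ 2 * W *+ 4 by rewrite pmulrn_lgt0// mulr_gt0// exprn_gt0.
have e0 : 0 < eps by rewrite lt_min W0 divr_gt0.
have eW : eps <= W by rewrite ge_min lexx.
have : eps * (q ^+ 2 * W *+ 4) <= d by rewrite -ler_pdivlMr// ge_min lexx orbT.
have := key _ e0 eW; rewrite -mulr_natr => k1 k2.
have : 0 <= q ^+ 2 * eps ^+ 2 by rewrite mulr_ge0 ?sqr_ge0.
have : 0 < q ^+ 2 * W * eps by rewrite !mulr_gt0.
rewrite /d in k2 d0; lra.
Qed.

End edot_theory.

(** * From curves to polygons *)

Section curves.
Variables (R : realType) (n : nat).
Implicit Types (gamma : R -> 'rV[R]_n) (a b : R).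

Lemma detour_bound (u x p q : 'rV[R]_n) (delta : R) : enorm u = 1 -> 0 <= delta ->
  edot u p + delta <= edot u x -> edot u q + delta <= edot u x ->
  enorm (q - p) ^+ 2 + 4 * delta ^+ 2 <= (enorm (x - p) + enorm (q - x)) ^+ 2.
Proof.
move=> /enorm1_sqr u1 d0 h1 h2.
(* Reflect [q] in the hyperplane through [x] orthogonal to [u]. *)
set B := edot u x - edot u q; pose q' := q + (2 * B) *: u.
have shift y c : edot (y + c *: u) (y + c *: u) = edot y y + c * (2 * edot u y + c).
  by rewrite edotDl !edotDr !edotZl !edotZr (edotC y u) u1; ring.
have E1 : enorm (q' - x) = enorm (q - x).
  by rewrite /enorm /q' addrAC shift (edotBr _ _ u); congr Num.sqrt; rewrite /B; ring.
have E2 : enorm (q' - p) ^+ 2 = enorm (q - p) ^+ 2 + 4 * B * (edot u x - edot u p).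
  by rewrite !enorm_sqr /q' addrAC shift (edotBr _ _ u) /B; ring.
apply: (@le_trans _ _ (enorm (q' - p) ^+ 2)).
  rewrite E2 lerD2l expr2 -mulrA ler_pM2l//; apply: ler_pM => //; rewrite /B; lra.
rewrite ler_pXn2r ?nnegrE ?addr_ge0 ?enorm_ge0// -E1.
have -> : q' - p = (x - p) + (q' - x) by rewrite [RHS]addrC addrA subrK.
exact: enorm_triangle.
Qed.

Lemma polygonal_length_le a b gamma m (t : nat -> R) : rectifiable a b gamma ->
  t 0%N = a -> t m = b -> (forall i, (i < m)%N -> t i <= t i.+1) ->
  plen m (gamma \o t) <= curve_length a b gamma.
Proof. by move=> rec t0 tm tinc; apply: sup_upper_bound; [split=> //; exists (plen m (gamma \o t))|]; exists m, t. Qed.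

Lemma plen_insert gamma m (t : nat -> R) s i : (i < m)%N ->
  plen m.+1 (gamma \o (fun j => if (j <= i)%N then t j else if j == i.+1 then s else t j.-1)) =
  plen m (gamma \o t) - enorm (gamma (t i.+1) - gamma (t i)) +
    (enorm (gamma s - gamma (t i)) + enorm (gamma (t i.+1) - gamma s)).
Proof.
move=> im; set t' := fun j => _; rewrite /plen.
rewrite -(big_mkord xpredT (fun j => enorm ((gamma \o t') j.+1 - (gamma \o t') j))).
rewrite -(big_mkord xpredT (fun j => enorm ((gamma \o t) j.+1 - (gamma \o t) j))).
have i1 : (i <= m.+1)%N by rewrite ltnW// ltnS ltnW.
rewrite (big_cat_nat (n := i))//= [in RHS](big_cat_nat (n := i))//=; last exact: ltnW.
rewrite [\sum_(i <= _ < m.+1) _]big_ltn ?ltnS ?(ltnW im)// [\sum_(i.+1 <= _ < m.+1) _]big_ltn ?ltnS// [\sum_(i <= _ < m) _]big_ltn// [\sum_(i.+2 <= _ < m.+1) _]big_add1/=.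
have t'i : t' i = t i by rewrite /t' leqnn.
have t's : t' i.+1 = s by rewrite /t' ltnn eqxx.
have t'l j : (i < j)%N -> t' j.+1 = t j.
  by move=> ij; rewrite /t' leqNgt (leqW ij)/= eqSS gtn_eqF.
rewrite t'i t's t'l//.
have -> : \sum_(0 <= j < i) enorm (gamma (t' j.+1) - gamma (t' j)) = \sum_(0 <= j < i) enorm (gamma (t j.+1) - gamma (t j)).
  by rewrite !big_mkord; apply: eq_bigr => j _; rewrite /t' ltn_ord (ltnW (ltn_ord j)).
have -> : \sum_(i.+1 <= j < m) enorm (gamma (t' j.+2) - gamma (t' j.+1)) = \sum_(i.+1 <= j < m) enorm (gamma (t j.+1) - gamma (t j)).
  by apply: eq_big_nat => j /andP[ij _]; rewrite !t'l// ltnW.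
by move: (enorm _) (enorm _) (enorm _) (\sum_(_ <= _ < _) _) (\sum_(_ <= _ < _) _) => *; ring.
Qed.

Lemma interval_of (m : nat) (t : nat -> R) s : t 0%N <= s -> s <= t m -> t 0%N < t m ->
  exists2 i, (i < m)%N & t i <= s <= t i.+1.
Proof.
elim: m => [|m IH] h0 hm lt; first by move: lt; rewrite ltxx.
have [ge|lt'] := leP (t m) s; first by exists m => //; rewrite ge.
have [i im h] := IH h0 (ltW lt') (le_lt_trans h0 lt'); by exists i => //; rewrite leqW.
Qed.

(** The vertices come from a partition whose length is within [eps] of the supremum. If a point of
    the curve stood out by more than [delta] beyond all vertices in some direction, inserting it
    would lengthen the polygon by more than [eps]. *)
Lemma inscribed_polygon a b gamma delta : a < b -> rectifiable a b gamma -> 0 < delta ->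
  exists m (P : nat -> 'rV[R]_n),
  [/\ plen m P <= curve_length a b gamma, P 0%N = gamma a, P m = gamma b,
      (forall i, (i <= m)%N -> exists2 s, a <= s <= b & P i = gamma s) &
      forall s u, a <= s <= b -> enorm u = 1 ->
        exists2 j, (j <= m)%N & edot u (gamma s) <= edot u (P j) + delta].
Proof.
move=> ab rec d0; set L := curve_length a b gamma.
have L0 : 0 <= L.
  have := @polygonal_length_le a b gamma 1 (fun i => if i is 0%N then a else b) rec erefl erefl.
  move=> h; apply: le_trans (h _); first exact: plen_ge0.
  by move=> i; rewrite ltnS leqn0 => /eqP ->; exact: ltW.
(* For an edge of length [d <= L] this gives [(d + eps) ^+ 2 < d ^+ 2 + 4 * delta ^+ 2], because
   [2 * d * eps + eps ^+ 2] is at most [2 * (L + 1) * eps]. *)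
pose eps := Num.min 1 (delta ^+ 2 / (L + 1)).
have e0 : 0 < eps by rewrite lt_min ltr01 divr_gt0// ?exprn_gt0//; lra.
have e1 : eps <= 1 by rewrite ge_min lexx.
have eL : eps * (L + 1) <= delta ^+ 2.
  by rewrite -ler_pdivlMr; [rewrite ge_min lexx orbT|lra].
have hs : has_sup (polygonal_lengths a b gamma).
  split => //; exists (plen 1 (gamma \o (fun i : nat => if i is 0%N then a else b))).
  exists 1%N, (fun i : nat => if i is 0%N then a else b); split => //.
  by move=> i; rewrite ltnS leqn0 => /eqP ->; exact: ltW.
have [_ [m [t [t0 tm tinc ->]]] near] := sup_adherent e0 hs.
have pL : plen m (gamma \o t) <= L by exact: polygonal_length_le.
have {}near : L - eps < plen m (gamma \o t) := near.
have mono i j : (i <= j)%N -> (j <= m)%N -> t i <= t j.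
  elim: j => [|j IH]; first by rewrite leqn0 => /eqP ->.
  rewrite leq_eqVlt => /orP[/eqP -> //|]; rewrite ltnS => ij jm.
  by apply: le_trans (IH ij (ltnW jm)) (tinc _ jm).
exists m, (gamma \o t); split => /=; first exact: polygonal_length_le.
- by rewrite t0.
- by rewrite tm.
- by move=> i im; exists (t i) => //; rewrite -t0 -tm !mono.
move=> s u /andP[as_ sb] u1.
have [||| i im /andP[is_ si]] := @interval_of m t s; rewrite ?t0 ?tm//.
apply: contrapT => no.
have far j : (j <= m)%N -> edot u (gamma (t j)) + delta <= edot u (gamma s).
  by move=> jm; rewrite leNgt; apply/negP => lt; apply: no; exists j => //; exact: ltW.
have := detour_bound u1 (ltW d0) (far i (ltnW im)) (far i.+1 im).
have := plen_insert gamma t s im; set t' := fun j => _ => pE.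
have : plen m.+1 (gamma \o t') <= L.
  apply: polygonal_length_le => //; rewrite /t'.
  - by rewrite ltnNge (ltnW im)/= eqSS gtn_eqF.
  - move=> j; rewrite ltnS => jm.
    have [ji|ij|->] := ltngtP j i; rewrite ?ltnn ?eqxx//.
    + by apply: tinc; exact: ltn_trans ji im.
    + rewrite eqSS (gtn_eqF ij).
      have [->|ne] := eqVneq j i.+1 => //=.
      by have := tinc j.-1; rewrite (ltn_predK ij); apply.
rewrite pE => {pE}; have := plen_ge0 m (gamma \o t).
have : enorm (gamma (t i.+1) - gamma (t i)) <= plen m (gamma \o t).
  rewrite /plen (bigD1 (Ordinal im))//= lerDl; apply: sumr_ge0 => j _; exact: enorm_ge0.
have := enorm_ge0 (gamma (t i.+1) - gamma (t i)).
have := enorm_ge0 (gamma s - gamma (t i)); have := enorm_ge0 (gamma (t i.+1) - gamma s).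
move: (enorm (gamma (t i.+1) - gamma (t i))) (enorm (gamma s - gamma (t i))) (enorm (gamma (t i.+1) - gamma s)) near pL.
move: (plen m _) => p d x y near pL x0 y0 dd0 dp p0 h1 h2.
have xy : x + y < d + eps by lra.
have : (x + y) ^+ 2 < (d + eps) ^+ 2 by rewrite ltrXn2r//; lra.
have dL : d <= L by lra.
have : d * eps <= L * eps by rewrite ler_wpM2r// ltW.
have : eps ^+ 2 <= eps by rewrite expr2 ler_piMr// ltW.
have : 0 < delta ^+ 2 by rewrite exprn_gt0.
move: h2 eL; move: (delta ^+ 2) => D; lra.
Qed.

Definition has_height (m : nat) (r : R) (h : nat -> R) := exists2 i, (i <= m)%N & r <= h i.

Lemma width_polygon a b gamma W : a < b -> rectifiable a b gamma -> W < curve_width a b gamma ->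
  exists m (P : nat -> 'rV[R]_n), [/\ plen m P <= curve_length a b gamma,
    (gamma a = gamma b -> P m = P 0%N) & every_direction (has_spread m W) P].
Proof.
move=> ab rec Ww; pose delta := (curve_width a b gamma - W) / 2.
have d0 : 0 < delta by rewrite /delta; lra.
have [m [P [PL P0 Pm Pg near]]] := inscribed_polygon ab rec d0.
exists m, P; split => //; first by rewrite P0 Pm.
move=> u u1; have [i Mi] := near_max_ex m (fun i => edot u (P i)).
have [j mj] := near_max_ex m (fun i => - edot u (P i)).
case: Mi => im hi; case: mj => jm hj.
exists i, j; split => //.
suff : curve_width a b gamma <= (edot u (P i) + delta) - (edot u (P j) - delta) by rewrite /delta; lra.
apply: ge_inf.
  exists 0 => _ [v [al [be [v1 hv ->]]]].
  have := hv a; rewrite lexx ltW//= => /(_ isT) /andP[h1 h2]; lra.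
exists u, (edot u (P j) - delta), (edot u (P i) + delta); split => // s sab.
have [k km hk] := near s u sab u1; have [|l lm hl] := near s (- u) sab; first by rewrite enormN.
by have := hi k km; have := hj l lm; rewrite !edotNl in hl *; move=> *; apply/andP; split; lra.
Qed.

(** The point [c + rho *: u] of the sphere is a convex combination of points of the curve, so one of
    them is at least as high in the direction [u]. *)
Lemma inradius_polygon a b gamma rho r : a < b -> rectifiable a b gamma ->
  inradii a b gamma rho -> r < rho ->
  exists m (P : nat -> 'rV[R]_n), [/\ plen m P <= curve_length a b gamma,
    (gamma a = gamma b -> P m = P 0%N) & every_direction (has_height m r) P].
Proof.
move=> ab rec [rho0 [c [sub _]]] rr; have d0 : 0 < rho - r by lra.
have [m [P [PL P0 Pm Pg near]]] := inscribed_polygon ab rec d0.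
exists m, (fun i => P i - c); split.
- by rewrite /plen in PL *; under eq_bigr => i _ do rewrite opprB addrA subrK.
- by rewrite P0 Pm => ->.
move=> u u1.
have [|k [t [l [ht l0 l1 E]]]] := sub (c + rho *: u).
  rewrite /esphere/= addrC addKr /enorm edotZl edotZr (_ : edot u u = 1); last exact/enorm1_sqr.
  by rewrite mulr1 -expr2 sqrtr_sqr ger0_norm.
have [i hi] : exists i, edot u c + rho <= edot u (gamma (t i)).
  apply: contrapT => no.
  have lt i : edot u (gamma (t i)) < edot u c + rho.
    by rewrite ltNge; apply/negP => h; apply: no; exists i.
  have E2 : edot u c + rho = \sum_(i < k) l i * edot u (gamma (t i)).
    have : edot u (c + rho *: u) = edot u c + rho.
      by rewrite edotDr edotZr (_ : edot u u = 1) ?mulr1//; exact/enorm1_sqr.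
    move=> <-; rewrite E /edot; under [RHS]eq_bigr do rewrite mulr_sumr.
    rewrite exchange_big; apply: eq_bigr => j _; rewrite summxE mulr_sumr.
    by apply: eq_bigr => i _; rewrite mxE; ring.
  have z : \sum_(i < k) l i * (edot u c + rho - edot u (gamma (t i))) = 0.
    by under eq_bigr => i _ do rewrite mulrBr; rewrite sumrB -mulr_suml l1 mul1r -E2 subrr.
  have pos i : 0 <= edot u c + rho - edot u (gamma (t i)) by rewrite subr_ge0 ltW.
  have l0' i : l i = 0.
    have /eqP := @psumr_eq0P _ _ predT _ (fun i _ => mulr_ge0 (l0 i) (pos i)) z i isT.
    by rewrite mulf_eq0 subr_eq0 [_ == edot _ _]gt_eqF// orbF => /eqP.
  by move: l1; rewrite big1 => [/eqP|i _]; rewrite ?l0'// eq_sym oner_eq0.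
have [j jm hj] := near (t i) u (ht i) u1.
by exists j => //; rewrite edotBr; lra.
Qed.

End curves.

Section closed_space.
Variable R : realType.
Local Notation V3 := ((R * R) * R)%type.

(** The covering conditions are strict at radius 1: the polygon is enlarged by a factor [c > 1 / r],
    which is then brought close enough to [1 / r]. *)
Lemma scale_limit (K r L : R) : 0 < K -> 0 <= r -> 0 <= L ->
  (forall c, 0 < c -> 1 < c * r -> K <= c * L) -> K * r <= L.
Proof.
move=> K0; rewrite le_eqVlt => /predU1P[<- L0 _|r0 L0 key]; first by rewrite mulr0.
rewrite leNgt; apply/negP => lt.
have ri : 0 < r^-1 by rewrite invr_gt0.
have [Lz|Lp] := eqVneq L 0.
  have c0 : 0 < 2 / r by rewrite divr_gt0.
  have := key (2 / r) c0; rewrite Lz mulr0 divfK ?gt_eqF// ltr1n => /(_ isT).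
  by move=> /(lt_le_trans K0); rewrite ltxx.
have Lp' : 0 < L by rewrite lt_neqAle eq_sym Lp.
pose c := 2^-1 * (r^-1 + K / L).
have h1 : r^-1 < K / L by rewrite ltr_pdivlMr// mulrC ltr_pdivrMr.
have h2 : 1 < c * r by rewrite -ltr_pdivrMr// mul1r /c; lra.
have c0 : 0 < c by rewrite /c; lra.
have := key c c0 h2; rewrite -ler_pdivrMr// /c; lra.
Qed.

Lemma psum_map (T : eqType) (f : T -> T -> R) (P : nat -> T) m k :
  psum f (P k) [seq P i.+1 | i <- iota k m] = \sum_(k <= i < k + m) f (P i) (P i.+1).
Proof.
elim: m k => [|m IH] k; first by rewrite addn0 big_geq.
by rewrite /= IH addSnnS [RHS]big_ltn// -addSnnS leq_addr.
Qed.

Lemma closed_inradius_space (m : nat) (P : nat -> 'rV[R]_3) r :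
  0 <= r -> every_direction (has_height m r) P -> P m = P 0%N ->
  6 * Num.sqrt 3 * r <= plen m P.
Proof.
move=> r0 hP clo; have L0 := plen_ge0 m P.
pose to3 (c : R) (x : 'rV[R]_3) : V3 := ((c * x 0 0, c * x 0 1), c * x 0 (inord 2)).
have o2 : (inord 2 : 'I_3) = lift ord0 (lift ord0 ord0) by apply/val_inj; rewrite /= inordK.
have o1 : (1 : 'I_3) = lift ord0 ord0 by apply/val_inj.
have edot3 (x y : 'rV[R]_3) : edot x y = x 0 0 * y 0 0 + x 0 1 * y 0 1 + x 0 (inord 2) * y 0 (inord 2).
  rewrite /edot !big_ord_recl big_ord0 addr0 addrA o1 o2.
  by congr (_ + _ + _ * _); congr fun_of_matrix.
have key c : 0 < c -> 1 < c * r -> 6 * Num.sqrt 3 <= c * plen m P.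
  move=> c0 cr; pose Q i := to3 c (P i).
  have dE i j : dist3 (Q i) (Q j) = c * enorm (P j - P i).
    rewrite -[c in RHS](ger0_norm (ltW c0)) -sqrtr_sqr -sqrtrM ?sqr_ge0// /dist3 edot3; congr Num.sqrt.
    by rewrite /dot3/= !mxE; ring.
  case: m hP clo L0 dE => [|k] hP clo L0 dE.
    (* A single vertex cannot have positive height in two opposite directions. *)
    have [|j] := hP (delta_mx ord0 ord0); first by apply/enorm1_sqr; rewrite edot_delta mxE !eqxx.
    have [|j'] := hP (- delta_mx ord0 ord0); first by rewrite enormN; apply/enorm1_sqr; rewrite edot_delta mxE !eqxx.
    rewrite !leqn0 => /eqP -> h1 /eqP -> h2; rewrite edotNl in h1.
    have : 0 < r by rewrite -(pmulr_rgt0 _ c0); lra.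
    lra.
  (* The closed list omits the last vertex, which repeats the first. *)
  have : covers [seq Q i | i <- iota 0 k.+1].
    move=> X X0; pose x : 'rV[R]_3 := \row_(j < 3) (if j == 0 then X.1.1 else if j == 1 then X.1.2 else X.2).
    have [x0 x1 x2] : [/\ x 0 0 = X.1.1, x 0 1 = X.1.2 & x 0 (inord 2) = X.2].
      by rewrite !mxE !eqxx o2.
    have xE i : dot3 X (Q i) = c * edot x (P i) by rewrite edot3 x0 x1 x2 /dot3/=; ring.
    have XX : dot3 X X = edot x x by rewrite edot3 x0 x1 x2.
    have xn : 0 < enorm x.
      rewrite lt_neqAle enorm_ge0 andbT eq_sym; apply: contra X0 => /eqP/enorm0_eq0 xz.
      have -> : X = ((x 0 0, x 0 1), x 0 (inord 2)) by rewrite x0 x1 x2 -!surjective_pairing.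
      by rewrite xz !mxE.
    have [|i im hi] := hP ((enorm x)^-1 *: x).
      by apply/enorm1_sqr; rewrite edotZl edotZr -enorm_sqr; field; rewrite gt_eqF.
    rewrite edotZl ler_pdivlMl// in hi.
    have good l : r * enorm x <= edot x (P l) -> (0 < dot3 X (Q l)) && (dot3 X X < dot3 X (Q l) ^+ 2).
      move=> hl; have : enorm x < dot3 X (Q l).
        rewrite xE; apply: lt_le_trans (_ : c * (r * enorm x) <= _); last by rewrite ler_pM2l.
        by rewrite mulrA ltr_pMl.
      move=> lt; rewrite (lt_trans xn lt)/= XX -enorm_sqr ltrXn2r//; exact: enorm_ge0.
    rewrite mulrC in hi; move: im; rewrite leq_eqVlt => /orP[/eqP ik|ik].
      by exists (Q 0%N); [exact: mem_head|apply: good; rewrite -clo -ik].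
    by exists (Q i); [apply/map_f; rewrite mem_iota|exact: good].
  move=> /closed_length_cover /le_trans; apply.
  have -> : csum (@dist3 R) [seq Q i | i <- iota 0 k.+1] = psum (@dist3 R) (Q 0%N) [seq Q i.+1 | i <- iota 0 k.+1].
    have sE : [seq Q i.+1 | i <- iota 0 k.+1] = rcons [seq Q i | i <- iota 1 k] (Q 0%N).
      have -> : Q 0%N = Q k.+1 by rewrite /Q clo.
      by rewrite -{1}addn1 iotaD map_cat cats1 (iotaDl 1 0) -map_comp.
    by rewrite sE.
  rewrite psum_map add0n big_mkord /plen mulr_sumr le_eqVlt; apply/orP; left; apply/eqP.
  by apply: eq_bigr => i _; rewrite dE.
by apply: scale_limit key => //; rewrite mulr_gt0// sqrtr_gt0.
Qed.

End closed_space.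

(** * Planar width *)

Section planar_width.
Variable R : realType.

Lemma sin_mono (x y : R) : - (pi / 2) <= x -> x <= y -> y <= pi / 2 -> sin x <= sin y.
Proof.
move=> x0 xy yp; have [->//|ne] := eqVneq x y.
by rewrite ltW// ltr_sin ?in_itv/= ?x0 ?(le_trans xy)// ?(le_trans x0)// lt_neqAle ne.
Qed.

Lemma cos_anti (x y : R) : 0 <= x -> x <= y -> y <= pi / 2 -> cos y <= cos x.
Proof.
move=> x0 xy yp; have pi0 := pi_gt0 R; apply: cos_le_far => //.
by rewrite xy/= [pi *+ 2]mulr2n; lra.
Qed.

Lemma sin_cos_proj_le (x y t : R) : x * sin t + y * cos t <= Num.sqrt (x ^+ 2 + y ^+ 2).
Proof.
have [h|h] := leP (x * sin t + y * cos t) 0; first exact: le_trans (sqrtr_ge0 _).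
rewrite -(ger0_norm (ltW h)) -sqrtr_sqr ler_wsqrtr// -subr_ge0.
have -> : x ^+ 2 + y ^+ 2 - (x * sin t + y * cos t) ^+ 2 =
  (x ^+ 2 + y ^+ 2) * (1 - (cos t ^+ 2 + sin t ^+ 2)) + (x * cos t - y * sin t) ^+ 2 by ring.
by rewrite cos2Dsin2 subrr mulr0 add0r sqr_ge0.
Qed.

Section edge_sum.
Variables (a tau x y : R) (n : nat).
Hypotheses (x0 : 0 <= x) (y0 : 0 <= y) (a0 : 0 <= a) (tau0 : 0 <= tau)
  (htau : a + n%:R * (2 * tau) <= pi / 2).

Definition node k := a + k%:R * (2 * tau).
Definition mid k := node k + tau.

Lemma node0 : node 0 = a. Proof. by rewrite /node mul0r addr0. Qed.
Lemma nodeS k : node k.+1 = mid k + tau.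
Proof. by rewrite /node /mid -natr1 /node; ring. Qed.
Lemma nodeE k : node k = mid k - tau. Proof. by rewrite /mid addrK. Qed.
Lemma node_le k : (k <= n)%N -> 0 <= node k <= pi / 2.
Proof.
move=> kn; apply/andP; split; first by rewrite addr_ge0 ?mulr_ge0.
by apply: le_trans htau; rewrite lerD2l ler_wpM2r ?mulr_ge0// ler_nat.
Qed.
Lemma mid_le k : (k < n)%N -> 0 <= mid k <= pi / 2.
Proof.
move=> kn; have /andP[h1 h2] := node_le (ltnW kn); have /andP[h3 h4] := node_le kn.
by rewrite nodeS in h3 h4; rewrite nodeE in h1 h2; apply/andP; split; lra.
Qed.

Lemma sin_step k : 2 * sin tau * cos (mid k) = sin (node k.+1) - sin (node k).
Proof. by rewrite nodeS nodeE sinB sinD; ring. Qed.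
Lemma cos_step k : 2 * sin tau * sin (mid k) = cos (node k) - cos (node k.+1).
Proof. by rewrite nodeS nodeE cosB cosD; ring. Qed.

Lemma sin_tau_ge0 : (0 < n)%N -> 0 <= sin tau.
Proof.
move=> n0; have /andP[_ h] := mid_le n0; have pi0 := pi_gt0 R.
move: h; rewrite /mid node0 => h; apply: sin_ge0_pi; have t0 := tau0; have a0' := a0; rewrite t0; lra.
Qed.

(** A discrete integral of the maximum of [x * cos t] and [y * sin t]; midpoints with weight
    [2 * sin tau] integrate sine and cosine exactly. The maximum switches only once, from the first
    term to the second, so the sum telescopes to [x * sin t + y * cos t] at the switching node [t],
    a projection of [(x, y)]. *)
Lemma edge_sum : x * sin a + (\sum_(k < n) 2 * sin tau * Num.max (x * cos (mid k)) (y * sin (mid k)))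
  + y * cos (node n) <= Num.sqrt (x ^+ 2 + y ^+ 2).
Proof.
pose S k := x * sin a + \sum_(i < k) 2 * sin tau * Num.max (x * cos (mid i)) (y * sin (mid i)).
suff : S n = x * sin (node n) \/ S n + y * cos (node n) <= Num.sqrt (x ^+ 2 + y ^+ 2).
  by case=> //; rewrite -/(S n) => ->; exact: sin_cos_proj_le.
have key k : (k <= n)%N -> S k = x * sin (node k) \/
   (S k + y * cos (node k) <= Num.sqrt (x ^+ 2 + y ^+ 2) /\
    forall j, (k <= j)%N -> (j < n)%N -> x * cos (mid j) <= y * sin (mid j)).
  elim: k => [|k IH] kn; first by left; rewrite /S big_ord0 addr0 node0.
  have SE : S k.+1 = S k + 2 * sin tau * Num.max (x * cos (mid k)) (y * sin (mid k)).
    by rewrite /S big_ord_recr/= addrA.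
  have switch j : (k <= j)%N -> (j < n)%N -> x * cos (mid k) <= y * sin (mid k) -> x * cos (mid j) <= y * sin (mid j).
    move=> kj jn h; have mm : mid k <= mid j.
      by rewrite lerD2r lerD2l ler_wpM2r ?mulr_ge0// ler_nat.
    have /andP[m1 m2] := mid_le jn; have /andP[m3 m4] := mid_le kn; have pi0 := pi_gt0 R.
    apply: (@le_trans _ _ (x * cos (mid k))); first by rewrite ler_wpM2l// cos_anti.
    by apply: le_trans h _; rewrite ler_wpM2l// sin_mono//; lra.
  have [E|[E mono]] := IH (ltnW kn).
    have [le|lt] := leP (x * cos (mid k)) (y * sin (mid k)).
      right; split; last by move=> j kj jn; apply: switch => //; exact: ltnW.
      rewrite SE (max_idPr le) E mulrCA cos_step.
      have := sin_cos_proj_le x y (node k); lra.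
    by left; rewrite SE (max_idPl (ltW lt)) E mulrCA sin_step; ring.
  right; split; last by move=> j kj jn; apply: mono => //; exact: ltnW.
  rewrite SE (max_idPr (mono k (leqnn _) kn)) mulrCA cos_step; lra.
by have [->|[h _]] := key n (leqnn _); [left|right].
Qed.

Lemma cos_mid_sum : \sum_(k < n) 2 * sin tau * cos (mid k) = sin (node n) - sin a.
Proof.
rewrite -node0; elim: n => [|k IH]; first by rewrite big_ord0 subrr.
by rewrite big_ord_recr/= IH sin_step; ring.
Qed.

End edge_sum.

(** The walk from the start to one extreme, to the other and on to the end, closed up by the chord,
    covers the spread twice. *)
Lemma tv_spread m W (h : nat -> R) : has_spread m W h -> 2 * W - `|h m - h 0%N| <= tv m h.
Proof.
move=> [i [j [im jm hij]]].
have gen i' j' : (i' <= j')%N -> (j' <= m)%N -> W <= `|h j' - h i'| -> 2 * W - `|h m - h 0%N| <= tv m h.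
  move=> ij jm' hh; have := tv_split h ij (leqnn j') (leqnn j') jm'.
  rewrite subrr normr0 => hs.
  have : `|h j' - h i'| <= `|h m - h 0%N| + `|h i' - h 0%N| + `|h m - h j'|.
    have -> : h j' - h i' = (h m - h 0%N) - (h i' - h 0%N) - (h m - h j') by ring.
    by apply: le_trans (ler_normB _ _) _; rewrite lerD2r; exact: ler_normB.
  lra.
have [le|le] := leqP i j.
  by apply: (gen i j) => //; rewrite distrC; apply: le_trans hij (ler_norm _).
by apply: (gen j i) => //; [exact: ltnW|apply: le_trans hij (ler_norm _)].
Qed.

Lemma max_norm (p q : R) : Num.max `|p| `|q| = 2^-1 * (`|p + q| + `|p - q|).
Proof.
have dom (r s : R) : `|r| <= `|s| -> `|s| = 2^-1 * (`|r + s| + `|r - s|).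
  have [s0|s0] := leP 0 s; rewrite ?(ger0_norm s0) ?(ltr0_norm s0) ler_norml => /andP[h1 h2].
    rewrite (@ger0_norm _ (r + s)) ?(@ler0_norm _ (r - s)); lra.
  rewrite (@ler0_norm _ (r + s)) ?(@ger0_norm _ (r - s)); lra.
have [le|lt] := leP `|p| `|q|; first exact: dom.
by rewrite (dom q p (ltW lt)) (addrC q) (distrC q).
Qed.

Lemma edot2 (u v : 'rV[R]_2) : edot u v = u 0 0 * v 0 0 + u 0 1 * v 0 1.
Proof.
rewrite /edot !big_ord_recl big_ord0 addr0.
by have -> : (1 : 'I_2) = lift ord0 ord0 by apply/val_inj.
Qed.

Definition vec2 (x y : R) : 'rV[R]_2 := \row_j (if j == 0 then x else y).

Lemma edot_vec2 x y v : edot (vec2 x y) v = x * v 0 0 + y * v 0 1.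
Proof. by rewrite edot2 !mxE. Qed.

Lemma enorm_vec2 x y : x ^+ 2 + y ^+ 2 = 1 -> enorm (vec2 x y) = 1.
Proof. by move=> h; apply/enorm1_sqr; rewrite edot_vec2 !mxE/= -!expr2. Qed.

(** With the first axis along the chord, the horizontal variation is at least [d] and the vertical
    one at least [2 * W]. By [max_norm] each maximum in [edge_sum] is the mean of the projections on
    two directions symmetric about the axis, and in both the variation is at least
    [2 * W - d * cos t]. *)
Lemma planar_width_sum (m n : nat) (P : nat -> 'rV[R]_2) (W d a tau : R) :
  every_direction (has_spread m W) P ->
  P m 0 0 - P 0%N 0 0 = d -> P m 0 1 - P 0%N 0 1 = 0 -> 0 <= d ->
  0 <= a -> 0 <= tau -> (0 < n)%N -> a + n%:R * (2 * tau) <= pi / 2 ->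
  d * (2 * sin a - sin (a + n%:R * (2 * tau))) + 4 * n%:R * sin tau * W +
    2 * W * cos (a + n%:R * (2 * tau)) <= plen m P.
Proof.
move=> wide sx sy d0 a0 tau0 n0 htau; set b := a + _; have pi0 := pi_gt0 R.
pose x i := `|P i.+1 0 0 - P i 0 0|; pose y i := `|P i.+1 0 1 - P i 0 1|.
have b0 : 0 <= b by rewrite addr_ge0 ?mulr_ge0.
have bE : node a tau n = b by [].
have eE i : enorm (P i.+1 - P i) = Num.sqrt (x i ^+ 2 + y i ^+ 2).
  by rewrite /enorm edot2 !mxE -!expr2 /x /y !real_normK ?num_real.
have len : \sum_(i < m) (x i * sin a + (\sum_(k < n) 2 * sin tau * Num.max (x i * cos (mid a tau k)) (y i * sin (mid a tau k)))
  + y i * cos b) <= plen m P.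
  apply: ler_sum => i _; rewrite eE; by apply: edge_sum; rewrite ?normr_ge0.
apply: le_trans len.
rewrite !big_split/= -!mulr_suml exchange_big/=.
have Sx : d <= \sum_(i < m) x i.
  have := @var_between_ge R (fun i => P i 0 0) 0 m (leq0n _); rewrite sx big_mkord => h.
  exact: le_trans (ler_norm _) h.
have Sy : 2 * W <= \sum_(i < m) y i.
  have [|i [j [im jm h]]] := wide (vec2 0 1); first by rewrite enorm_vec2// expr0n expr1n add0r.
  have := @tv_spread m W (fun i => P i 0 1); rewrite sy normr0 subr0; apply.
  by exists i, j; split => //; move: h; rewrite !edot_vec2 !mul0r !add0r !mul1r.
have F k : (k < n)%N -> 2 * W - d * cos (mid a tau k) <= \sum_(i < m) Num.max (x i * cos (mid a tau k)) (y i * sin (mid a tau k)).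
  move=> kn; have /andP[m1 m2] := mid_le a0 tau0 htau kn.
  move: (mid a tau k) m1 m2 => t t1 t2.
  have c0 : 0 <= cos t by apply: cos_ge0_pihalf; apply/andP; split; lra.
  have s0 : 0 <= sin t by apply: sin_ge0_pi; apply/andP; split; lra.
  have dir s : s ^+ 2 = sin t ^+ 2 ->
      2 * W - d * cos t <= \sum_(i < m) `|cos t * (P i.+1 0 0 - P i 0 0) + s * (P i.+1 0 1 - P i 0 1)|.
    move=> ss; have := @tv_spread m W _ (wide (vec2 (cos t) s) _).
    rewrite !edot_vec2 enorm_vec2 ?ss ?cos2Dsin2// => /(_ erefl).
    have -> : cos t * P m 0 0 + s * P m 0 1 - (cos t * P 0%N 0 0 + s * P 0%N 0 1) = d * cos t.
      rewrite [LHS](_ : _ = cos t * (P m 0 0 - P 0%N 0 0) + s * (P m 0 1 - P 0%N 0 1)); last by ring.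
      by rewrite sx sy mulr0 addr0 mulrC.
    rewrite ger0_norm ?mulr_ge0// => /le_trans; apply.
    rewrite /tv le_eqVlt; apply/orP; left; apply/eqP; apply: eq_bigr => i _; congr `|_|.
    by rewrite !edot_vec2; ring.
  have := dir (sin t) erefl; have := dir (- sin t) (sqrrN _) => h1 h2.
  have -> : \sum_(i < m) Num.max (x i * cos t) (y i * sin t) =
     2^-1 * (\sum_(i < m) `|cos t * (P i.+1 0 0 - P i 0 0) + sin t * (P i.+1 0 1 - P i 0 1)| +
     \sum_(i < m) `|cos t * (P i.+1 0 0 - P i 0 0) + - sin t * (P i.+1 0 1 - P i 0 1)|).
    rewrite -big_split mulr_sumr; apply: eq_bigr => i _.
    rewrite -{1}(ger0_norm c0) -{1}(ger0_norm s0) /x /y -!normrM [_ * cos t]mulrC [_ * sin t]mulrC mulNr.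
    move: (cos t * _) (sin t * _) => p q.
    exact: max_norm.
  lra.
have sb0 : 0 <= sin tau by exact: sin_tau_ge0 htau n0.
have mono : \sum_(k < n) 2 * sin tau * (2 * W - d * cos (mid a tau k)) <=
   \sum_(k < n) \sum_(i < m) 2 * sin tau * Num.max (x i * cos (mid a tau k)) (y i * sin (mid a tau k)).
  by apply: ler_sum => k _; rewrite -mulr_sumr ler_wpM2l ?mulr_ge0// F.
have : \sum_(k < n) 2 * sin tau * (2 * W - d * cos (mid a tau k)) = 4 * n%:R * sin tau * W - d * (sin b - sin a).
  rewrite (eq_bigr (fun k : 'I_n => 2 * sin tau * (2 * W) - d * (2 * sin tau * cos (mid a tau k)))); last first.
    by move=> k _; ring.
  rewrite sumrB sumr_const card_ord -mulr_sumr cos_mid_sum bE -mulr_natr; ring.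
move=> E; rewrite E in mono.
have ab : a <= b by rewrite lerDl !mulr_ge0.
have bp : b <= pi / 2 := htau.
have sa0 : 0 <= sin a by apply: sin_ge0_pi; rewrite a0; lra.
have cb0 : 0 <= cos b by apply: cos_ge0_pihalf; apply/andP; split => //; lra.
have l1 : d * sin a <= (\sum_(i < m) x i) * sin a by rewrite ler_wpM2r.
have l2 : 2 * W * cos b <= (\sum_(i < m) y i) * cos b by rewrite ler_wpM2r.
apply: le_trans (lerD (lerD l1 mono) l2).
rewrite le_eqVlt; apply/orP; left; apply/eqP; ring.
Qed.

(* The angles a and b nearly maximize 2 (b - a) + 2 cos b subject to 2 sin a >= sin b. *)
Lemma width_constants (a b t : R) : a = 9 / 31 -> b = 64 / 105 -> t = (b - a) / 32 ->
  0 <= 2 * sin a - sin b /\ 11391%:R / 5000%:R <= 64 * sin t + 2 * cos b.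
Proof.
move=> aE bE tE.
have a0 : 0 <= a by rewrite aE; lra.
have b0 : 0 <= b by rewrite bE; lra.
have t0 : 0 <= t by rewrite tE aE bE; lra.
have sa := sin_ge3T a0; have sb := sin_le5T b0.
have st := sin_ge3T t0; have cb := cos_ge6T b0.
have p1 : b - 6^-1 * b ^+ 3 + 120^-1 * b ^+ 5 <= 2 * (a - 6^-1 * a ^+ 3) by rewrite aE bE; lra.
have p2 : 11391%:R / 5000%:R <= 64 * (t - 6^-1 * t ^+ 3) + 2 * (1 - 2^-1 * b ^+ 2 + 24^-1 * b ^+ 4 - 720^-1 * b ^+ 6).
  by rewrite tE aE bE; lra.
move: p1 p2 sa sb st cb; clear.
move: (b - 6^-1 * b ^+ 3 + _) (a - _) (t - _) (1 - _ + _ - _) => A B C D p1 p2 sa sb st cb; split; first lra.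
by apply: (le_trans p2); lra.
Qed.

Lemma planar_width_open (m : nat) (P : nat -> 'rV[R]_2) (W : R) : 0 <= W ->
  every_direction (has_spread m W) P -> 11391%:R / 5000%:R * W <= plen m P.
Proof.
move=> W0 wide; have pi3 := pi_gt_3_13 R.
(* A reflection lays the chord along the first axis. *)
have [H [Hlen Hwide]] : exists H : 'rV[R]_2 -> 'rV[R]_2,
   [/\ plen m (H \o P) = plen m P, every_direction (has_spread m W) (H \o P) &
       0 <= (H (P m) - H (P 0%N)) 0 0 /\ (H (P m) - H (P 0%N)) 0 1 = 0].
  set s := P m - P 0%N.
  have [s0|s0] := eqVneq (enorm s) 0.
    exists id; split => //; rewrite -/s (enorm0_eq0 s0) !mxE; by [].
  have sp : 0 < enorm s by rewrite lt_neqAle eq_sym s0 enorm_ge0.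
  pose u := (enorm s)^-1 *: s; pose f : 'rV[R]_2 := vec2 1 0.
  have u1 : enorm u = 1 by apply/enorm1_sqr; rewrite edotZl edotZr -enorm_sqr; field.
  have f1 : enorm f = 1 by rewrite enorm_vec2// expr1n expr0n addr0.
  exists (mirror (f - u)); split.
  - by apply: eq_bigr => i _ /=; rewrite -mirrorB /enorm mirror_isometry.
  - move=> v v1 /=; have -> : (fun i => edot v (mirror (f - u) (P i))) = (fun i => edot (mirror (f - u) v) (P i)).
      by apply/funext => i; rewrite edot_mirror.
    by apply: wide; apply/enorm1_sqr; rewrite mirror_isometry; apply/enorm1_sqr.
  - rewrite -mirrorB -/s (_ : s = enorm s *: u); last by rewrite scalerA divff// scale1r.
    have -> : mirror (f - u) (enorm s *: u) = enorm s *: f.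
      by rewrite mirrorZ mirror_swap.
    by rewrite !mxE/= mulr1 mulr0 enorm_ge0.
rewrite !mxE => -[d0 sy]; rewrite -Hlen.
set d := _ - _ in d0.
have [a aE] : exists a : R, a = 9 / 31 by exists (9 / 31).
have [b bE] : exists b : R, b = 64 / 105 by exists (64 / 105).
have [t tE] : exists t : R, t = (b - a) / 32 by exists ((b - a) / 32).
have [h1 h2] := width_constants aE bE tE.
have a0 : 0 <= a by rewrite aE; lra.
have t0 : 0 <= t by rewrite tE aE bE; lra.
have btE : a + 16%:R * (2 * t) = b by rewrite tE; field.
have bp : b <= pi / 2 by rewrite bE; lra.
have := @planar_width_sum m 16 (H \o P) W d a t Hwide erefl sy d0 a0 t0 isT.
rewrite btE => /(_ bp); apply: le_trans.
(* The chord length is unknown, so the angles were chosen to make its coefficient nonnegative. *)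
have h3 : 0 <= d * (2 * sin a - sin b) by rewrite mulr_ge0.
apply: (le_trans (ler_wpM2r W0 h2)); lra.
Qed.

(** Without a chord the whole quarter circle of directions is available: [a = 0] and [b = pi / 2].
    Then [n] directions give the constant [4 n sin (pi / (4 n))], which tends to [pi]. *)
Lemma planar_width_closed (m : nat) (P : nat -> 'rV[R]_2) (W : R) : 0 <= W ->
  every_direction (has_spread m W) P -> P m = P 0%N -> pi * W <= plen m P.
Proof.
move=> W0 wide clo; have pi0 := pi_gt0 R; have pi4 : pi <= 4 :> R.
  by have [/andP[_ h] _] := pihalf_02_cos_pihalf R; lra.
have key (n : nat) : (0 < n)%N -> (pi - n%:R^-1) * W <= plen m P.
  move=> n0; have nr : 0 < n%:R :> R by rewrite ltr0n.
  pose t : R := pi / (4 * n%:R).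
  have t0 : 0 <= t by rewrite divr_ge0 ?mulr_ge0// ltW.
  have ht : 0 + n%:R * (2 * t) = pi / 2 by rewrite /t; field; rewrite gt_eqF.
  have := @planar_width_sum m n P W 0 0 t wide.
  rewrite ht clo !subrr => /(_ erefl erefl (lexx 0) (lexx 0) t0 n0 (lexx _)).
  rewrite mul0r cos_pihalf mulr0 addr0 add0r; apply: le_trans; apply: ler_wpM2r => //.
  have ni : n%:R^-1 * n%:R = 1 :> R by rewrite mulVf// gt_eqF.
  have nt : 4 * n%:R * t = pi by rewrite /t; field; rewrite gt_eqF.
  have tn : t <= n%:R^-1.
    by rewrite /t ler_pdivrMr ?mulr_gt0// mulrCA ni mulr1.
  have n1 : n%:R^-1 <= 1 :> R by rewrite invf_le1// ler1n.
  have q0 : 0 <= 4 * n%:R :> R by rewrite mulr_ge0.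
  have := ler_wpM2l q0 (sin_ge3T t0).
  apply: le_trans; rewrite mulrBr nt lerD2l lerN2.
  have -> : 4 * n%:R * (6^-1 * t ^+ 3) = 6^-1 * pi * t ^+ 2 by rewrite -nt; ring.
  have t2 : t ^+ 2 <= n%:R^-1.
    by rewrite expr2; apply: (@le_trans _ _ (t * 1)); [rewrite ler_wpM2l//; lra|rewrite mulr1].
  apply: (@le_trans _ _ (6^-1 * pi * n%:R^-1)); first by rewrite ler_wpM2l//; lra.
  by rewrite ler_piMl ?invr_ge0//; lra.
rewrite leNgt; apply/negP => lt.
have [N Nh] : exists N : nat, W < N%:R * (pi * W - plen m P).
  exists (Num.truncn (W / (pi * W - plen m P))).+1.
  by rewrite -ltr_pdivrMr ?subr_gt0//; exact: truncnS_gt.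
have N0 : (0 < N)%N by case: N Nh => //; rewrite mul0r ltNge W0.
have Nr : 0 < N%:R :> R by rewrite ltr0n.
have := key N N0; rewrite mulrBl => h.
have : W <= N%:R * (plen m P - pi * W + N%:R^-1 * W) + N%:R * (pi * W - plen m P) by rewrite -mulrDr; rewrite (_ : _ + _ = N%:R^-1 * W) ?mulVKf ?gt_eqF//; ring.
have : N%:R * (pi * W - plen m P) <= N%:R * (N%:R^-1 * W) by rewrite ler_pM2l//; lra.
by rewrite mulVKf ?gt_eqF//; lra.
Qed.

End planar_width.

(** * Planar inradius of open polygons *)

Section counting.
Variable R : realType.
Local Notation twopi := (2 * pi : R).

Lemma window_count (b : nat -> bool) (N : nat) (y z : R) : y <= z ->
  (forall j, (j < N)%N -> b j -> y <= j%:R <= z) -> \sum_(j < N) (b j)%:R <= z - y + 1.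
Proof.
move=> yz; elim: N => [|N IH] h; first by rewrite big_ord0; lra.
have hN j : (j < N)%N -> b j -> y <= j%:R <= z by move=> jN; apply: h; exact: ltnW.
suff key n : (forall j, (j < n)%N -> b j -> y <= j%:R <= z) ->
    \sum_(j < n) (b j)%:R <= Num.max 0 (n%:R - y).
  rewrite big_ord_recr/=; case bN: (b N); last by rewrite addr0; exact: IH.
  have /andP[h1 h2] := h N (leqnn _) bN; rewrite lerD2r.
  by apply: le_trans (key N hN) _; rewrite ge_max subr_ge0 yz/=; lra.
elim: n => [|n IHn] hn; first by rewrite big_ord0 le_max lexx.
have {}IHn := IHn (fun j jn => hn j (ltnW jn)).
rewrite big_ord_recr/= -natr1; case bn: (b n).
  have /andP[h1 h2] := hn n (leqnn _) bn.
  have E : Num.max 0 (n%:R - y) = n%:R - y by apply/max_idPr; rewrite subr_ge0.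
  rewrite E in IHn; rewrite /=.
  by rewrite le_max; apply/orP; right; lra.
rewrite /= addr0; apply: le_trans IHn _; rewrite ge_max le_max lexx/= le_max.
by apply/orP; right; lra.
Qed.

Lemma periodic_sum (f : nat -> R) N s : (forall k, f (N + k)%N = f k) ->
  \sum_(k < N) f k = \sum_(k < N) f (s + k)%N.
Proof.
move=> per; elim: s => [|s ->]; first by under [RHS]eq_bigr do rewrite add0n.
case: N per => [|N] per; first by rewrite !big_ord0.
rewrite big_ord_recl big_ord_recr/= addn0 addrC; congr (_ + _).
  by rewrite -per; congr f; lia.
by apply: eq_bigr => i _; congr f; rewrite /bump; lia.
Qed.

(** The error 1 does not depend on [N], so it disappears after division by [N]. Periodicity moves
    the count to the first sample beyond [x], from where the set lies in one interval. *)
Lemma arc_count (A : R -> bool) (x y z : R) (N : nat) : (0 < N)%N -> 0 <= x -> y <= z ->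
  (forall t, A (t + twopi) = A t) ->
  (forall t, x < t -> t <= x + twopi -> A t -> y <= t <= z) ->
  \sum_(k < N) (A (twopi * k%:R / N%:R))%:R <= N%:R * (z - y) / twopi + 1.
Proof.
move=> N0 x0 yz per hA; have pi0 := pi_gt0 R; have p0 : 0 < twopi by lra.
have Nr : 0 < N%:R :> R by rewrite ltr0n.
have fE (n s p : R) : p != 0 -> n * (z - y) / (2 * p) + 1 = (n * z / (2 * p) - s) - (n * y / (2 * p) - s) + 1.
  by move=> h; field.
have fE' (n p : R) : p != 0 -> n * (x + 2 * p) / (2 * p) = n * x / (2 * p) + n by move=> h; field.
set s := (Num.truncn (N%:R * x / twopi)).+1.
rewrite (@periodic_sum (fun k => (A (twopi * k%:R / N%:R))%:R) N s); last first.
  move=> k; rewrite -[in RHS]per; congr (A _)%:R; rewrite natrD; field; rewrite gt_eqF//.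
have q0 : 0 <= N%:R * x / twopi by rewrite divr_ge0 ?mulr_ge0// ltW.
have s1 : N%:R * x / twopi < s%:R by exact: truncnS_gt.
have s2 : s%:R - 1 <= N%:R * x / twopi.
  by rewrite /s -natr1 addrK; have /truncn_itv/andP[] := q0.
have conv (a b : R) : (a <= twopi * b / N%:R) = (N%:R * a / twopi <= b).
  by rewrite ler_pdivlMr// ler_pdivrMr// mulrC [b * _]mulrC.
have conv' (a b : R) : (twopi * b / N%:R <= a) = (b <= N%:R * a / twopi).
  by rewrite ler_pdivrMr// ler_pdivlMr// mulrC [_ * a]mulrC.
have -> : N%:R * (z - y) / twopi + 1 = (N%:R * z / twopi - s%:R) - (N%:R * y / twopi - s%:R) + 1.
  by apply: fE; rewrite gt_eqF.
apply: (@window_count (fun j => A (twopi * (s + j)%:R / N%:R))).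
  by rewrite lerD2r ler_pM2r ?invr_gt0// ler_pM2l.
move=> j jN hb; have : y <= twopi * (s + j)%:R / N%:R <= z.
  apply: hA hb; first by rewrite ltNge conv' -ltNge; apply: lt_le_trans s1 _; rewrite natrD lerDl.
  rewrite conv' fE' ?gt_eqF// natrD.
  have : j%:R + 1 <= N%:R :> R by rewrite natr1 ler_nat.
  lra.
by rewrite conv conv' natrD lerBlDl lerBrDl.
Qed.

(** The sequence is true at [t] and false at [c] or [c.+1], so it switches; where it starts or ends
    true, the end terms make up for the missing switch. *)
Lemma xor_count (b : nat -> bool) m (t c : nat) : (t <= m)%N -> b t -> (c < m)%N ->
  ~~ (b c && b c.+1) ->
  2 <= \sum_(i < m) (b i (+) b i.+1)%:R + (b 0%N)%:R + (b m)%:R :> R.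
Proof.
move=> tm bt cm bc.
have between i j : (i <= j)%N -> (b i (+) b j)%:R <= \sum_(i <= k < j) (b k (+) b k.+1)%:R :> R.
  elim: j => [|j IH]; first by rewrite leqn0 => /eqP ->; rewrite addbb big_geq.
  rewrite leq_eqVlt => /orP[/eqP ->|]; first by rewrite addbb big_geq.
  rewrite ltnS => ij; rewrite big_nat_recr//=; have := IH ij.
  by case: (b i); case: (b j); case: (b j.+1) => /=; lra.
have split i : (i <= m)%N -> (b 0%N (+) b i)%:R + (b i (+) b m)%:R <= \sum_(k < m) (b k (+) b k.+1)%:R :> R.
  move=> im; rewrite -(big_mkord xpredT (fun k => (b k (+) b k.+1)%:R)) (big_cat_nat (n := i))//=.
  by rewrite lerD// between.
case b0: (b 0%N); case bm: (b m) => /=.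
- have [i im bi] : exists2 i, (i <= m)%N & ~~ b i.
    by move: bc; rewrite negb_and => /orP[h|h]; [exists c => //; exact: ltnW|exists c.+1].
  by have := split i im; rewrite b0 bm (negbTE bi)/=; lra.
- by have := split 0%N isT; rewrite b0 bm/=; lra.
- by have := split 0%N isT; rewrite b0 bm/=; lra.
- by have := split t tm; rewrite b0 bm bt/=; lra.
Qed.

End counting.

Section arcs.
Variable R : realType.
Implicit Types phi a t : R.

Definition sees phi a t := cos a < cos (t - phi).

Lemma arc_2pi phi a t : sees phi a (t + 2 * pi) = sees phi a t.
Proof. by rewrite /sees addrAC mulr_natl cosD2pi. Qed.

Lemma arc_near phi a t : a <= pi -> `|t - phi| < a -> sees phi a t.
Proof. exact: cos_gt_near. Qed.

Lemma arc_far phi a t : 0 <= a -> a <= t - phi -> t - phi <= 2 * pi - a -> ~~ sees phi a t.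
Proof. by move=> a0 h1 h2; rewrite /sees -leNgt; apply: cos_le_far => //; rewrite h1 mulr2n; lra. Qed.

Lemma arc_witness phi a t : 0 <= a -> sees phi a t ->
  exists y, [/\ `|y| < a, cos y = cos (t - phi) & sin y = sin (t - phi)].
Proof.
move=> a0 h; have [y [yp cy sy]] := angle_mod (t - phi); exists y; split => //.
rewrite ltNge; apply/negP => le; move: h; rewrite /sees -cy -[cos y]cos_norm ltNge; apply/negP/negPn.
by apply: cos_le_far => //; rewrite le [pi *+ 2]mulr2n; have := le_trans le yp; lra.
Qed.

Lemma arc_sub phi a phi' a' t : 0 <= a' -> a <= pi -> `|phi' - phi| + a' <= a ->
  sees phi' a' t -> sees phi a t.
Proof.
move=> a0 ap le /(arc_witness a0)[y [ya cy sy]].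
have -> : sees phi a t = (cos a < cos (y + (phi' - phi))).
  by rewrite /sees -(subrKA phi' t) (cosD (t - phi')) (cosD y) cy sy.
by apply: cos_gt_near => //; apply: le_lt_trans (ler_normD _ _) _; lra.
Qed.

Lemma arc_disjoint phi a phi' a' t : 0 <= a -> 0 <= a' -> a + a' <= pi ->
  `|phi' - phi| <= pi -> a + a' <= `|phi' - phi| -> sees phi a t -> ~~ sees phi' a' t.
Proof.
move=> a0 a0' aa dp far /(arc_witness a0)[y [ya cy sy]].
have -> : sees phi' a' t = (cos a' < cos (y - (phi' - phi))).
  have -> : sees phi' a' t = (cos a' < cos ((t - phi) - (phi' - phi))) by rewrite /sees opprB subrKA.
  by rewrite (cosB (t - phi)) (cosB y) cy sy.
rewrite -leNgt -[leLHS]cos_norm; apply: cos_le_far => //; rewrite [pi *+ 2]mulr2n; apply/andP; split.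
  by rewrite distrC; have := lerB_dist (phi' - phi) y; lra.
by have := ler_normB y (phi' - phi); lra.
Qed.

Lemma arc_total phi a (N : nat) : (0 < N)%N -> 0 <= a -> a <= phi ->
  \sum_(k < N) (sees phi a (2 * pi * k%:R / N%:R))%:R <= N%:R * a / pi + 1.
Proof.
move=> N0 a0 ap; have pi0 := pi_gt0 R.
have fE (n p : R) : p != 0 -> n * a / p = n * ((phi + a) - (phi - a)) / (2 * p) by move=> h; field.
rewrite fE ?gt_eqF//.
apply: (@arc_count R (sees phi a) (phi - a)) => //; [lra|lra|exact: arc_2pi|].
move=> t t1 t2 h; apply/andP; split; first exact: ltW.
rewrite leNgt; apply/negP => t3; move: h; apply/negP; apply: arc_far => //; lra.
Qed.

(** Both ends of the arc advance while the arcs still overlap, by amounts that add up to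
    [2 * (phi' - phi)]; each advance is counted with error at most 1. *)
Lemma arc_xor_total phi a phi' a' (N : nat) : (0 < N)%N -> 0 <= a -> 0 <= a' -> a <= pi -> a' <= pi ->
  a <= phi -> a' <= phi' ->
  phi <= phi' -> phi - a <= phi' - a' -> phi' - a' <= phi + a -> phi + a <= phi' + a' ->
  \sum_(k < N) (sees phi a (2 * pi * k%:R / N%:R) (+) sees phi' a' (2 * pi * k%:R / N%:R))%:R <=
    N%:R * (phi' - phi) / pi + 2.
Proof.
move=> N0 a0 a0' ap ap' pos pos' pp ll lr rr; have pi0 := pi_gt0 R.
have Nr : 0 < N%:R :> R by rewrite ltr0n.
pose D t := sees phi a t && ~~ sees phi' a' t; pose D' t := sees phi' a' t && ~~ sees phi a t.
have fE (n p : R) : p != 0 -> n * (phi' - phi) / p + 2 = (n * ((phi' - a') - (phi - a)) / (2 * p) + 1) +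
    (n * ((phi' + a') - (phi + a)) / (2 * p) + 1) by move=> h; field.
rewrite fE ?gt_eqF//.
apply: (@le_trans _ _ (\sum_(k < N) (D (2 * pi * k%:R / N%:R))%:R + \sum_(k < N) (D' (2 * pi * k%:R / N%:R))%:R)).
  rewrite -big_split; apply: ler_sum => k _; rewrite /D /D' /=.
  by case: (sees _ _ _); case: (sees _ _ _) => /=; lra.
apply: lerD.
  apply: (@arc_count R D (phi - a)) => //; first by lra.
    by move=> t; rewrite /D !arc_2pi.
  move=> t t1 t2 /andP[h h']; apply/andP; split; first exact: ltW.
  rewrite leNgt; apply/negP => t3; have t4 : t < phi + a.
    by rewrite ltNge; apply/negP => t4; move: h; apply/negP; apply: arc_far => //; lra.
  by move: h'; apply/negP/negPn; apply: arc_near => //; rewrite ltr_norml; apply/andP; split; lra.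
apply: (@arc_count R D' (phi' - a')) => //; first by lra.
  by move=> t; rewrite /D' !arc_2pi.
move=> t t1 t2 /andP[h h']; apply/andP; split.
  rewrite leNgt; apply/negP => t3; move: h'; apply/negP/negPn; apply: arc_near => //.
  by rewrite ltr_norml; apply/andP; split; lra.
rewrite leNgt; apply/negP => t3; move: h; apply/negP; apply: arc_far => //; lra.
Qed.

End arcs.

(** * Paths around the unit disc in polar coordinates *)

Section polar_path.
Variable R : realType.
Variables (m : nat) (phi al : nat -> R) (dist : nat -> nat -> R).
Hypotheses (al_range : forall i, (i <= m)%N -> 0 < al i < pi / 2)
  (step_le : forall i, (i < m)%N -> `|phi i.+1 - phi i| <= pi)
  (start_ge0 : forall i, (i <= m)%N -> al i <= phi i)
  (distC : forall i j, dist i j = dist j i)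
  (dist_proj : forall i j, (i <= m)%N -> (j <= m)%N -> forall psi, sin (phi j - psi) / cos (al j) - sin (phi i - psi) / cos (al i) <= dist i j)
  (covered : forall t, exists2 i, (i <= m)%N & sees (phi i) (al i) t)
  (incomparable : forall i, (i < m)%N ->
     (exists t, sees (phi i) (al i) t && ~~ sees (phi i.+1) (al i.+1) t) /\
     (exists t, sees (phi i.+1) (al i.+1) t && ~~ sees (phi i) (al i) t)).

Let excess i := tan (al i) - al i.

Local Lemma cos_al i : (i <= m)%N -> 0 < cos (al i).
Proof. by move=> /al_range/andP[h1 h2]; apply: cos_gt0_pihalf; apply/andP; split; lra. Qed.

Local Lemma sec_sin_al i : (i <= m)%N -> sin (al i) / cos (al i) = tan (al i).
Proof. by []. Qed.

Local Lemma sec_sin_lower i x : (i <= m)%N -> 0 <= x -> x <= 2 * al i ->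
  sin (al i - x) / cos (al i) <= tan (al i) - x.
Proof.
move=> im x0 xa; have c0 := cos_al im; have /andP[a0 ap] := al_range im.
have := @sec_sin_ge R (al i) (al i) (al i - x) (ltW a0) ap.
have -> : al i - (al i - x) = x by ring.
move=> h; rewrite ler_pdivrMr// mulrBl /tan divfK ?gt_eqF//.
have : x * cos (al i) <= sin (al i) - sin (al i - x) by apply: h; lra.
lra.
Qed.

Local Lemma sec_sin_upper i x : (i <= m)%N -> 0 <= x ->
  sin (al i + x) / cos (al i) <= tan (al i) + x.
Proof.
move=> im x0; have c0 := cos_al im; have /andP[a0 ap] := al_range im; have pi0 := pi_gt0 R.
have s0 : 0 <= sin (al i) by apply: sin_ge0_pi; apply/andP; split; lra.
rewrite ler_pdivrMr// mulrDl /tan divfK ?gt_eqF//.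
have [xp|xp] := leP x (pi / 2).
  have := @deriv_ge0_le R (fun t => sin (al i) + t * cos (al i) - sin (al i + t))
    (fun t => cos (al i) - cos (al i + t)) 0 x x0.
  rewrite mul0r !addr0 subrr subr_ge0; apply=> t /andP[t0 tx].
    by apply: is_derive_eq; rewrite /GRing.scale/=; ring.
  by rewrite subr_ge0; apply: cos_le_far; [exact: ltW|rewrite [pi *+ 2]mulr2n; apply/andP; split; lra].
apply: (@le_trans _ _ 1); first exact: sin_le1.
have h1 : cos (al i) <= x * cos (al i).
  by rewrite ler_peMl ?ltW//; have [/andP[h _] _] := pihalf_02_cos_pihalf R; have := pi_gt_3_13 R; lra.
have sc := cos2Dsin2 (al i).
have : 1 <= (sin (al i) + cos (al i)) ^+ 2.
  have : 0 <= sin (al i) * cos (al i) by rewrite mulr_ge0// ltW.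
  by rewrite sqrrD mulr2n; lra.
by move: (sin (al i)) (cos (al i)) s0 c0 h1 => s c s0 c0 h1 h2; nra.
Qed.

Lemma arc_offset i j : (i <= m)%N -> (j <= m)%N ->
  (exists t, sees (phi i) (al i) t && ~~ sees (phi j) (al j) t) -> al j - al i < `|phi j - phi i|.
Proof.
move=> im jm [t /andP[h h']]; rewrite ltNge; apply/negP => le; move: h'; apply/negP/negPn.
have /andP[a0 ap] := al_range im; have /andP[a0' ap'] := al_range jm; have pi0 := pi_gt0 R.
by apply: arc_sub h; rewrite ?(ltW a0)//; [lra|rewrite distrC; lra].
Qed.

(** The edge is projected along the tangents at [phi i + al i] and at [phi j - al j]; each gives the
    bound for one sign of the difference of excesses. *)
Lemma overlap_length_aux i j : (i <= m)%N -> (j <= m)%N -> phi i <= phi j ->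
  al j - al i <= phi j - phi i -> al i - al j <= phi j - phi i -> phi j - phi i <= al i + al j ->
  phi j - phi i + `|excess j - excess i| <= dist i j.
Proof.
move=> im jm pp d1 d2 ov; have /andP[a0 ap] := al_range im; have /andP[a0' ap'] := al_range jm.
rewrite -lerBrDl ler_norml; apply/andP; split.
  have := dist_proj im jm (phi i + al i).
  rewrite (_ : phi j - (phi i + al i) = - (al j - (phi j + al j - phi i - al i))); last by ring.
  rewrite (_ : phi i - (phi i + al i) = - al i); last by ring.
  rewrite !sinN !mulNr sec_sin_al// => h.
  have := @sec_sin_lower j (phi j + al j - phi i - al i) jm; rewrite /excess => h'.
  have : sin (al j - (phi j + al j - phi i - al i)) / cos (al j) <= tan (al j) - (phi j + al j - phi i - al i).
    by apply: h'; lra.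
  lra.
have := dist_proj im jm (phi j - al j).
rewrite (_ : phi j - (phi j - al j) = al j); last by ring.
rewrite (_ : phi i - (phi j - al j) = al i - (phi j - al j - phi i + al i)); last by ring.
rewrite sec_sin_al// => h.
have := @sec_sin_lower i (phi j - al j - phi i + al i) im; rewrite /excess => h'.
have : sin (al i - (phi j - al j - phi i + al i)) / cos (al i) <= tan (al i) - (phi j - al j - phi i + al i).
  by apply: h'; lra.
lra.
Qed.

(** The edge is projected along the tangent at the inner end of the wider arc. The angle left for
    the other vertex lies between its half-width and the supplement, where the sine is at least that
    of the half-width. *)
Lemma crossing_length_aux i j : (i <= m)%N -> (j <= m)%N -> phi j - phi i <= pi ->
  al i + al j <= phi j - phi i -> tan (al i) + tan (al j) <= dist i j.
Proof.
move=> im jm dp far; have /andP[a0 ap] := al_range im; have /andP[a0' ap'] := al_range jm.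
have pi0 := pi_gt0 R; have c0 := cos_al im; have c0' := cos_al jm.
have big (a y : R) : 0 < a -> a < pi / 2 -> a <= y -> y <= pi - a -> sin a <= sin y.
  move=> h1 h2 h3 h4; rewrite -!cosBpihalf -[leLHS]cos_norm -[leRHS]cos_norm ler0_norm; last by lra.
  apply: cos_le_far => //; rewrite [pi *+ 2]mulr2n; apply/andP; split.
    by rewrite ler_norml; apply/andP; split; lra.
  have : `|y - pi / 2| <= pi / 2 by rewrite ler_norml; apply/andP; split; lra.
  lra.
have [le|le] := leP (al j) (al i).
  have := dist_proj im jm (phi i + al i).
  rewrite (_ : phi i - (phi i + al i) = - al i); last by ring.
  rewrite sinN mulNr opprK sec_sin_al// => h; apply: le_trans h; rewrite addrC lerD2r.
  by rewrite /tan ler_pM2r ?invr_gt0//; apply: big => //; lra.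
have := dist_proj im jm (phi j - al j).
rewrite (_ : phi j - (phi j - al j) = al j); last by ring.
rewrite sec_sin_al// => h; apply: le_trans h; rewrite addrC lerD2l.
rewrite -mulNr -sinN /tan ler_pM2r ?invr_gt0//; apply: big => //; lra.
Qed.

Lemma excess_ge0 i : (i <= m)%N -> 0 <= excess i.
Proof.
move=> im; have /andP[a0 _] := al_range im.
have := @sec_sin_lower i (al i) im (ltW a0); rewrite subrr sin0 mul0r; apply; lra.
Qed.

(** Half the length of the symmetric difference of the two arcs, in the overlapping and in the
    disjoint case. *)
Let gap i : R := if `|phi i.+1 - phi i| <= al i + al i.+1 then `|phi i.+1 - phi i| else al i + al i.+1.

Lemma overlap_length i : (i < m)%N -> `|phi i.+1 - phi i| <= al i + al i.+1 ->
  `|phi i.+1 - phi i| + `|excess i.+1 - excess i| <= dist i i.+1.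
Proof.
move=> im ov; have [h1 h2] := incomparable im; have im' := ltnW im.
have g1 := arc_offset im' im h1; have g2 := arc_offset im im' h2.
rewrite [ltRHS]distrC in g2.
have [le|le] := leP (phi i) (phi i.+1).
  rewrite ger0_norm ?subr_ge0// in g1 g2 ov *; apply: overlap_length_aux => //; lra.
rewrite distrC ger0_norm ?subr_ge0 ?(ltW le)// in g1 g2 ov *.
by rewrite distrC distC; apply: overlap_length_aux => //; lra.
Qed.

Lemma crossing_length i : (i < m)%N -> al i + al i.+1 <= `|phi i.+1 - phi i| ->
  tan (al i) + tan (al i.+1) <= dist i i.+1.
Proof.
move=> im far; have im' := ltnW im; have := step_le im.
have [le|le] := leP (phi i) (phi i.+1).
  by rewrite ger0_norm ?subr_ge0// in far *; move=> dp; apply: crossing_length_aux.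
rewrite distrC ger0_norm ?subr_ge0 ?(ltW le)// in far *; move=> dp.
by rewrite distC [leLHS]addrC; apply: crossing_length_aux => //; rewrite addrC.
Qed.

Local Lemma xor_total_le i (N : nat) : (0 < N)%N -> (i < m)%N ->
  \sum_(k < N) (sees (phi i) (al i) (2 * pi * k%:R / N%:R) (+)
    sees (phi i.+1) (al i.+1) (2 * pi * k%:R / N%:R))%:R <= N%:R * gap i / pi + 2.
Proof.
move=> N0 im; have im' := ltnW im; have pi0 := pi_gt0 R.
have /andP[a0 ap] := al_range im'; have /andP[a0' ap'] := al_range im.
have s0 := start_ge0 im'; have s0' := start_ge0 im.
rewrite /gap; case: (leP `|phi i.+1 - phi i| _) => ov.
  have [h1 h2] := incomparable im.
  have g1 := arc_offset im' im h1; have g2 := arc_offset im im' h2.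
  rewrite [ltRHS]distrC in g2.
  have [le|le] := leP (phi i) (phi i.+1).
    by rewrite ger0_norm ?subr_ge0// in g1 g2 ov *; apply: arc_xor_total => //; lra.
  rewrite distrC ger0_norm ?subr_ge0 ?(ltW le)// in g1 g2 ov *.
  apply: le_trans (@arc_xor_total R (phi i.+1) (al i.+1) (phi i) (al i) N N0 _ _ _ _ _ _ _ _ _ _) => //; try lra.
  by apply: ler_sum => k _; rewrite addbC.
have fE (n a b p : R) : n * (a + b) / p + 2 = (n * a / p + 1) + (n * b / p + 1) by ring.
rewrite fE; apply: le_trans (lerD (arc_total N0 (ltW a0) s0) (arc_total N0 (ltW a0') s0')).
rewrite -big_split; apply: ler_sum => k _ /=.
by case: (sees _ _ _); case: (sees _ _ _) => /=; lra.
Qed.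

(** Every sampled direction is seen by some vertex and missed at an end of the edge [c], whose arcs
    are disjoint, so [xor_count] applies to it. Summed over [N] directions, the counting errors stay
    bounded while the main terms grow with [N]. *)
Lemma gap_sum c : (c < m)%N -> al c + al c.+1 <= `|phi c.+1 - phi c| ->
  2 * pi - al 0%N - al m <= \sum_(i < m) gap i.
Proof.
move=> cm far; have pi0 := pi_gt0 R.
have /andP[a0 ap] := al_range (leq0n m); have /andP[am amp] := al_range (leqnn m).
have key (N : nat) : (0 < N)%N -> N%:R * (2 * pi - al 0%N - al m - \sum_(i < m) gap i) <= (m%:R + 1) * (2 * pi).
  move=> N0; pose b i k := sees (phi i) (al i) (2 * pi * k%:R / N%:R).
  have h1 : \sum_(k < N) (2 : R) <= \sum_(k < N) (\sum_(i < m) (b i k (+) b i.+1 k)%:R + (b 0%N k)%:R + (b m k)%:R).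
    apply: ler_sum => k _; have [t tm ht] := covered (2 * pi * k%:R / N%:R).
    apply: (@xor_count R (fun i => b i k) m t c) => //.
    have /andP[ac acp] := al_range (ltnW cm); have /andP[ac' acp'] := al_range cm.
    apply/negP => /andP[s1]; apply/negP; apply: (arc_disjoint (ltW ac) (ltW ac') _ (step_le cm) far s1); lra.
  move: h1; rewrite sumr_const card_ord !big_split/= exchange_big/= => h1.
  have h2 : \sum_(i < m) \sum_(k < N) (b i k (+) b i.+1 k)%:R <= \sum_(i < m) (N%:R * gap i / pi + 2).
    by apply: ler_sum => i _; exact: xor_total_le.
  have h3 := arc_total N0 (ltW a0) (start_ge0 (leq0n m)).
  have h4 := arc_total N0 (ltW am) (start_ge0 (leqnn m)).
  have := le_trans h1 (lerD (lerD h2 h3) h4).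
  rewrite big_split/= sumr_const card_ord -mulr_suml -mulr_sumr -[2 *+ N]mulr_natr -[2 *+ m]mulr_natr.
  rewrite -(ler_pM2r pi0); move: (\sum_(i < m) gap i) => S.
  have fE (n s u v w p : R) : p != 0 -> (n * s / p + 2 * w + (n * u / p + 1) + (n * v / p + 1)) * p = n * (s + u + v) + 2 * (w + 1) * p.
    by move=> h; field.
  rewrite fE ?gt_eqF//; lra.
rewrite leNgt; apply/negP => lt; move: key; move: (\sum_(i < m) gap i) lt => S lt key.
pose D := 2 * pi - al 0%N - al m - S; have D0 : 0 < D by rewrite subr_gt0.
have q0 : 0 <= (m%:R + 1) * (2 * pi) / D by apply: divr_ge0; [apply: mulr_ge0; [rewrite addr_ge0|lra]|exact: ltW].
have := key (Num.truncn ((m%:R + 1) * (2 * pi) / D)).+1 isT.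
by rewrite -/D -ler_pdivlMr// leNgt truncnS_gt.
Qed.

(** The tangent line of [tan] at [pi / 4], where the slope is 2. The two ends of a path each
    contribute such a term and turn [2 * pi] into [pi + 2]. *)
Lemma tan_double_ge (x : R) : 0 < x -> x < pi / 2 -> 1 - pi / 2 <= tan x - 2 * x.
Proof.
move=> x0 xp; have pi0 := pi_gt0 R.
have q : 0 <= (pi : R) / 4 < pi / 2 by apply/andP; split; lra.
have xx : 0 <= x < pi / 2 by rewrite ltW.
have := tan_tangent_le q xx; rewrite tan_piquarter.
have c2 : cos (pi / 4) ^+ 2 = 2^-1 :> R.
  have := cos_pihalf R; rewrite (_ : pi / 2 = pi / 4 + pi / 4 :> R); last by lra.
  by rewrite cosD -!expr2 => h; have := cos2Dsin2 (pi / 4 : R); lra.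
by rewrite c2 invrK; lra.
Qed.

(* Flipping the sign of the excess at the crossing edge turns the bounds for the edges into a
   telescoping sum. *)
Lemma length_with_crossing c : (c < m)%N -> al c + al c.+1 <= `|phi c.+1 - phi c| ->
  pi + 2 <= \sum_(i < m) dist i i.+1.
Proof.
move=> cm far; pose s i : R := if (i <= c)%N then - excess i else excess i.
have s_le i : (i <= c)%N -> s i = - excess i by rewrite /s => ->.
have s_gt i : (c < i)%N -> s i = excess i by move=> ci; rewrite /s leqNgt ci.
have gapE i : `|phi i.+1 - phi i| <= al i + al i.+1 -> gap i = `|phi i.+1 - phi i| by rewrite /gap => ->.
clearbody s.
have edge i : (i < m)%N -> gap i + (s i.+1 - s i) <= dist i i.+1.
  move=> im; have e0 := excess_ge0 (ltnW im); have e1 := excess_ge0 im.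
  have cross : al i + al i.+1 <= `|phi i.+1 - phi i| -> gap i + (excess i + excess i.+1) <= dist i i.+1.
    move=> h; apply: le_trans (crossing_length im h).
    have : gap i <= al i + al i.+1 by rewrite /gap; case: (leP `|phi i.+1 - phi i| _).
    by rewrite /excess; lra.
  have [ic|ci|ic] := ltngtP i c.
  - rewrite (s_le _ ic) (s_le _ (ltnW ic)).
    have [ov|h] := leP `|phi i.+1 - phi i| (al i + al i.+1); last by have := cross (ltW h); lra.
    apply: le_trans (overlap_length im ov); rewrite (gapE _ ov) lerD2l opprK addrC.
    by rewrite distrC ler_norm.
  - rewrite (s_gt _ ci) (s_gt _ (leqW ci)).
    have [ov|h] := leP `|phi i.+1 - phi i| (al i + al i.+1); last by have := cross (ltW h); lra.
    by apply: le_trans (overlap_length im ov); rewrite (gapE _ ov) lerD2l ler_norm.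
  - rewrite -ic in far s_le s_gt.
    by rewrite (s_gt _ (ltnSn i)) (s_le _ (leqnn i)); have := cross far; lra.
have tele : \sum_(i < m) (s i.+1 - s i) = excess m + excess 0%N.
  by rewrite -(big_mkord xpredT (fun i => s i.+1 - s i)) telescope_sumr// (s_gt _ cm) (s_le _ (leq0n c)) opprK.
apply: (@le_trans _ _ (\sum_(i < m) (gap i + (s i.+1 - s i)))); last first.
  by apply: ler_sum => i _; exact: edge.
rewrite big_split/= tele; have := gap_sum cm far.
have /andP[a0 ap] := al_range (leq0n m); have /andP[am amp] := al_range (leqnn m).
have := tan_double_ge a0 ap; have := tan_double_ge am amp; rewrite /excess.
move: (\sum_(i < m) gap i) => S; lra.
Qed.

(* [height] is 1-Lipschitz along edges that avoid the disc: up to a sign it is the length of the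
   path which winds around the disc from the tangent at the angle [c]. *)
Section calibration.
Variable c : R.

Let height i : R := if phi i - al i <= c then sin (phi i - c) / cos (al i)
  else tan (al i) + (phi i - al i - c).

(** One projection of the edge suffices in each case: at the angle [c] if the arc of [j] starts
    before [c], at [phi j - al j] otherwise. The hypothesis keeps the angles in the range of the
    secant bounds. *)
Lemma height_step i j : (i <= m)%N -> (j <= m)%N -> phi j - al j <= phi i + al i ->
  height j - height i <= dist i j.
Proof.
move=> im jm ov; have /andP[a0 ap] := al_range im; have /andP[a0' ap'] := al_range jm.
have ci := cos_al im.
have atl : dist i j >= tan (al j) - sin (phi i - (phi j - al j)) / cos (al i).
  have := dist_proj im jm (phi j - al j).
  by rewrite (_ : phi j - (phi j - al j) = al j) ?sec_sin_al//; ring.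
rewrite /height; case: (leP (phi j - al j) c) => hj; case: (leP (phi i - al i) c) => hi.
- exact: dist_proj.
- apply: le_trans (dist_proj im jm c); rewrite lerD2l lerN2.
  have := @sec_sin_upper i (phi i - al i - c) im.
  by rewrite (_ : al i + (phi i - al i - c) = phi i - c); [apply; lra|ring].
- apply: le_trans atl; suff : (phi j - al j - c) <= sin (phi i - c) / cos (al i) - sin (phi i - (phi j - al j)) / cos (al i) by lra.
  rewrite -mulrBl ler_pdivlMr//.
  have := @sec_sin_ge R (al i) (phi i - c) (phi i - (phi j - al j)) (ltW a0) ap.
  by rewrite (_ : phi i - c - (phi i - (phi j - al j)) = phi j - al j - c); [apply; lra|ring].
- apply: le_trans atl; suff : sin (phi i - (phi j - al j)) / cos (al i) <= tan (al i) + (phi i - al i) - (phi j - al j) by lra.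
  have [le|le] := leP (phi i - al i) (phi j - al j).
    have := @sec_sin_lower i (phi j - al j - (phi i - al i)) im.
    rewrite (_ : al i - _ = phi i - (phi j - al j)); last by ring.
    move=> h; suff : sin (phi i - (phi j - al j)) / cos (al i) <= tan (al i) - (phi j - al j - (phi i - al i)) by lra.
    by apply: h; lra.
  have := @sec_sin_upper i (phi i - al i - (phi j - al j)) im.
  rewrite (_ : al i + _ = phi i - (phi j - al j)); last by ring.
  move=> h; suff : sin (phi i - (phi j - al j)) / cos (al i) <= tan (al i) + (phi i - al i - (phi j - al j)) by lra.
  by apply: h; lra.
Qed.

End calibration.

(** The least lower end and the greatest upper end of the arcs are at least [2 * pi] apart, or a
    direction would be missed. With [c] at the upper end of the arc of [p], the height rises from
    [p] to [q] by a tangent, an arc and a tangent. *)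
Lemma length_without_crossing : (forall i, (i < m)%N -> `|phi i.+1 - phi i| <= al i + al i.+1) ->
  pi + 2 <= \sum_(i < m) dist i i.+1.
Proof.
move=> ov; have pi0 := pi_gt0 R.
have [p [pm hp]] := near_max_ex m (fun i => - (phi i - al i)).
have [q [qm hq]] := near_max_ex m (fun i => phi i + al i).
have /andP[ap app] := al_range pm; have /andP[aq aqp] := al_range qm.
have wide : 2 * pi <= (phi q + al q) - (phi p - al p).
  rewrite leNgt; apply/negP => lt; have [i im] := covered (phi q + al q); apply/negP.
  have /andP[ai aip] := al_range im; have := hp i im; have := hq i im.
  by move=> *; apply: arc_far; lra.
pose c := phi p + al p.
pose h i : R := if phi i - al i <= c then sin (phi i - c) / cos (al i) else tan (al i) + (phi i - al i - c).
have hpE : h p = - tan (al p).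
  rewrite /h /c (_ : phi p - al p <= _); last by lra.
  by rewrite (_ : phi p - _ = - al p); [rewrite sinN mulNr|ring].
have hqE : h q = tan (al q) + (phi q - al q - c).
  by rewrite /h; case: (leP (phi q - al q) c) => // le; exfalso; rewrite /c in le; lra.
have tvle : tv m h <= \sum_(i < m) dist i i.+1.
  apply: ler_sum => i _; have im := ltn_ord i; have := ov i im; rewrite ler_norml => /andP[v1 v2].
  have /andP[ai aip] := al_range (ltnW im); have /andP[ai' aip'] := al_range im.
  rewrite ler_norml lerNl opprB; apply/andP; split.
    by rewrite distC; apply: height_step => //; [exact: ltnW|lra].
  by apply: height_step => //; [exact: ltnW|lra].
apply: le_trans tvle.
have : h q - h p <= tv m h.
  have b (x y : nat) : (x <= y)%N -> (y <= m)%N -> `|h y - h x| <= tv m h.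
    move=> xy ym; apply: le_trans (tv_split h xy (leqnn y) (leqnn y) ym).
    by have := normr_ge0 (h x - h 0%N); have := normr_ge0 (h m - h y); rewrite subrr normr0; lra.
  apply: le_trans (ler_norm _) _; have [le|le] := leqP p q; first exact: b.
  by rewrite distrC; apply: b => //; exact: ltnW.
have := tan_double_ge ap app; have := tan_double_ge aq aqp.
rewrite hpE hqE /c; lra.
Qed.

Lemma polar_path_length : pi + 2 <= \sum_(i < m) dist i i.+1.
Proof.
have [[c cm far]|no] := pselect (exists2 c, (c < m)%N & al c + al c.+1 <= `|phi c.+1 - phi c|).
  exact: length_with_crossing far.
apply: length_without_crossing => i im; rewrite leNgt; apply/negP => lt.
by apply: no; exists i => //; exact: ltW.
Qed.

End polar_path.

Section open_lists.
Variables (R : realType).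
Local Notation vec := 'rV[R]_2.
Implicit Types (p q u : vec) (c s t : seq vec).

Definition inspects c := forall u, enorm u = 1 -> exists2 p, p \in c & 1 < edot u p.
Definition nested p q := forall u, enorm u = 1 -> 1 < edot u p -> 1 < edot u q.

Definition edist p q : R := enorm (q - p).

Lemma edist_triangle q p p' : edist p p' <= edist p q + edist q p'.
Proof. by rewrite /edist (_ : p' - p = (q - p) + (p' - q)) ?enorm_triangle// [RHS]addrC subrKA. Qed.

Lemma edist_ge0 p q : 0 <= edist p q. Proof. exact: enorm_ge0. Qed.

Definition olen c : R := if c is p :: s then psum edist p s else 0.

Lemma olen_del c1 y z c2 :
  olen (c1 ++ z :: c2) <= olen (c1 ++ y :: z :: c2) /\ olen (c1 ++ y :: c2) <= olen (c1 ++ y :: z :: c2).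
Proof.
have tl : psum edist y c2 <= edist y z + psum edist z c2.
  case: c2 => [|w c2] /=; first by rewrite addr0 edist_ge0.
  by rewrite addrA lerD2r edist_triangle.
case: c1 => [|p c1] /=; first by rewrite lerDr edist_ge0.
rewrite !psum_cat /= !lerD2l; split; first by rewrite addrA lerD2r edist_triangle.
exact: tl.
Qed.

Lemma psum_nth d p t :
  psum edist p t = \sum_(i < size t) edist (nth d (p :: t) i) (nth d (p :: t) i.+1).
Proof.
elim: t p => [|q t IH] p /=; first by rewrite big_ord0.
by rewrite big_ord_recl IH.
Qed.

Lemma not_path (e : rel vec) p t : ~~ path e p t ->
  exists c1 y z c2, p :: t = c1 ++ y :: z :: c2 /\ ~~ e y z.
Proof.
elim: t p => [//|q t IH] p /=; rewrite negb_and => /orP[h|/IH[c1 [y [z [c2 [E h]]]]]].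
  by exists [::], p, q, t.
by exists (p :: c1), y, z, c2; rewrite E.
Qed.

Definition incomparable : rel vec := fun p q => `[< ~ nested p q /\ ~ nested q p >].

Lemma inspects_del c1 y z c2 x x' : (forall w, w \in [:: y; z] -> w = x \/ w = x') ->
  nested x x' -> inspects (c1 ++ y :: z :: c2) -> inspects (c1 ++ x' :: c2).
Proof.
move=> yz nest ins u u1; have [p pc hp] := ins u u1.
have [px|px] := eqVneq p x.
  by exists x'; [rewrite mem_cat mem_head orbT|apply: nest => //; rewrite -px].
exists p => //; move: pc; rewrite !mem_cat !inE => /orP[->//|].
rewrite orbA => /orP[h|->]; last by rewrite !orbT.
have [|pe|->] := yz p; first by rewrite !inE.
  by rewrite pe eqxx in px.
by rewrite eqxx orbT.
Qed.

(** Deleting a vertex whose view is contained in that of a neighbour loses no direction and does not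
    lengthen the path. *)
Lemma reduce_path c : inspects c -> exists p t,
  [/\ inspects (p :: t), path incomparable p t & olen (p :: t) <= olen c].
Proof.
have [n] := ubnP (size c); elim: n c => // n IH [|p t] sz ins.
  have [|//] := ins (vec2 1 0); by rewrite enorm_vec2// expr1n expr0n addr0.
have [pe|/not_path[c1 [y [z [c2 [E]]]]]] := boolP (path incomparable p t); first by exists p, t.
rewrite E in sz ins *; have [d1 d2] := olen_del c1 y z c2.
have step x x' : (forall w, w \in [:: y; z] -> w = x \/ w = x') -> nested x x' ->
    olen (c1 ++ x' :: c2) <= olen (c1 ++ y :: z :: c2) ->
    exists p t, [/\ inspects (p :: t), path incomparable p t & olen (p :: t) <= olen (c1 ++ y :: z :: c2)].
  move=> yz nest le; have [|q [s [h1 h2 h3]]] := IH (c1 ++ x' :: c2) _ (inspects_del yz nest ins).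
    by move: sz; rewrite !size_cat /=; lia.
  by exists q, s; split => //; exact: le_trans h3 le.
move=> /asboolPn h; have [yz|nyz] := pselect (nested y z).
  by apply: (step y z) => // w; rewrite !inE => /orP[/eqP->|/eqP->]; [left|right].
apply: (step z y) => //; last by apply: contrapT => h'; apply: h.
by move=> w; rewrite !inE => /orP[/eqP->|/eqP->]; [right|left].
Qed.

Lemma polar_of_vec p : 1 < enorm p -> exists phi a,
  [/\ 0 < a < pi / 2, p 0 0 = cos phi / cos a & p 0 1 = sin phi / cos a].
Proof.
move=> p1; have [r [psi [r0 _ xE yE]]] := polar_ex (p 0 0) (p 0 1).
have r1 : 1 < r.
  have : enorm p ^+ 2 = r ^+ 2.
    by rewrite enorm_sqr edot2 xE yE -[RHS]mulr1 -(cos2Dsin2 psi); ring.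
  by have := enorm_ge0 p; nra.
have [a [a0 ap ca _]] := sec_angle (ltW r1).
exists psi, a; rewrite ca invrK xE yE ![r * _]mulrC ap andbT; split => //.
rewrite lt_neqAle a0 andbT; apply/eqP => e; move: ca; rewrite -e cos0 => /eqP.
by rewrite eq_sym invr_eq1 gt_eqF.
Qed.

(** Real angles rather than angles modulo [2 * pi] record how the path winds around the disc. *)
Lemma lift_angles (f : nat -> R) (x0 : R) : cos x0 = cos (f 0%N) -> sin x0 = sin (f 0%N) ->
  exists phi : nat -> R, [/\ phi 0%N = x0, (forall i, `|phi i.+1 - phi i| <= pi) &
    forall i, cos (phi i) = cos (f i) /\ sin (phi i) = sin (f i)].
Proof.
move=> c0 s0; pose g (x : R) := projT1 (cid (angle_mod x)).
have gP (x : R) : [/\ `|g x| <= pi, cos (g x) = cos x & sin (g x) = sin x] by rewrite /g; case: (cid _).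
pose fix phi i := if i is j.+1 then phi j + g (f j.+1 - phi j) else x0.
exists phi; split => //.
  by move=> i /=; rewrite addrC addKr; have [] := gP (f i.+1 - phi i).
elim=> [|i [IHc IHs]] //=; have [_ c1 s1] := gP (f i.+1 - phi i).
by rewrite cosD sinD c1 s1 -cosD -sinD addrC subrK.
Qed.

Lemma cos_sin_shift (x : R) (k : nat) : cos (x + pi *+ 2 *+ k) = cos x /\ sin (x + pi *+ 2 *+ k) = sin x.
Proof.
elim: k => [|k [h1 h2]]; first by rewrite mulr0n addr0.
by rewrite mulrSr addrA cosD2pi sinD2pi.
Qed.

Lemma inspecting_path_length p t : inspects (p :: t) -> path incomparable p t ->
  pi + 2 <= olen (p :: t).
Proof.
move=> ins pth; have pi0 := pi_gt0 R.
pose m := size t; pose Q i := nth p (p :: t) i.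
have inc i : (i < m)%N -> incomparable (Q i) (Q i.+1) by move=> im; move/(pathP p): pth => /(_ i im).
have big i : (i <= m)%N -> 1 < enorm (Q i).
  suff h u q : enorm u = 1 -> 1 < edot u q -> 1 < enorm q.
    case: i => [|i] im; last first.
      have /asboolP[_ /existsNP[u /not_implyP[u1 /not_implyP[uq _]]]] := inc i im; exact: h u1 uq.
    case: (posnP m) => [m0|mp]; last first.
      have /asboolP[/existsNP[u /not_implyP[u1 /not_implyP[uq _]]] _] := inc 0%N mp; exact: h u1 uq.
    have u1 : enorm (vec2 1 0 : vec) = 1 by rewrite enorm_vec2// expr1n expr0n addr0.
    have [q] := ins _ u1; move: m0; rewrite /m => /size0nil ->; rewrite inE => /eqP ->; exact: h u1.
  by move=> u1 uq; have := cauchy_schwarz u q; rewrite u1 mul1r; apply: lt_le_trans.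
have pol i : exists fa : R * R, (i <= m)%N ->
    [/\ 0 < fa.2 < pi / 2, Q i 0 0 = cos fa.1 / cos fa.2 & Q i 0 1 = sin fa.1 / cos fa.2].
  have [im|im] := leqP i m; last by exists (0, 0).
  by have [f [a h]] := polar_of_vec (big i im); exists (f, a).
have [fa faP] := choice pol.
pose f i := (fa i).1; pose al i := (fa i).2.
(* Adding full turns brings all arcs to nonnegative angles, as the samples [2 * pi * k / N]
   require. *)
have [M hM] : exists M : nat, (m.+1)%:R * pi + `|f 0%N| + pi <= pi *+ 2 *+ M.
  exists (Num.truncn ((m.+1)%:R * pi + `|f 0%N| + pi)).+1.
  apply: (le_trans (ltW (truncnS_gt _))); rewrite -[leRHS]mulr_natl ler_peMr//.
  by rewrite mulr2n; have := pi_gt_3_13 R; lra.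
have [phi [phi0 phi_step phiE]] := @lift_angles f (f 0%N + pi *+ 2 *+ M) (cos_sin_shift _ _).1 (cos_sin_shift _ _).2.
have low i : phi 0%N - i%:R * pi <= phi i.
  elim: i => [|i IH]; first by rewrite mul0r subr0.
  by have := phi_step i; rewrite ler_norml -natr1 => /andP[h1 h2]; lra.
have al_range i : (i <= m)%N -> 0 < al i < pi / 2 by move=> /faP[].
have Q0 i : (i <= m)%N -> Q i 0 0 = cos (phi i) / cos (al i) by move=> /faP[_ h _]; rewrite h (phiE i).1.
have Q1 i : (i <= m)%N -> Q i 0 1 = sin (phi i) / cos (al i) by move=> /faP[_ _ h]; rewrite h (phiE i).2.
have ca i : (i <= m)%N -> 0 < cos (al i).
  by move=> /al_range/andP[h1 h2]; apply: cos_gt0_pihalf; apply/andP; split; lra.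
have seesE i u (t0 : R) : (i <= m)%N -> u = vec2 (cos t0) (sin t0) -> (1 < edot u (Q i)) = sees (phi i) (al i) t0.
  move=> im ->; rewrite edot_vec2 Q0// Q1// /sees cosB mulrA mulrA -mulrDl ltr_pdivlMr ?ca//.
  by rewrite mul1r.
have dir u : enorm u = 1 -> exists t0 : R, u = vec2 (cos t0) (sin t0).
  move=> /enorm1_sqr u1; have [r [psi [r0 _ xE yE]]] := polar_ex (u 0 0) (u 0 1).
  have r1 : r = 1.
    have : r ^+ 2 * (cos psi ^+ 2 + sin psi ^+ 2) = 1 by rewrite -u1 edot2 xE yE; ring.
    by rewrite cos2Dsin2; nra.
  exists psi; apply/rowP => j; rewrite mxE; case: ifPn => [/eqP ->|j0]; first by rewrite xE r1 mul1r.
  have -> : j = 1 by apply/val_inj; case: j j0 => -[|[|]].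
  by rewrite yE r1 mul1r.
have unit (t0 : R) : enorm (vec2 (cos t0) (sin t0)) = 1 by rewrite enorm_vec2// cos2Dsin2.
have olenE : olen (p :: t) = \sum_(i < m) edist (Q i) (Q i.+1).
  exact: psum_nth.
rewrite olenE; apply: (@polar_path_length R m phi al (fun i j => edist (Q i) (Q j))) => //.
- move=> i im; have := low i; rewrite phi0.
  have /andP[_ h2] := al_range i im; have := ler_norm (- f 0%N); rewrite normrN.
  have : i%:R * pi <= m.+1%:R * pi :> R by apply: ler_wpM2r; [exact: ltW|rewrite ler_nat leqW].
  lra.
- by move=> i j; rewrite /edist -enormN opprB.
- move=> i j im jm psi.
  have u1 : enorm (vec2 (- sin psi) (cos psi)) = 1 by rewrite enorm_vec2// sqrrN addrC cos2Dsin2.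
  have := cauchy_schwarz (vec2 (- sin psi) (cos psi)) (Q j - Q i).
  rewrite u1 mul1r edotBr !edot_vec2 !Q0// !Q1//; apply: le_trans.
  by rewrite !sinB le_eqVlt; apply/orP; left; apply/eqP; ring.
- move=> t0; have [q qc hq] := ins _ (unit t0).
  have im : (index q (p :: t) <= m)%N by rewrite -ltnS -[m.+1]/(size (p :: t)) index_mem.
  exists (index q (p :: t)) => //; rewrite -(@seesE _ (vec2 (cos t0) (sin t0)))//.
  by rewrite /Q nth_index.
- move=> i im; have /asboolP[h1 h2] := inc i im; have im' := ltnW im; split.
    move: h1 => /existsNP[u /not_implyP[u1 /not_implyP[uq nq]]]; have [t0 uE] := dir u u1.
    by exists t0; rewrite -!(@seesE _ u)// uq; apply/negP.
  move: h2 => /existsNP[u /not_implyP[u1 /not_implyP[uq nq]]]; have [t0 uE] := dir u u1.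
  by exists t0; rewrite -!(@seesE _ u)// uq; apply/negP.
Qed.

Lemma planar_inradius_open (m : nat) (P : nat -> vec) r :
  0 <= r -> every_direction (has_height m r) P -> (pi + 2) * r <= plen m P.
Proof.
move=> r0 hP; apply: scale_limit => //; [by have := pi_gt0 R; lra|exact: plen_ge0|].
move=> c c0 cr; pose L := [seq c *: P i.+1 | i <- iota 0 m].
have ins : inspects (c *: P 0%N :: L).
  move=> u u1; have [i im hi] := hP u u1.
  have key : 1 < edot u (c *: P i) by rewrite edotZr; apply: lt_le_trans cr _; rewrite ler_pM2l.
  case: i im {hi} key => [|i] im key; first by exists (c *: P 0%N); rewrite ?mem_head.
  exists (c *: P i.+1) => //; rewrite inE; apply/orP; right.
  by apply/mapP; exists i => //; rewrite mem_iota.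
have [p [t [h1 h2 h3]]] := reduce_path ins.
apply: le_trans (inspecting_path_length h1 h2) _; apply: (le_trans h3).
rewrite /olen /L (@psum_map _ _ _ (fun i => c *: P i)) add0n big_mkord /plen mulr_sumr.
apply: ler_sum => i _; rewrite /edist -scalerBr /enorm edotZl edotZr mulrA sqrtrM ?mulr_ge0 ?(ltW c0)//.
by rewrite -expr2 sqrtr_sqr ger0_norm ?(ltW c0).
Qed.

End open_lists.

(** * Induction on the dimension and conclusion *)

Section lower_bounds.
Variable R : realType.

Lemma has_height_spread (n m : nat) r (P : nat -> 'rV[R]_n) :
  every_direction (has_height m r) P -> every_direction (has_spread m (2 * r)) P.
Proof.
move=> hP u u1; have [i im hi] := hP u u1; have [|j jm hj] := hP (- u); first by rewrite enormN.
by exists i, j; split => //; rewrite edotNl in hj; lra.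
Qed.

Lemma length_dim2 (m : nat) (closed : bool) W (Phi : (nat -> R) -> Prop) (c : R) : 0 <= W ->
  (forall n (P : nat -> 'rV[R]_n), every_direction Phi P -> every_direction (has_spread m W) P) ->
  (forall P : nat -> 'rV[R]_2, every_direction Phi P -> (closed -> P m = P 0%N) -> c <= plen m P ^+ 2) ->
  forall k (P : nat -> 'rV[R]_k.+2), every_direction Phi P -> (closed -> P m = P 0%N) ->
    c + k%:R * ((if closed then 16 else 9) * W ^+ 2) <= plen m P ^+ 2.
Proof.
move=> W0 spread base; elim=> [|k IH] P hP clo; first by rewrite mul0r addr0; exact: base.
have := @length_step R k m closed W Phi _ W0 (spread _) IH P hP clo.
by rewrite -[k.+1%:R]natr1 mulrDl mul1r addrA.
Qed.

Lemma length_dim3 (m : nat) (closed : bool) W (Phi : (nat -> R) -> Prop) (c : R) : 0 <= W ->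
  (forall n (P : nat -> 'rV[R]_n), every_direction Phi P -> every_direction (has_spread m W) P) ->
  (forall P : nat -> 'rV[R]_3, every_direction Phi P -> (closed -> P m = P 0%N) -> c <= plen m P ^+ 2) ->
  forall k (P : nat -> 'rV[R]_k.+3), every_direction Phi P -> (closed -> P m = P 0%N) ->
    c + k%:R * ((if closed then 16 else 9) * W ^+ 2) <= plen m P ^+ 2.
Proof.
move=> W0 spread base; elim=> [|k IH] P hP clo; first by rewrite mul0r addr0; exact: base.
have := @length_step R k.+1 m closed W Phi _ W0 (spread _) IH P hP clo.
by rewrite -[k.+1%:R]natr1 mulrDl mul1r addrA.
Qed.

Lemma sqrt_mul_le (K W L : R) : 0 <= W -> 0 <= L -> K * W ^+ 2 <= L ^+ 2 -> Num.sqrt K * W <= L.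
Proof.
move=> W0 L0 h; rewrite -[W]ger0_norm// -sqrtr_sqr mulrC -sqrtrM ?sqr_ge0// mulrC.
by rewrite -[leRHS]ger0_norm// -sqrtr_sqr ler_wsqrtr.
Qed.

Lemma sup_limit (K w L : R) : 0 <= K -> 0 <= L -> (forall W, 0 <= W -> W < w -> K * W <= L) -> K * w <= L.
Proof.
move=> K0 L0 h; have [w0|w0] := leP w 0; first by apply: le_trans L0; rewrite mulr_ge0_le0.
rewrite leNgt; apply/negP => lt.
have Kp : 0 < K.
  by rewrite lt_neqAle K0 andbT; apply/eqP => e; move: lt; rewrite -e mul0r ltNge L0.
have e : L / K < w by rewrite ltr_pdivrMr// mulrC.
have q0 : 0 <= L / K by rewrite divr_ge0.
have := h (2^-1 * (L / K + w)).
have -> : K * (2^-1 * (L / K + w)) = 2^-1 * (L + K * w) by field; rewrite gt_eqF.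
by move=> h'; have : 2^-1 * (L + K * w) <= L by [apply: h'; lra]; lra.
Qed.

End lower_bounds.

Unset Implicit Arguments.

Theorem theorem8p5 (R : realType) (k : nat) (a b : R)
    (gamma : R -> 'rV[R]_(2 + k)) :
  (1 <= k)%N -> a < b ->
  {within `[a, b], continuous gamma} ->
  rectifiable a b gamma ->
  let L := curve_length a b gamma in
  let w := curve_width a b gamma in
  let r := curve_inradius a b gamma in
  [/\ Num.sqrt ((22782%:R / 10000%:R) ^+ 2 + 9 * k%:R) * w <= L,
      Num.sqrt ((pi + 2) ^+ 2 + 36 * k%:R) * r <= L &
      (gamma a = gamma b ->
         Num.sqrt (pi ^+ 2 + 16 * k%:R) * w <= L /\
         Num.sqrt ((6 * Num.sqrt 3) ^+ 2 + 64 * (k%:R - 1)) * r <= L)].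
Proof.
case: k gamma => // k gamma _ ab _ rec L w r; have pi0 := pi_gt0 R.
have L0 : 0 <= L.
  by have [m [P [h _ _ _ _]]] := inscribed_polygon ab rec ltr01; exact: le_trans (plen_ge0 m P) h.
have width (closed : bool) (K : R) : (closed -> gamma a = gamma b) ->
    (forall W m (P : nat -> 'rV[R]_k.+3), 0 <= W -> every_direction (has_spread m W) P ->
       (closed -> P m = P 0%N) -> K * W ^+ 2 <= plen m P ^+ 2) -> Num.sqrt K * w <= L.
  move=> clo h; apply: sup_limit => //.
  move=> W W0 Ww; have [m [P [PL cP hP]]] := width_polygon ab rec Ww.
  apply: le_trans PL; apply: sqrt_mul_le => //; first exact: plen_ge0.
  by apply: h => // /clo/cP.
have inradius (closed : bool) (K : R) : (closed -> gamma a = gamma b) ->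
    (forall rho m (P : nat -> 'rV[R]_k.+3), 0 <= rho -> every_direction (has_height m rho) P ->
       (closed -> P m = P 0%N) -> K * rho ^+ 2 <= plen m P ^+ 2) -> Num.sqrt K * r <= L.
  move=> clo h; apply: sup_limit => //.
  move=> rho rho0 rr.
  (* The supremum of the empty set is 0, so [0 <= rho < r] provides at least one sphere. *)
  have ne : inradii a b gamma !=set0.
    apply/set0P/eqP => e; move: rr; rewrite /r /curve_inradius e sup0 ltNge; exact/negP/negPn.
  have [rho' hr' lt'] : exists2 rho', inradii a b gamma rho' & rho < rho'.
    apply: contrapT => no; move: rr; apply/negP; rewrite -leNgt; apply: ge_sup => // x hx.
    by rewrite leNgt; apply/negP => lt; apply: no; exists x.
  have [m [P [PL cP hP]]] := inradius_polygon ab rec hr' lt'.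
  apply: le_trans PL; apply: sqrt_mul_le => //; first exact: plen_ge0.
  by apply: h => // /clo/cP.
have sq (c x y : R) : 0 <= c -> 0 <= x -> c * x <= y -> c ^+ 2 * x ^+ 2 <= y ^+ 2.
  by move=> c0 x0 h; rewrite -exprMn ler_pXn2r ?nnegrE ?mulr_ge0// (le_trans _ h)// mulr_ge0.
have open_width (c : R) : 0 <= c -> c <= 11391%:R / 5000%:R -> Num.sqrt (c ^+ 2 + 9 * k.+1%:R) * w <= L.
  move=> c0 cle; apply: (width false) => // W m P W0 hP _.
  have := @length_dim2 R m false W (has_spread m W) (c ^+ 2 * W ^+ 2) W0 (fun _ _ h => h) _ k.+1 P hP.
  rewrite (_ : c ^+ 2 * W ^+ 2 + k.+1%:R * (9 * W ^+ 2) = (c ^+ 2 + 9 * k.+1%:R) * W ^+ 2); last by ring.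
  apply=> // Q hQ _; apply: sq => //.
  by apply: le_trans (planar_width_open W0 hQ); apply: ler_wpM2r.
split.
- apply: open_width; lra.
- apply: (inradius false) => // rho m P rho0 hP _.
  have W0 : 0 <= 2 * rho by rewrite mulr_ge0.
  have := @length_dim2 R m false (2 * rho) (has_height m rho) ((pi + 2) ^+ 2 * rho ^+ 2) W0
     (fun n P => @has_height_spread R n m rho P) _ k.+1 P hP.
  rewrite (_ : (pi + 2) ^+ 2 * rho ^+ 2 + k.+1%:R * (9 * (2 * rho) ^+ 2) = ((pi + 2) ^+ 2 + 36 * k.+1%:R) * rho ^+ 2); last by ring.
  apply=> // Q hQ _; apply: sq => //; first lra.
  exact: planar_inradius_open.
move=> clo; split.
  apply: (width true) => // W m P W0 hP cP.
  have := @length_dim2 R m true W (has_spread m W) (pi ^+ 2 * W ^+ 2) W0 (fun _ _ h => h) _ k.+1 P hP cP.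
  rewrite (_ : pi ^+ 2 * W ^+ 2 + k.+1%:R * (16 * W ^+ 2) = (pi ^+ 2 + 16 * k.+1%:R) * W ^+ 2); last by ring.
  apply=> // Q hQ cQ; apply: sq => //; first exact: ltW.
  by apply: planar_width_closed => //; exact: cQ.
apply: (inradius true) => // rho m P rho0 hP cP.
have W0 : 0 <= 2 * rho by rewrite mulr_ge0.
(* The base is dimension 3, so only [k] of the [k.+1] extra dimensions are dropped. *)
have := @length_dim3 R m true (2 * rho) (has_height m rho) ((6 * Num.sqrt 3) ^+ 2 * rho ^+ 2) W0
   (fun n P => @has_height_spread R n m rho P) _ k P hP cP.
rewrite (_ : _ + k%:R * (16 * (2 * rho) ^+ 2) = ((6 * Num.sqrt 3) ^+ 2 + 64 * (k.+1%:R - 1)) * rho ^+ 2); last first.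
  by rewrite -[k.+1%:R]natr1; ring.
apply=> // Q hQ cQ; apply: sq => //.
by apply: closed_inradius_space => //; exact: cQ.
Qed.
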